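(* Let $a\in\mathbb C$ and $\widetilde M\in\widetilde{\mathcal O}_a$, and put $M=T(\widetilde M)$, $\overline M=\overline T(\widetilde M)$, $M^\diamond=T^\diamond(\widetilde M)$, $\overline M^\diamond=\overline T^\diamond(\widetilde M)$. Then for every $j\ge0$: (i) $T(H_j(\widetilde{\mathfrak u}_-;\widetilde M))\cong H_j(\mathfrak u_-;M)$ as $\mathfrak l$-modules; (ii) $\overline T(H_j(\widetilde{\mathfrak u}_-;\widetilde M))\cong H_j(\overline{\mathfrak u}_-;\overline M)$ as $\overline{\mathfrak l}$-modules; (iii) $T^\diamond(H_j(\widetilde{\mathfrak u}_-;\widetilde M))\cong H_j(\mathfrak u^\diamond_-;M^\diamond)$ as $\mathfrak l^\diamond$-modules; (iv) $\overline T^\diamond(H_j(\widetilde{\mathfrak u}_-;\widetilde M))\cong H_j(\overline{\mathfrak u}^\diamond_-;\overline M^\diamond)$ as $\overline{\mathfrak l}^\diamond$-modules.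
   Context: All is over $\mathbb C$; $\mathbb Z_+=\{0,1,2,\dots\}$, $\mathbb N=\{1,2,\dots\}$. $H_j(\mathcal G;V)$ denotes the $j$th homology group of a Lie superalgebra $\mathcal G$ with coefficients in a $\mathcal G$-module $V$. **Algebras.** Fix $k\in\mathbb Z_+$, $\mathbb K=\{\bar1,\dots,\bar k\}$ (empty if $k=0$), and let $\widetilde{\mathbb I}=\mathbb K\sqcup\frac12\mathbb Z$ be totally ordered by $\cdots<-1<-\frac12<0<\bar1<\cdots<\bar k<\frac12<1<\cdots$. Put $\mathbb I=\mathbb K\cup\mathbb Z$, $\overline{\mathbb I}=\mathbb K\cup(-\mathbb Z_+)\cup(\frac12+\mathbb Z_+)$, $\mathbb I^\diamond=\mathbb K\cup(-\frac12-\mathbb Z_+)\cup\mathbb N$, $\overline{\mathbb I}^\diamond=\mathbb K\cup(\frac12+\mathbb Z)$. Let $\widetilde V$ be the superspace with basis $v_r$ ($r\in\widetilde{\mathbb I}$), $v_r$ even for $r\in\mathbb Z\cup\mathbb K$ and odd for $r\in\frac12+\mathbb Z$; $\mathfrak{gl}(\widetilde V)$ is the Lie superalgebra of matrices $(a_{rs})_{r,s\in\widetilde{\mathbb I}}$ with finitely many nonzero entries. Let $\widetilde{\mathfrak g}=\mathfrak{gl}(\widetilde V)\oplus\mathbb CK$ be its central extension by the 2-cocycle $\alpha(A,B)=\mathrm{Str}([\mathfrak J,A]B)$, $\mathfrak J=\sum_{r\le0}E_{rr}$, and write $\widehat E_{rs}\in\widetilde{\mathfrak g}$ for the elementary matrix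 $E_{rs}$ viewed in $\mathfrak{gl}(\widetilde V)\oplus\mathbb CK$. The subalgebras generated by $K$ and the $\widehat E_{rs}$ with $r,s$ in $\mathbb I,\overline{\mathbb I},\mathbb I^\diamond,\overline{\mathbb I}^\diamond$ are $\mathfrak g,\overline{\mathfrak g},\mathfrak g^\diamond,\overline{\mathfrak g}^\diamond$. For each of the five algebras, with index set $X$, the Cartan subalgebra ($\widetilde{\mathfrak h},\mathfrak h,\overline{\mathfrak h},\mathfrak h^\diamond,\overline{\mathfrak h}^\diamond$) is spanned by $K$ and $\widehat E_{rr}$, $r\in X$, the Borel subalgebra ($\widetilde{\mathfrak b},\mathfrak b,\overline{\mathfrak b},\mathfrak b^\diamond,\overline{\mathfrak b}^\diamond$) by $K$ and $\widehat E_{rs}$, $r\le s$ in $X$; $\epsilon_r,\Lambda_0$ are the weights with $\epsilon_r(\widehat E_{ss})=\delta_{rs}$, $\epsilon_r(K)=0$, $\Lambda_0(\widehat E_{ss})=0$, $\Lambda_0(K)=1$; the simple roots of $\widetilde{\mathfrak g}$ ($\widetilde\Pi$) are $\epsilon_r-\epsilon_s$ with $r<s$ adjacent in $\widetilde{\mathbb I}$, and similarly for the other algebras. **Levi subalgebras.** Fix a subset $Y_0\subseteq\{\epsilon_{\bar j}-\epsilon_{\overline{j+1}}:1\le j\le k-1\}$. The Levi subalgebra $\widetilde{\mathfrak l}$ of $\widetilde{\mathfrak g}$ is the standard Levi subalgebra attached to $Y_0$ together with all simple roots $\epsilon_r-\epsilon_s$ with $r,s\in\frac12\mathbb Z$ and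 ($r<s\le0$ or $0<r<s$); $\mathfrak l,\overline{\mathfrak l},\mathfrak l^\diamond,\overline{\mathfrak l}^\diamond$ are defined in the same way for the other four algebras. The parabolic subalgebra $\widetilde{\mathfrak p}=\widetilde{\mathfrak l}+\widetilde{\mathfrak b}$ has nilradical $\widetilde{\mathfrak u}$ and opposite nilradical $\widetilde{\mathfrak u}_-$; $\mathfrak u_-,\overline{\mathfrak u}_-,\mathfrak u^\diamond_-,\overline{\mathfrak u}^\diamond_-$ are the analogous opposite nilradicals for $\mathfrak g,\overline{\mathfrak g},\mathfrak g^\diamond,\overline{\mathfrak g}^\diamond$. $L(\widetilde{\mathfrak l},\mu)$ is the irreducible $\widetilde{\mathfrak l}$-module of highest weight $\mu$. **Dominant weights.** For $a\in\mathbb C$, $P_a^+$ is the set of tuples $\lambda=(a,\lambda^0_1,\dots,\lambda^0_k;\lambda^-,\lambda^+)$ with $\lambda_i^0\in\mathbb C$, $\lambda^\pm$ partitions, and $\lambda^0_j-\lambda^0_{j+1}\in\mathbb Z_+$ whenever $\epsilon_{\bar j}-\epsilon_{\overline{j+1}}\in Y_0$; $P^+=\bigcup_aP_a^+$. With $\mu'$ the conjugate partition, $\langle b\rangle=\max\{b,0\}$, $\theta(\mu)_{i-1/2}=\langle\mu_i'-i+1\rangle$, $\theta(\mu)_i=\langle\mu_i-i\rangle$ ($i\in\mathbb N$), associate to $\lambda$ the weight $\widetilde\lambda=\sum_i\lambda^0_i\epsilon_{\bar i}+a\Lambda_0-\sum_{r\in\frac12\mathbb N}\theta((\lambda^-)')_r\epsilon_{-r+\frac12}+\sum_{r\in\frac12\mathbb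 N}\theta(\lambda^+)_r\epsilon_r$. **Category.** $\widetilde{\mathcal O}_a$ is the category of ($\mathbb Z_2$-graded) $\widetilde{\mathfrak g}$-modules $\widetilde M$ on which $K$ acts by $a$, that are $\widetilde{\mathfrak h}$-semisimple with finite-dimensional weight spaces, such that (i) $\widetilde M$ is over $\widetilde{\mathfrak l}$ a direct sum of modules $L(\widetilde{\mathfrak l},\widetilde\mu)$, $\mu\in P^+$; (ii) there are finitely many $\lambda_1,\dots,\lambda_s\in P^+$ such that every weight of $\widetilde M$ lies in $\widetilde\lambda_i-\sum_{\alpha\in\widetilde\Pi}\mathbb Z_+\alpha$ for some $i$. **Functors.** Regard $\mathfrak h^*,\overline{\mathfrak h}^*,\mathfrak h^{\diamond*},\overline{\mathfrak h}^{\diamond*}$ as subspaces of $\widetilde{\mathfrak h}^*$ (weights vanishing on $\widehat E_{rr}$ for $r$ outside the respective index set). For an $\widetilde{\mathfrak h}$-semisimple $\widetilde M=\bigoplus_\gamma\widetilde M_\gamma$ put $T(\widetilde M)=\bigoplus_{\gamma\in\mathfrak h^*}\widetilde M_\gamma$, $\overline T(\widetilde M)=\bigoplus_{\gamma\in\overline{\mathfrak h}^*}\widetilde M_\gamma$, $T^\diamond(\widetilde M)=\bigoplus_{\gamma\in\mathfrak h^{\diamond*}}\widetilde M_\gamma$, $\overline T^\diamond(\widetilde M)=\bigoplus_{\gamma\in\overline{\mathfrak h}^{\diamond*}}\widetilde M_\gamma$. If $\widetilde M$ is a $\widetilde{\mathfrak g}$-module (resp. $\widetilde{\mathfrak l}$-module)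 these are modules over $\mathfrak g,\overline{\mathfrak g},\mathfrak g^\diamond,\overline{\mathfrak g}^\diamond$ (resp. $\mathfrak l,\overline{\mathfrak l},\mathfrak l^\diamond,\overline{\mathfrak l}^\diamond$). *)

(* Defs.v *)
From HB Require Import structures.
From mathcomp Require Import all_boot all_order all_algebra.
From mathcomp Require Import generic_quotient ring_quotient.
From mathcomp Require Import finmap monalg ring zify.
From mathcomp Require Import boolp reals complex.
Set Implicit Arguments. Unset Strict Implicit. Unset Printing Implicit Defensive.
Import GRing.Theory.
Local Open Scope ring_scope.
Local Open Scope quotient_scope.

Section LinearMaps.
Variables (F : fieldType) (U V : lmodType F) (f : U -> V).
Hypothesis lf : linear f.

Lemma linE0 : f 0 = 0.
Proof. by have := lf (-1) 0 0; rewrite scaler0 addr0 scaleN1r addNr. Qed.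
Lemma linED u v : f (u + v) = f u + f v.
Proof. by have := lf 1 u v; rewrite !scale1r. Qed.
Lemma linEZ a u : f (a *: u) = a *: f u.
Proof. by have := lf a u 0; rewrite !addr0 linE0 addr0. Qed.
Lemma linEN u : f (- u) = - f u.
Proof. by rewrite -scaleN1r linEZ scaleN1r. Qed.
Lemma linEB u v : f (u - v) = f u - f v.
Proof. by rewrite linED linEN. Qed.
Lemma linE_sum I (r : seq I) (P : pred I) (G : I -> U) :
  f (\sum_(i <- r | P i) G i) = \sum_(i <- r | P i) f (G i).
Proof. by apply: (big_morph f linED linE0). Qed.
End LinearMaps.

Section Subspaces.
Variables (F : fieldType) (V : lmodType F).

Record subspace := Subspace {
  spset :> V -> Prop;
  sp0 : spset 0;
  spP : forall a u v, spset u -> spset v -> spset (a *: u + v) }.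

Lemma spD (S : subspace) u v : S u -> S v -> S (u + v).
Proof. by move=> Su Sv; rewrite -[u]scale1r; apply: spP. Qed.
Lemma spZ (S : subspace) a u : S u -> S (a *: u).
Proof. by move=> Su; rewrite -[_ *: _]addr0; apply: spP => //; exact: sp0. Qed.
Lemma spN (S : subspace) u : S u -> S (- u).
Proof. by move=> Su; rewrite -scaleN1r; apply: spZ. Qed.
Lemma spB (S : subspace) u v : S u -> S v -> S (u - v).
Proof. by move=> Su Sv; apply: spD => //; apply: spN. Qed.
Lemma sp_sum (S : subspace) I (r : seq I) (P : pred I) (G : I -> V) :
  (forall i, P i -> S (G i)) -> S (\sum_(i <- r | P i) G i).
Proof. by move=> SG; elim/big_ind: _ => //; [exact: sp0 | exact: spD]. Qed.

Definition spred (S : subspace) : {pred V} := fun v => `[< S v >].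

Lemma spred_closed (S : subspace) : submod_closed (spred S).
Proof.
split=> [|a u v /asboolP Su /asboolP Sv]; apply/asboolP; [exact: sp0 | exact: spP].
Qed.

HB.instance Definition _ (S : subspace) :=
  GRing.isSubmodClosed.Build F V (spred S) (spred_closed S).

Definition lspan_set (P : V -> Prop) (v : V) :=
  forall W : subspace, (forall u, P u -> W u) -> W v.
Lemma lspan0 P : lspan_set P 0.
Proof. by move=> W _; exact: sp0. Qed.
Lemma lspanP P a u v : lspan_set P u -> lspan_set P v -> lspan_set P (a *: u + v).
Proof. by move=> Pu Pv W PW; apply: spP; [exact: Pu | exact: Pv]. Qed.
Definition lspan (P : V -> Prop) := Subspace (lspan0 (P := P)) (@lspanP P).

Lemma lspan_sub (P : V -> Prop) u : P u -> lspan P u.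
Proof. by move=> Pu W PW; exact: PW. Qed.

End Subspaces.

Section Preimage.
Variables (F : fieldType) (U V : lmodType F).

Lemma zero_spP a (u v : V) : u = 0 -> v = 0 -> a *: u + v = 0.
Proof. by move=> -> ->; rewrite scaler0 addr0. Qed.
Definition zero_sp : subspace V := Subspace (erefl 0) zero_spP.

Variables (f : U -> V) (lf : linear f) (W : subspace V).
Lemma preim_sp0 : W (f 0).
Proof. by rewrite (linE0 lf); exact: sp0. Qed.
Lemma preim_spP a u v : W (f u) -> W (f v) -> W (f (a *: u + v)).
Proof. by rewrite lf; apply: spP. Qed.
Definition preim_sp : subspace U := Subspace preim_sp0 preim_spP.

Lemma lspan_ind (P : U -> Prop) :
  (forall u, P u -> W (f u)) -> forall u, lspan P u -> W (f u).
Proof. by move=> h u /(_ preim_sp); apply. Qed.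
End Preimage.

Section SubQuo.
Variables (F : fieldType) (V : lmodType F) (S : subspace V).

Record subsp := SubSp { subsp_val : V; subsp_valP : subsp_val \in spred S }.
HB.instance Definition _ := [isSub for subsp_val].
HB.instance Definition _ := [Choice of subsp by <:].
HB.instance Definition _ := [SubChoice_isSubLmodule of subsp by <:].

Lemma subsp_in (x : subsp) : S (val x).
Proof. by have /asboolP := subsp_valP x. Qed.

Definition subsp_mk (v : V) (Sv : S v) : subsp := SubSp (asboolT Sv : v \in spred S).

Lemma subsp_mkK v (Sv : S v) : val (subsp_mk Sv) = v. Proof. by []. Qed.

Lemma subsp_inj (x y : subsp) : val x = val y -> x = y.
Proof. exact: val_inj. Qed.

Lemma subsp_lin : linear (val : subsp -> V).
Proof. by move=> a x y. Qed.

Definition quo := Quotient.quot (spred S).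
HB.instance Definition _ := GRing.Zmodule.copy quo (Quotient.quot (spred S)).

Definition qpi (v : V) : quo := \pi_(Quotient.quot (spred S))%qT v.
Definition qrepr (q : quo) : V := repr (q : Quotient.quot (spred S)).

Lemma qreprK q : qpi (qrepr q) = q.
Proof. exact: reprK. Qed.

Lemma qpiP u v : qpi u = qpi v <-> S (u - v).
Proof.
split=> [/eqP|Suv].
  by rewrite /qpi -Quotient.idealrBE => /asboolP.
by apply/eqP; rewrite /qpi -Quotient.idealrBE; apply/asboolP.
Qed.

Lemma qpiD : {morph qpi : u v / u + v}.
Proof. by move=> u v; rewrite /qpi; apply: (raddfD (\pi_(Quotient.quot (spred S)))). Qed.

Definition qscale a (q : quo) : quo := qpi (a *: qrepr q).

Lemma qpiZ a u : qpi (a *: u) = qscale a (qpi u).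
Proof.
apply/qpiP; rewrite -scalerBr; apply: spZ; apply/qpiP; by rewrite qreprK.
Qed.

Lemma qscaleA a b q : qscale a (qscale b q) = qscale (a * b) q.
Proof. by rewrite -(qreprK q) -!qpiZ scalerA. Qed.
Lemma qscale1 : left_id 1 qscale.
Proof. by move=> q; rewrite -(qreprK q) -!qpiZ scale1r. Qed.
Lemma qscaleDr : right_distributive qscale +%R.
Proof.
by move=> a p q; rewrite -(qreprK p) -(qreprK q) -qpiD -!qpiZ -qpiD scalerDr.
Qed.
Lemma qscaleDl q : {morph qscale^~ q : a b / a + b}.
Proof. by move=> a b; rewrite -(qreprK q) -!qpiZ -qpiD scalerDl. Qed.

HB.instance Definition _ := GRing.Zmodule_isLmodule.Build F quo
  qscaleA qscale1 qscaleDr qscaleDl.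

Lemma qpi_lin : linear qpi.
Proof. by move=> a u v; rewrite qpiD qpiZ. Qed.

Lemma qpi0 v : qpi v = 0 <-> S v.
Proof. by rewrite -(linE0 qpi_lin) qpiP subr0. Qed.

End SubQuo.

Fact lext_key : unit. Proof. exact: tt. Qed.

Section FreeModule.
Variables (F : fieldType) (K : choiceType).

Definition lext (V : lmodType F) : (K -> V) -> {malg F[K]} -> V :=
  locked_with lext_key (fun f x => \sum_(i <- msupp x) x@_i *: f i).

Lemma lext_def (V : lmodType F) (f : K -> V) x :
  lext f x = \sum_(i <- msupp x) x@_i *: f i.
Proof. by rewrite /lext unlock. Qed.

Lemma lextE (V : lmodType F) (f : K -> V) (d : {fset K}) (x : {malg F[K]}) :
  (msupp x `<=` d)%fset -> lext f x = \sum_(i <- d) x@_i *: f i.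
Proof.
move=> le; rewrite lext_def (big_fset_incl _ le) //= => i _ ni.
by rewrite mcoeff_outdom // scale0r.
Qed.

Lemma lext_lin (V : lmodType F) (f : K -> V) : linear (lext f).
Proof.
move=> a x y.
pose d := (msupp (a *: x + y) `|` (msupp x `|` msupp y))%fset.
have l1 : (msupp (a *: x + y) `<=` d)%fset by apply: fsubsetUl.
have l2 : (msupp x `<=` d)%fset.
  by apply: (fsubset_trans _ (fsubsetUr _ _)); apply: fsubsetUl.
have l3 : (msupp y `<=` d)%fset.
  by apply: (fsubset_trans _ (fsubsetUr _ _)); apply: fsubsetUr.
rewrite (lextE f l1) (lextE f l2) (lextE f l3).
rewrite scaler_sumr -big_split /=; apply: eq_bigr => i _.
by rewrite mcoeffD mcoeffZ scalerDl scalerA.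
Qed.

Lemma lextU (V : lmodType F) (f : K -> V) i : lext f << i >> = f i.
Proof.
by rewrite lext_def msuppU oner_eq0 big_seq_fset1 mcoeffUU scale1r.
Qed.

Lemma malg_lin_ext (V : lmodType F) (f g : {malg F[K]} -> V) :
  linear f -> linear g -> (forall i, f << i >> = g << i >>) -> f =1 g.
Proof.
move=> lf lg fg x; rewrite [x]monalgE (linE_sum lf) (linE_sum lg).
apply: eq_bigr => i _.
have -> : << x@_i *g i >> = x@_i *: << i >>.
  by apply/malgP => j; rewrite mcoeffZ !mcoeffU mulr_natr.
by rewrite (linEZ lf) (linEZ lg) fg.
Qed.

End FreeModule.

(* A reflexive decision procedure for linear identities between vectors, used
   by the tactic [lmod_eq]. *)
Section LinearIdentities.
Variables (F : fieldType) (V : lmodType F).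

Inductive lexp := LVar of nat | LZero | LAdd of lexp & lexp | LOpp of lexp
  | LScale of F & lexp.

Fixpoint leval (e : seq V) t := match t with
  | LVar n => nth 0 e n
  | LZero => 0
  | LAdd t u => leval e t + leval e u
  | LOpp t => - leval e t
  | LScale a t => a *: leval e t
  end.

Fixpoint lcoef t i : F := match t with
  | LVar n => if n == i then 1 else 0
  | LZero => 0
  | LAdd t u => lcoef t i + lcoef u i
  | LOpp t => - lcoef t i
  | LScale a t => a * lcoef t i
  end.

Lemma leval_coef e t : leval e t = \sum_(i < size e) lcoef t i *: e`_i.
Proof.
elim: t => [n||t IHt u IHu|t IHt|a t IHt] /=.
- have [lt|ge] := ltnP n (size e).
    rewrite (bigD1 (Ordinal lt)) //= eqxx scale1r big1 ?addr0 // => i ne.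
    by rewrite eq_sym (_ : (i == n :> nat) = false) ?scale0r //; apply: negbTE.
  rewrite nth_default // big1 // => i _.
  by rewrite gtn_eqF ?scale0r // (leq_trans (ltn_ord i)).
- by rewrite big1 // => i _; rewrite scale0r.
- by rewrite IHt IHu -big_split; apply: eq_bigr => i _; rewrite scalerDl.
- by rewrite IHt -sumrN; apply: eq_bigr => i _; rewrite scaleNr.
- by rewrite IHt scaler_sumr; apply: eq_bigr => i _; rewrite scalerA.
Qed.

Fixpoint lcheck t u n := match n with
  | 0%N => True
  | m.+1 => lcoef t m = lcoef u m /\ lcheck t u m
  end.

Lemma lcheckP e t u : lcheck t u (size e) -> leval e t = leval e u.
Proof.
move=> h; rewrite !leval_coef; apply: eq_bigr => i _; congr (_ *: _).
have := ltn_ord i; move: (nat_of_ord i) => {i} i.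
elim: (size e) h => [|n IHn] //= [hn /IHn h].
by rewrite ltnS leq_eqVlt => /orP[/eqP ->|].
Qed.
End LinearIdentities.

Ltac lmod_index x e := lazymatch e with
  | x :: _ => constr:(0%N)
  | _ :: ?e' => let n := lmod_index x e' in constr:(S n)
  end.
Ltac lmod_mem x e k kn := lazymatch e with
  | context [x :: _] => k tt
  | _ => kn tt
  end.
Ltac lmod_atoms e t := lazymatch t with
  | ?a + ?b => let e1 := lmod_atoms e a in lmod_atoms e1 b
  | - ?a => lmod_atoms e a
  | _ *: ?a => lmod_atoms e a
  | 0 => e
  | ?x => lazymatch e with context [x :: _] => e | _ => constr:(x :: e) end
  end.
Ltac lmod_reify F e t := lazymatch t with
  | ?a + ?b => let u := lmod_reify F e a in let v := lmod_reify F e b in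
               constr:(@LAdd F u v)
  | - ?a => let u := lmod_reify F e a in constr:(@LOpp F u)
  | ?c *: ?a => let u := lmod_reify F e a in constr:(@LScale F c u)
  | 0 => constr:(@LZero F)
  | ?x => let n := lmod_index x e in constr:(@LVar F n)
  end.
Ltac lmod_eq F := lazymatch goal with |- @eq ?T ?l ?r =>
  let e0 := constr:(@nil T) in
  let e1 := lmod_atoms e0 l in let e := lmod_atoms e1 r in
  let u := lmod_reify F e l in let v := lmod_reify F e r in
  apply: (@lcheckP F _ e u v); rewrite /=; do ?[split]; try by [ring] end.

Fact tens_key : unit. Proof. exact: tt. Qed.

Section Tensor.
Variables (F : fieldType) (A B : lmodType F).

Definition tens_rel (x : {malg F[(A * B)%type]}) : Prop :=
  (exists a u u' v, x = << (a *: u + u', v) >> - (a *: << (u, v) >> + << (u', v) >>))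
  \/
  (exists a u v v', x = << (u, a *: v + v') >> - (a *: << (u, v) >> + << (u, v') >>)).

Definition tens := quo (lspan tens_rel).
HB.instance Definition _ := GRing.Lmodule.copy tens (quo (lspan tens_rel)).

Definition pure : A -> B -> tens :=
  locked_with tens_key (fun u v => qpi _ << (u, v) >>).
Lemma pureE u v : pure u v = qpi _ << (u, v) >>.
Proof. by rewrite /pure unlock. Qed.

Lemma pure_linl v : linear (pure^~ v).
Proof.
move=> a u u'; rewrite !pureE -(qpi_lin (lspan tens_rel)); apply/qpiP.
by apply: lspan_sub; left; exists a, u, u', v.
Qed.
Lemma pure_linr u : linear (pure u).
Proof.
move=> a v v'; rewrite !pureE -(qpi_lin (lspan tens_rel)); apply/qpiP.
by apply: lspan_sub; right; exists a, u, v, v'.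
Qed.

Lemma tens_ext (C : lmodType F) (f g : tens -> C) : linear f -> linear g ->
  (forall u v, f (pure u v) = g (pure u v)) -> f =1 g.
Proof.
move=> lf lg fg t; rewrite -(qreprK t).
apply: (@malg_lin_ext _ _ _ (f \o qpi _) (g \o qpi _)) => [a u v|a u v|[u v]] /=.
- by rewrite qpi_lin lf.
- by rewrite qpi_lin lg.
- by rewrite -!pureE; exact: fg.
Qed.

Definition tlift (C : lmodType F) : (A -> B -> C) -> tens -> C :=
  locked_with tens_key (fun f t => lext (fun p => f p.1 p.2) (qrepr t)).

Section Lift.
Variables (C : lmodType F) (f : A -> B -> C).
Hypotheses (lf : forall v, linear (f^~ v)) (rf : forall u, linear (f u)).

Lemma tlift_qpi x : tlift f (qpi _ x) = lext (fun p => f p.1 p.2) x.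
Proof.
pose W := preim_sp (lext_lin (fun p : A * B => f p.1 p.2)) (zero_sp C).
rewrite /tlift unlock; apply/eqP; rewrite -subr_eq0 -(linEB (lext_lin _)); apply/eqP.
have : lspan tens_rel (qrepr (qpi (lspan tens_rel) x) - x).
  by apply/qpiP; rewrite qreprK.
move=> /(_ W); apply=> y [[a [u [u' [v ->]]]]|[a [u [v [v' ->]]]]];
  rewrite /W /= (linEB (lext_lin _)) (linED (lext_lin _)) (linEZ (lext_lin _)) !lextU /=.
- by rewrite lf subrr.
- by rewrite rf subrr.
Qed.

Lemma tlift_pure u v : tlift f (pure u v) = f u v.
Proof. by rewrite pureE tlift_qpi lextU. Qed.

Lemma tlift_lin : linear (tlift f).
Proof.
by move=> a s t; rewrite -(qreprK s) -(qreprK t) -qpi_lin !tlift_qpi lext_lin.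
Qed.
End Lift.

End Tensor.

Definition ksign (F : fieldType) (a b : bool) : F := (-1) ^+ (a && b).

Section KSign.
Variable F : fieldType.
Lemma ksignFl b : ksign F false b = 1. Proof. by []. Qed.
Lemma ksignFr b : ksign F b false = 1. Proof. by rewrite /ksign andbF. Qed.
Lemma ksignT : ksign F true true = -1. Proof. by rewrite /ksign expr1. Qed.
Definition ksignE := (ksignFl, ksignFr, ksignT).
End KSign.

(* The Z_2-grading is given by its two projections [pc false] (even part) and
   [pc true] (odd part). *)
Record superspace (F : fieldType) := SuperSpace {
  ss_sort :> lmodType F;
  pc : bool -> ss_sort -> ss_sort;
  pc_lin : forall b, linear (pc b);
  pc_pc : forall a b v, pc a (pc b v) = if a == b then pc b v else 0;
  pc_sum : forall v, pc false v + pc true v = v }.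

Definition homog (F : fieldType) (V : superspace F) (b : bool) (v : V) : Prop :=
  pc b v = v.

Section SuperSpaceTheory.
Variables (F : fieldType).

Lemma homog_pc (V : superspace F) b (v : V) : homog b (pc b v).
Proof. by rewrite /homog pc_pc eqxx. Qed.

Lemma pc_homog (V : superspace F) a b (v : V) :
  homog a v -> pc b v = if a == b then v else 0.
Proof. by move=> hv; rewrite -{1}hv pc_pc eq_sym; case: eqP => // <-. Qed.

Lemma homog_ext (V : superspace F) (W : lmodType F) (f g : V -> W) :
  linear f -> linear g -> (forall b v, homog b v -> f v = g v) -> f =1 g.
Proof.
move=> lf lg fg v; rewrite -(pc_sum v) (linED lf) (linED lg).
by congr (_ + _); apply: (fg _ _ (homog_pc _ _)).
Qed.

Lemma homog0 (V : superspace F) b : homog b (0 : V).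
Proof. exact: (linE0 (@pc_lin _ V b)). Qed.
Lemma homogP (V : superspace F) b a (u v : V) :
  homog b u -> homog b v -> homog b (a *: u + v).
Proof. by move=> hu hv; rewrite /homog pc_lin hu hv. Qed.
Lemma homogD (V : superspace F) b (u v : V) :
  homog b u -> homog b v -> homog b (u + v).
Proof. by move=> hu hv; rewrite -[u]scale1r; apply: homogP. Qed.
Lemma homogZ (V : superspace F) b a (u : V) : homog b u -> homog b (a *: u).
Proof. by move=> hu; rewrite -[_ *: _]addr0; apply: homogP => //; apply: homog0. Qed.

Lemma linear_comp (U V W : lmodType F) (f : V -> W) (g : U -> V) :
  linear f -> linear g -> linear (fun x => f (g x)).
Proof. by move=> lf lg a u v; rewrite lg lf. Qed.
Lemma linear_add (U V : lmodType F) (f g : U -> V) :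
  linear f -> linear g -> linear (fun x => f x + g x).
Proof. by move=> lf lg a u v; rewrite lf lg; lmod_eq F. Qed.
Lemma linear_opp (U V : lmodType F) (f : U -> V) :
  linear f -> linear (fun x => - f x).
Proof. by move=> lf a u v; rewrite lf; lmod_eq F. Qed.
Lemma linear_sub (U V : lmodType F) (f g : U -> V) :
  linear f -> linear g -> linear (fun x => f x - g x).
Proof. by move=> lf lg; apply: linear_add => //; apply: linear_opp. Qed.
Lemma linear_scale (U V : lmodType F) (f : U -> V) c :
  linear f -> linear (fun x => c *: f x).
Proof. by move=> lf a u v; rewrite lf; lmod_eq F. Qed.
Lemma linear_zero (U V : lmodType F) : linear (fun _ : U => 0 : V).
Proof. by move=> a u v; rewrite scaler0 addr0. Qed.
Lemma linear_id (V : lmodType F) : linear (fun x : V => x).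
Proof. by []. Qed.

Section TensorSuper.
Variables (A B : superspace F).

Definition tpc (b : bool) : tens A B -> tens A B := tlift (fun u v =>
  pure (pc false u) (pc b v) + pure (pc true u) (pc (~~ b) v)).

Let tpcl b (v : B) : linear (fun u : A =>
  pure (pc false u) (pc b v) + pure (pc true u) (pc (~~ b) v)).
Proof. by apply: linear_add; apply: (linear_comp (pure_linl _) (@pc_lin _ A _)). Qed.
Let tpcr b (u : A) : linear (fun v : B =>
  pure (pc false u) (pc b v) + pure (pc true u) (pc (~~ b) v)).
Proof. by apply: linear_add; apply: (linear_comp (pure_linr _) (@pc_lin _ B _)). Qed.

Lemma tpc_lin b : linear (tpc b).
Proof. exact: tlift_lin (tpcl b) (tpcr b). Qed.

Lemma tpc_pure b u v : tpc b (pure u v) =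
  pure (pc false u) (pc b v) + pure (pc true u) (pc (~~ b) v).
Proof. exact: tlift_pure (tpcl b) (tpcr b) u v. Qed.

Lemma pure0l v : pure (0 : A) (v : B) = 0.
Proof. exact: (linE0 (pure_linl _)). Qed.
Lemma pure0r u : pure (u : A) (0 : B) = 0.
Proof. exact: (linE0 (pure_linr _)). Qed.

Lemma tens_homog_ext (C : lmodType F) (f g : tens A B -> C) :
  linear f -> linear g ->
  (forall a b u v, homog a u -> homog b v -> f (pure u v) = g (pure u v)) ->
  f =1 g.
Proof.
move=> lf lg fg; apply: tens_ext => // u v.
apply: (@homog_ext A C (fun u => f (pure u v)) (fun u => g (pure u v))).
- exact: (linear_comp lf (pure_linl _)).
- exact: (linear_comp lg (pure_linl _)).
move=> {u} a u hu.
apply: (@homog_ext B C (fun v => f (pure u v)) (fun v => g (pure u v))).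
- exact: (linear_comp lf (pure_linr _)).
- exact: (linear_comp lg (pure_linr _)).
by move=> {v} b v hv; apply: fg hu hv.
Qed.

Lemma tpc_homog a b c u v : homog a u -> homog b v ->
  tpc c (pure u v) = if a (+) b == c then pure u v else 0.
Proof.
move=> hu hv; rewrite tpc_pure !(pc_homog _ hu) !(pc_homog _ hv).
by case: a hu; case: b hv; case: c => /= *; rewrite ?pure0l ?pure0r ?addr0 ?add0r.
Qed.

Lemma tpc_tpc a b t : tpc a (tpc b t) = if a == b then tpc b t else 0.
Proof.
apply: (@tens_homog_ext _ (fun t => tpc a (tpc b t))
  (fun t => if a == b then tpc b t else 0)).
- by apply: linear_comp; apply: tpc_lin.
- by case: (a == b); [apply: tpc_lin | apply: linear_zero].
move=> c d u v hu hv; rewrite !(tpc_homog _ hu hv).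
have [eb|_] := eqVneq (c (+) d) b; last by rewrite (linE0 (tpc_lin _)) if_same.
by rewrite (tpc_homog _ hu hv) eb eq_sym.
Qed.

Lemma tpc_sum t : tpc false t + tpc true t = t.
Proof.
apply: (@tens_homog_ext _ (fun t => tpc false t + tpc true t) (fun t => t)).
- by apply: linear_add; apply: tpc_lin.
- exact: linear_id.
move=> c d u v hu hv; rewrite !(tpc_homog _ hu hv).
by case: (c (+) d); rewrite ?addr0 ?add0r.
Qed.

Definition tens_ss : superspace F := SuperSpace tpc_lin tpc_tpc tpc_sum.

Lemma homog_pure a b (u : A) (v : B) : homog a u -> homog b v ->
  homog (a (+) b) (pure u v : tens_ss).
Proof. by move=> hu hv; rewrite /homog /= (tpc_homog _ hu hv) eqxx. Qed.

End TensorSuper.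

Record subsuper (V : superspace F) := SubSuper {
  su_sp :> subspace V;
  su_pc : forall b v, su_sp v -> su_sp (pc b v) }.

Section SubQuoSuper.
Variables (V : superspace F) (S : subsuper V).

Definition sub_pc b (x : subsp S) : subsp S := subsp_mk (su_pc b (subsp_in x)).
Lemma sub_pc_lin b : linear (sub_pc b).
Proof. by move=> a x y; apply: subsp_inj; rewrite /= pc_lin. Qed.
Lemma sub_pc_pc a b x : sub_pc a (sub_pc b x) = if a == b then sub_pc b x else 0.
Proof. by apply: subsp_inj; rewrite /= pc_pc; case: eqP. Qed.
Lemma sub_pc_sum x : sub_pc false x + sub_pc true x = x.
Proof. by apply: subsp_inj; rewrite /= pc_sum. Qed.
Definition sub_ss : superspace F := SuperSpace sub_pc_lin sub_pc_pc sub_pc_sum.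

Definition quo_pc b (q : quo S) : quo S := qpi S (pc b (qrepr q)).
Lemma quo_pcE b v : quo_pc b (qpi S v) = qpi S (pc b v).
Proof.
apply/qpiP; rewrite -(linEB (@pc_lin _ V b)); apply: su_pc.
by apply/qpiP; rewrite qreprK.
Qed.
Lemma quo_pc_lin b : linear (quo_pc b).
Proof.
by move=> a x y; rewrite -(qreprK x) -(qreprK y) -qpi_lin !quo_pcE pc_lin qpi_lin.
Qed.
Lemma quo_pc_pc a b x : quo_pc a (quo_pc b x) = if a == b then quo_pc b x else 0.
Proof.
rewrite -(qreprK x) !quo_pcE pc_pc; case: eqP => // _.
exact: (linE0 (qpi_lin S)).
Qed.
Lemma quo_pc_sum x : quo_pc false x + quo_pc true x = x.
Proof. by rewrite -(qreprK x) !quo_pcE -(linED (qpi_lin S)) pc_sum. Qed.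
Definition quo_ss : superspace F := SuperSpace quo_pc_lin quo_pc_pc quo_pc_sum.

End SubQuoSuper.

Record lieSuper := LieSuper {
  ls_ss :> superspace F;
  br : ls_ss -> ls_ss -> ls_ss;
  br_linl : forall y, linear (br^~ y);
  br_linr : forall x, linear (br x);
  br_homog : forall a b x y, homog a x -> homog b y -> homog (a (+) b) (br x y);
  br_skew : forall a b x y, homog a x -> homog b y ->
    br x y = - (ksign F a b *: br y x);
  br_jacobi : forall a b x y z, homog a x -> homog b y ->
    br x (br y z) = br (br x y) z + ksign F a b *: br y (br x z) }.

Record smodule (L : lieSuper) := SModule {
  sm_ss :> superspace F;
  act : L -> sm_ss -> sm_ss;
  act_linl : forall v, linear (act^~ v);
  act_linr : forall x, linear (act x);
  act_homog : forall a b x v, homog a x -> homog b v -> homog (a (+) b) (act x v);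
  act_br : forall a b x y v, homog a x -> homog b y ->
    act (br x y) v = act x (act y v) - ksign F a b *: act y (act x v) }.

Record submod (L : lieSuper) (V : smodule L) := SubMod {
  sm_sub :> subsuper V;
  sm_act : forall x v, sm_sub v -> sm_sub (act x v) }.

Section ModuleConstructions.
Variable L : lieSuper.

Lemma homog_sub (V : superspace F) (S : subsuper V) b (x : sub_ss S) :
  homog b x <-> homog b (val x).
Proof.
by split=> [/(congr1 val)|h] //; apply: subsp_inj.
Qed.

Lemma adj_br a b (x y z : L) : homog a x -> homog b y ->
  br (br x y) z = br x (br y z) - ksign F a b *: br y (br x z).
Proof. by move=> hx hy; rewrite (br_jacobi _ hx hy) addrK. Qed.
Definition adj : smodule L :=
  @SModule L L (@br L) (@br_linl L) (@br_linr L) (@br_homog L) adj_br.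

Section SubQuoMod.
Variables (V : smodule L) (S : submod V).

Definition sub_act x (v : sub_ss S) : sub_ss S :=
  subsp_mk (sm_act x (subsp_in v)).

Lemma sub_act_linl v : linear (sub_act^~ v).
Proof. by move=> a x y; apply: subsp_inj; rewrite /= act_linl. Qed.
Lemma sub_act_linr x : linear (sub_act x).
Proof. by move=> a u v; apply: subsp_inj; rewrite /= act_linr. Qed.
Lemma sub_act_homog a b x v : homog a x -> homog b v ->
  homog (a (+) b) (sub_act x v).
Proof. by move=> hx /homog_sub hv; apply/homog_sub; apply: act_homog. Qed.
Lemma sub_act_br a b x y v : homog a x -> homog b y ->
  sub_act (br x y) v
  = sub_act x (sub_act y v) - ksign F a b *: sub_act y (sub_act x v).
Proof. by move=> hx hy; apply: subsp_inj; rewrite /= (act_br _ hx hy). Qed.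
Definition sub_mod : smodule L :=
  SModule sub_act_linl sub_act_linr sub_act_homog sub_act_br.

Definition quo_act x (q : quo_ss S) : quo_ss S := qpi S (act x (qrepr q)).
Lemma quo_actE x v : quo_act x (qpi S v) = qpi S (act x v).
Proof.
apply/qpiP; rewrite -(linEB (@act_linr _ V x)); apply: sm_act.
by apply/qpiP; rewrite qreprK.
Qed.
Lemma quo_act_linl q : linear (quo_act^~ q).
Proof.
by move=> a x y; rewrite /quo_act -qpi_lin act_linl.
Qed.
Lemma quo_act_linr x : linear (quo_act x).
Proof.
by move=> a p q; rewrite -(qreprK p) -(qreprK q) -qpi_lin !quo_actE act_linr qpi_lin.
Qed.
Lemma quo_act_homog a b x q : homog a x -> homog b q ->
  homog (a (+) b) (quo_act x q).
Proof.
move=> hx hq; rewrite -hq -(qreprK q) /= quo_pcE quo_actE /homog /= quo_pcE.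
by congr qpi; apply: act_homog => //; apply: homog_pc.
Qed.
Lemma quo_act_br a b x y q : homog a x -> homog b y ->
  quo_act (br x y) q = quo_act x (quo_act y q) - ksign F a b *: quo_act y (quo_act x q).
Proof.
move=> hx hy; rewrite -(qreprK q) !quo_actE (act_br _ hx hy).
by rewrite (linEB (qpi_lin S)) (linEZ (qpi_lin S)).
Qed.
Definition quo_mod : smodule L :=
  SModule quo_act_linl quo_act_linr quo_act_homog quo_act_br.

End SubQuoMod.

(* The tensor product of two modules:
   x (u (x) v) = (x u) (x) v + (-1)^(|x||u|) u (x) (x v). *)
Section TensorMod.
Variables (A B : smodule L).

Definition tact_fun (x : L) (u : A) (v : B) : tens A B :=
  pure (act x u) v + pure (pc false u) (act x v)
  + pure (pc true u) (act (pc false x) v - act (pc true x) v).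
Definition tact (x : L) : tens A B -> tens A B := tlift (tact_fun x).

Let tact_linu x v : linear (tact_fun x ^~ v).
Proof.
move=> a u u'; rewrite /tact_fun act_linr !pc_lin !pure_linl.
by lmod_eq F.
Qed.
Let tact_linv x u : linear (tact_fun x u).
Proof.
by move=> a v v'; rewrite /tact_fun !(linEB (pure_linr _)) !act_linr !pure_linr; lmod_eq F.
Qed.

Lemma tact_linr x : linear (tact x).
Proof. exact: tlift_lin (tact_linu x) (tact_linv x). Qed.

Lemma tact_pure x u v : tact x (pure u v) = tact_fun x u v.
Proof. exact: tlift_pure (tact_linu x) (tact_linv x) u v. Qed.

Lemma tact_linl t : linear (tact^~ t).
Proof.
move=> a x y.
apply: (@tens_ext _ _ _ _ (tact (a *: x + y)) (fun t => a *: tact x t + tact y t)).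
- exact: tact_linr.
- by apply: linear_add; [apply: linear_scale|]; apply: tact_linr.
move=> u v; rewrite !tact_pure /tact_fun !pc_lin !act_linl !(linEB (pure_linr _)).
by rewrite pure_linl !pure_linr; lmod_eq F.
Qed.

Lemma tact_hpure a b x u v : homog a x -> homog b u ->
  tact x (pure u v) = pure (act x u) v + ksign F a b *: pure u (act x v).
Proof.
move=> hx hu; rewrite tact_pure /tact_fun.
rewrite !(pc_homog _ hx) !(pc_homog _ hu).
case: a hx; case: b hu => /= _ _; rewrite !ksignE;
  rewrite ?pure0l ?(linE0 (@act_linl _ B _)) ?addr0 ?add0r ?subr0 ?sub0r //;
  rewrite ?(linEN (pure_linr _)); lmod_eq F.
Qed.

Lemma tact_homog a b x (t : tens_ss A B) : homog a x -> homog b t ->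
  homog (a (+) b) (tact x t : tens_ss A B).
Proof.
move=> hx ht; rewrite /homog -ht.
apply: (@tens_homog_ext _ _ _ (fun t => tpc (a (+) b) (tact x (tpc b t)))
  (fun t => tact x (tpc b t))).
- apply: linear_comp (@tpc_lin _ _ _) _.
  exact: linear_comp (tact_linr _) (@tpc_lin _ _ _).
- exact: linear_comp (tact_linr _) (@tpc_lin _ _ _).
move=> c d u v hu hv; rewrite (tpc_homog _ hu hv).
case: eqP => [<-|_]; last by rewrite (linE0 (tact_linr _)) (linE0 (@tpc_lin _ _ _)).
rewrite (tact_hpure _ hx hu) (linED (@tpc_lin _ _ _)) (linEZ (@tpc_lin _ _ _)).
rewrite (tpc_homog _ (act_homog hx hu) hv) (tpc_homog _ hu (act_homog hx hv)).
by rewrite addbA eqxx (addbCA c a d) addbA eqxx.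
Qed.

Lemma tact_br a b x y t : homog a x -> homog b y ->
  tact (br x y) t = tact x (tact y t) - ksign F a b *: tact y (tact x t).
Proof.
move=> hx hy.
apply: (@tens_homog_ext _ _ _ (tact (br x y)) (fun t =>
  tact x (tact y t) - ksign F a b *: tact y (tact x t))).
- exact: tact_linr.
- apply: linear_sub; last apply: linear_scale;
  by apply: linear_comp; apply: tact_linr.
move=> c d u v hu hv.
rewrite (tact_hpure _ (br_homog hx hy) hu) (tact_hpure _ hx hu) (tact_hpure _ hy hu).
rewrite !(linED (tact_linr _)) !(linEZ (tact_linr _)).
rewrite (tact_hpure _ hx (act_homog hy hu)) (tact_hpure _ hx hu).
rewrite (tact_hpure _ hy (act_homog hx hu)) (tact_hpure _ hy hu).
rewrite !(act_br _ hx hy) (linEB (pure_linl _)) (linEZ (pure_linl _)).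
rewrite (linEB (pure_linr _)) (linEZ (pure_linr _)).
by case: a hx; case: b hy; case: c hu => *; rewrite !ksignE; lmod_eq F.
Qed.

Definition tens_mod : smodule L := @SModule L (tens_ss A B) tact
  tact_linl tact_linr tact_homog tact_br.

End TensorMod.
End ModuleConstructions.
End SuperSpaceTheory.

Section Homology.
Variables (F : fieldType) (L : lieSuper F) (I : submod (adj L)) (V : smodule L).

Let U : smodule L := sub_mod I.
Definition uval (x : U) : L := subsp_val (x : subsp I).

Lemma uval_lin : linear uval.
Proof. by []. Qed.
Lemma uval_act z x : uval (act z x) = br z (uval x).
Proof. by []. Qed.
Lemma uval_homog b x : homog b x -> homog b (uval x).
Proof. by move/homog_sub. Qed.

(* The L-module U (x) ... (x) U (x) V, with j factors U. *)
Fixpoint tpow (j : nat) : smodule L :=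
  match j with 0%N => V | i.+1 => tens_mod U (tpow i) end.

Definition tcons {j} (x : U) (c : tpow j) : tpow j.+1 := pure x c.

Lemma tcons_linl j (c : tpow j) : linear (tcons^~ c).
Proof. exact: (pure_linl c). Qed.
Lemma tcons_linr j x : linear (@tcons j x).
Proof. exact: (pure_linr x). Qed.

Lemma tcons_homog_ext j (C : lmodType F) (f g : tpow j.+1 -> C) :
  linear f -> linear g ->
  (forall a b x c, homog a x -> homog b c -> f (tcons x c) = g (tcons x c)) ->
  f =1 g.
Proof. exact: tens_homog_ext. Qed.

Lemma act_tcons j a b z (x : U) (c : tpow j) : homog a z -> homog b x ->
  act z (tcons x c) = tcons (act z x) c + ksign F a b *: tcons x (act z c).
Proof. exact: tact_hpure. Qed.

Lemma pc_tcons j a b d (x : U) (c : tpow j) : homog a x -> homog b c ->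
  pc d (tcons x c) = if a (+) b == d then tcons x c else 0.
Proof. exact: tpc_homog. Qed.

Lemma pc_tconsE j b (x : U) (c : tpow j) :
  pc b (tcons x c) = tcons (pc false x) (pc b c) + tcons (pc true x) (pc (~~ b) c).
Proof. exact: tpc_pure. Qed.

Lemma pc_hcons j a b (x : U) (c : tpow j) : homog a x ->
  pc b (tcons x c) = tcons x (pc (a (+) b) c).
Proof.
move=> hx; rewrite pc_tconsE !(pc_homog _ hx); have h0 := linE0 (@tcons_linl j _).
by case: a {hx}; rewrite h0 ?add0r ?addr0.
Qed.

Lemma homog_tcons j a b (x : U) (c : tpow j) : homog a x -> homog b c ->
  homog (a (+) b) (tcons x c).
Proof. exact: homog_pure. Qed.

(* d(x (x) c) = x c - x (x) d(c), where x acts on c by the module structure of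
   tpow.  On homogeneous x_1, ..., x_n in U this unfolds to
     d(x_1 ... x_n (x) v)
       = sum_s +- x_1 ... ^x_s ... x_n (x) (x_s v)
         + sum_(s < t) +- x_1 ... ^x_s ... [x_s, x_t] ... x_n (x) v,
   with signs (-1)^(s-1 + |x_s| sum_(i > s) |x_i|) and
   (-1)^(s-1 + |x_s| sum_(s < i < t) |x_i|). *)
Fixpoint tdiff (j : nat) : tpow j.+1 -> tpow j :=
  match j return tpow j.+1 -> tpow j with
  | 0%N => tlift (fun (x : U) (v : V) => act (uval x) v)
  | i.+1 => tlift (fun (x : U) (c : tpow i.+1) =>
              act (uval x) c - pure x (tdiff c))
  end.

Let dbil0l (v : tpow 0) : linear (fun x : U => act (uval x) v).
Proof. exact: linear_comp (@act_linl _ _ (tpow 0) v) uval_lin. Qed.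
Let dbil0r (x : U) : linear (fun v : tpow 0 => act (uval x) v).
Proof. exact: act_linr. Qed.

Let dbill j (c : tpow j.+1) :
  linear (fun x : U => act (uval x) c - tcons x (tdiff c)).
Proof.
apply: linear_sub; first exact: (linear_comp (@act_linl _ _ (tpow j.+1) c) uval_lin).
exact: tcons_linl.
Qed.

Let dbilr j : linear (@tdiff j) ->
  forall x : U, linear (fun c : tpow j.+1 => act (uval x) c - tcons x (tdiff c)).
Proof.
move=> ld x; apply: linear_sub; first exact: (@act_linr _ _ (tpow j.+1) (uval x)).
exact: (linear_comp (@tcons_linr j x) ld).
Qed.

Lemma tdiff_lin j : linear (@tdiff j).
Proof.
elim: j => [|j IHj]; first exact: (tlift_lin dbil0l dbil0r).
exact: (tlift_lin (@dbill j) (dbilr IHj)).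
Qed.

Lemma tdiff_cons0 (x : U) (v : tpow 0) : tdiff (tcons x v) = act (uval x) v.
Proof. exact: (tlift_pure dbil0l dbil0r). Qed.

Lemma tdiff_cons j (x : U) (c : tpow j.+1) :
  tdiff (tcons x c) = act (uval x) c - tcons x (tdiff c).
Proof. exact: (tlift_pure (@dbill j) (dbilr (@tdiff_lin j)) x c). Qed.

Lemma tdiff_act j z (t : tpow j.+1) : tdiff (act z t) = act z (tdiff t).
Proof.
apply: (@homog_ext _ L _ (fun z => tdiff (act z t)) (fun z => act z (tdiff t))).
- exact: (linear_comp (@tdiff_lin j) (@act_linl _ _ (tpow j.+1) t)).
- exact: act_linl.
move=> a {}z hz.
elim: j t => [|j IHj] t; apply: (@tcons_homog_ext _ _
    (fun t => tdiff (act z t)) (fun t => act z (tdiff t)));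
  try exact: (linear_comp (@tdiff_lin _) (@act_linr _ _ (tpow _.+1) z));
  try exact: (linear_comp (@act_linr _ _ (tpow _) z) (@tdiff_lin _));
  move=> b d x c hx hc; rewrite (act_tcons _ hz hx);
  rewrite (linED (@tdiff_lin _)) (linEZ (@tdiff_lin _)).
- by rewrite !tdiff_cons0 uval_act (act_br _ hz (uval_homog hx)) subrK.
rewrite !tdiff_cons uval_act (act_br _ hz (uval_homog hx)) IHj.
rewrite (linEB (@act_linr _ _ (tpow j.+1) z)) (act_tcons _ hz hx).
by lmod_eq F.
Qed.

Lemma tdiff_pc j b (t : tpow j.+1) : tdiff (pc b t) = pc b (tdiff t).
Proof.
elim: j b t => [|j IHj] b t; apply: (@tcons_homog_ext _ _
    (fun t => tdiff (pc b t)) (fun t => pc b (tdiff t)));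
  try exact: (linear_comp (@tdiff_lin _) (@pc_lin _ (tpow _.+1) b));
  try exact: (linear_comp (@pc_lin _ (tpow _) b) (@tdiff_lin _));
  move=> a d x c hx hc; rewrite (pc_tcons _ hx hc).
- rewrite tdiff_cons0 (pc_homog _ (act_homog (uval_homog hx) hc)).
  by case: eqP => _; [exact: tdiff_cons0 | exact: (linE0 (@tdiff_lin 0))].
have hd : homog d (tdiff c) by rewrite /homog -IHj hc.
rewrite tdiff_cons (linEB (@pc_lin _ (tpow j.+1) b)).
rewrite (pc_homog _ (act_homog (uval_homog hx) hc)) (pc_tcons _ hx hd).
case: eqP => _; first exact: tdiff_cons.
by rewrite subr0; exact: (linE0 (@tdiff_lin j.+1)).
Qed.

Lemma tdiff_tdiff j (t : tpow j.+2) : tdiff (tdiff t) = 0.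
Proof.
elim: j t => [|j IHj] t;
  apply: (@tcons_homog_ext _ _ (fun t => tdiff (tdiff t)) (fun=> 0));
  try exact: linear_zero;
  try exact: (linear_comp (@tdiff_lin _) (@tdiff_lin _.+1));
  move=> a b x c _ _; rewrite tdiff_cons (linEB (@tdiff_lin _)) tdiff_act.
- by rewrite tdiff_cons0 subrr.
by rewrite tdiff_cons IHj (linE0 (@tcons_linr _ x)) subr0 subrr.
Qed.

(* The relations x (x) y + (-1)^(|x||y|) y (x) x = 0 defining the exterior
   algebra of U, in adjacent positions. *)
Definition adj_swap j : tpow j -> Prop :=
  match j return tpow j -> Prop with
  | i.+2 => fun t => exists a b (x y : U) (c : tpow i),
      [/\ homog a x, homog b y &
          t = tcons x (tcons y c) + ksign F a b *: tcons y (tcons x c)]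
  | _ => fun=> False
  end.

Fixpoint skew_set (j : nat) : tpow j -> Prop :=
  match j return tpow j -> Prop with
  | 0%N => fun t => t = 0
  | i.+1 => lspan_set (fun t : tpow i.+1 =>
      adj_swap t \/ exists (x : U) (r : tpow i), skew_set r /\ t = tcons x r)
  end.

Lemma skew0 j : skew_set (0 : tpow j).
Proof. by case: j => // j; exact: lspan0. Qed.
Lemma skewP j a (u v : tpow j) :
  skew_set u -> skew_set v -> skew_set (a *: u + v).
Proof. by case: j u v => [|j] u v; [exact: zero_spP | exact: lspanP]. Qed.
Definition skew_sp j : subspace (tpow j) := Subspace (@skew0 j) (@skewP j).

Lemma skew_cons j (x : U) (r : tpow j) :
  skew_sp j r -> skew_sp j.+1 (tcons x r).
Proof. by move=> hr; apply: lspan_sub; right; exists x, r. Qed.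

Lemma skew_swap j a b (x y : U) (c : tpow j) : homog a x -> homog b y ->
  skew_sp j.+2 (tcons x (tcons y c) + ksign F a b *: tcons y (tcons x c)).
Proof. by move=> hx hy; apply: lspan_sub; left; exists a, b, x, y, c. Qed.

Lemma skew_act j z (t : tpow j) : skew_sp j t -> skew_sp j (act z t).
Proof.
elim: j z t => [|j IHj] z t.
  by move=> ->; exact: (linE0 (@act_linr _ _ (tpow 0) z)).
apply: (lspan_ind (@act_linr _ _ (tpow j.+1) z)) => {}t.
rewrite -(pc_sum z) (linED (@act_linl _ _ (tpow j.+1) t)) => ht.
suff h b : skew_sp j.+1 (act (pc b z) t) by apply: spD; exact: h.
move: (pc b z) (homog_pc b z) => {}z hz.
case: ht => [|[x [r [hr ->]]]]; last first.
  rewrite -(pc_sum x) (linED (tcons_linl _)) (linED (@act_linr _ _ (tpow j.+1) z)).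
  rewrite !(act_tcons _ hz (homog_pc _ _)).
  have hzr := IHj z r hr.
  by do !apply: spD; try apply: spZ; exact: skew_cons.
case: j IHj t => [|j] _ t; first by case.
case=> a [c [x [y [w [hx hy ->]]]]].
have hzx := act_homog hz hx; have hzy := act_homog hz hy.
have -> : act z (tcons x (tcons y w) + ksign F a c *: tcons y (tcons x w))
  = (tcons (act z x) (tcons y w)
     + ksign F (b (+) a) c *: tcons y (tcons (act z x) w))
  + ksign F b a *: (tcons x (tcons (act z y) w)
     + ksign F a (b (+) c) *: tcons (act z y) (tcons x w))
  + (ksign F b a * ksign F b c) *: (tcons x (tcons y (act z w))
     + ksign F a c *: tcons y (tcons x (act z w))).
  rewrite (linED (@act_linr _ _ (tpow j.+2) z)) (linEZ (@act_linr _ _ (tpow j.+2) z)).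
  rewrite !(act_tcons _ hz hx) !(act_tcons _ hz hy) !(act_tcons _ hz hx).
  rewrite !(linED (@tcons_linr _ _)) !(linEZ (@tcons_linr _ _)).
  by case: a {hx hzx}; case: b {hz hzy}; case: c {hy}; rewrite !ksignE; lmod_eq F.
apply: spD; [apply: spD|]; try apply: spZ; exact: skew_swap.
Qed.

Lemma skew_pc j b (t : tpow j) : skew_sp j t -> skew_sp j (pc b t).
Proof.
elim: j b t => [|j IHj] b t.
  by move=> ->; exact: (linE0 (@pc_lin _ (tpow 0) b)).
apply: (lspan_ind (@pc_lin _ (tpow j.+1) b)) => {}t [|[x [r [hr ->]]]]; last first.
  by rewrite pc_tconsE; apply: spD; apply: skew_cons; apply: IHj.
case: j IHj t => [|j] _ t; first by case.
case=> a [c [x [y [w [hx hy ->]]]]].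
rewrite (linED (@pc_lin _ (tpow j.+2) b)) (linEZ (@pc_lin _ (tpow j.+2) b)).
rewrite (pc_hcons _ _ hx) (pc_hcons _ _ hy) (pc_hcons _ _ hy) (pc_hcons _ _ hx).
rewrite addbCA; exact: skew_swap.
Qed.

Definition skew j : submod (tpow j) :=
  SubMod (sm_sub := SubSuper (@skew_pc j)) (@skew_act j).

(* The module of j-chains: the super exterior power Lambda^j(U) (x) V. *)
Definition chains j : smodule L := quo_mod (skew j).

Lemma tdiff_skew j (t : tpow j.+1) : skew_sp j.+1 t -> skew_sp j (tdiff t).
Proof.
elim: j t => [|j IHj] t.
  apply: (lspan_ind (@tdiff_lin 0)) => {}t [//|[x [r [hr ->]]]].
  by rewrite (hr : r = 0) (linE0 (@tcons_linr 0 x)) (linE0 (@tdiff_lin 0)).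
apply: (lspan_ind (@tdiff_lin j.+1)) => {}t [|[x [r [hr ->]]]]; last first.
  rewrite tdiff_cons; apply: spB; first exact: skew_act.
  by apply: skew_cons; apply: IHj.
case=> a [b [x [y [c [hx hy ->]]]]].
rewrite (linED (@tdiff_lin j.+1)) (linEZ (@tdiff_lin j.+1)) !tdiff_cons.
rewrite !(act_tcons _ (uval_homog hx) hy) !(act_tcons _ (uval_homog hy) hx).
have -> : act (uval x) y = - (ksign F a b *: act (uval y) x) :> U.
  apply: subsp_inj; exact: (br_skew (uval_homog hx) (uval_homog hy)).
rewrite (linEN (tcons_linl _)) (linEZ (tcons_linl _)).
case: j {IHj t} c => [|j] c.
  rewrite !tdiff_cons0.
  match goal with |- spset _ ?v => have -> : v = 0 end; last exact: sp0.
  by case: a {hx}; case: b {hy}; rewrite !ksignE; lmod_eq F.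
rewrite !tdiff_cons !(linEB (@tcons_linr _ _)).
have := skew_swap (tdiff c) hx hy.
match goal with |- spset _ ?u -> spset _ ?v => have -> : v = u end; last by [].
by case: a {hx}; case: b {hy}; rewrite !ksignE; lmod_eq F.
Qed.

(* The differential Lambda^(j+1)(U) (x) V -> Lambda^j(U) (x) V. *)
Definition diff j (q : chains j.+1) : chains j := qpi (skew j) (tdiff (qrepr q)).

Lemma diff_qpi j (t : tpow j.+1) : diff (qpi (skew j.+1) t) = qpi (skew j) (tdiff t).
Proof.
apply/qpiP; rewrite -(linEB (@tdiff_lin j)); apply: tdiff_skew.
by apply/(qpiP (skew j.+1)); rewrite qreprK.
Qed.

Lemma diff_lin j : linear (@diff j).
Proof.
move=> a p q; rewrite -(qreprK p) -(qreprK q) -(qpi_lin (skew j.+1)) !diff_qpi.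
by rewrite tdiff_lin qpi_lin.
Qed.

Lemma diff_act j z q : diff (j := j) (act z q) = act z (diff q).
Proof.
rewrite -(qreprK q) diff_qpi.
have -> : act z (qpi (skew j.+1) (qrepr q) : chains j.+1)
  = qpi (skew j.+1) (act z (qrepr q)) by exact: quo_actE.
by rewrite diff_qpi tdiff_act; symmetry; exact: quo_actE.
Qed.

Lemma diff_pc j b q : diff (j := j) (pc b q) = pc b (diff q).
Proof.
rewrite -(qreprK q) diff_qpi.
have -> : pc b (qpi (skew j.+1) (qrepr q) : chains j.+1)
  = qpi (skew j.+1) (pc b (qrepr q)) by exact: quo_pcE.
by rewrite diff_qpi tdiff_pc; symmetry; exact: quo_pcE.
Qed.

Lemma diff_diff j (q : chains j.+2) : diff (diff q) = 0.
Proof.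
by rewrite -(qreprK q) !diff_qpi tdiff_tdiff; exact: (linE0 (qpi_lin _)).
Qed.

Definition cycle_set j : chains j -> Prop :=
  match j return chains j -> Prop with
  | 0%N => fun=> True
  | i.+1 => fun c => diff c = 0
  end.

Lemma cycle0 j : cycle_set (0 : chains j).
Proof. by case: j => // j; exact: (linE0 (@diff_lin j)). Qed.
Lemma cycleP j a (u v : chains j) :
  cycle_set u -> cycle_set v -> cycle_set (a *: u + v).
Proof.
case: j u v => // j u v hu hv; rewrite /cycle_set diff_lin.
by rewrite (hu : diff u = 0) (hv : diff v = 0) scaler0 addr0.
Qed.
Lemma cycle_pc j b (v : chains j) : cycle_set v -> cycle_set (pc b v).
Proof.
case: j v => // j v hv; rewrite /cycle_set diff_pc (hv : diff v = 0).
exact: (linE0 (@pc_lin _ (chains j) b)).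
Qed.
Lemma cycle_act j z (v : chains j) : cycle_set v -> cycle_set (act z v).
Proof.
case: j v => // j v hv; rewrite /cycle_set diff_act (hv : diff v = 0).
exact: (linE0 (@act_linr _ _ (chains j) z)).
Qed.

Definition cycles j : submod (chains j) :=
  SubMod (sm_sub := SubSuper (su_sp := Subspace (@cycle0 j) (@cycleP j))
                             (@cycle_pc j)) (@cycle_act j).

Definition boundary_set j (z : sub_mod (cycles j)) : Prop :=
  exists e : chains j.+1, diff e = subsp_val (z : subsp (cycles j)).

Lemma boundary0 j : boundary_set (0 : sub_mod (cycles j)).
Proof. by exists 0; exact: (linE0 (@diff_lin j)). Qed.
Lemma boundaryP j a (u v : sub_mod (cycles j)) :
  boundary_set u -> boundary_set v -> boundary_set (a *: u + v).
Proof. by move=> [e he] [f hf]; exists (a *: e + f); rewrite diff_lin he hf. Qed.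
Lemma boundary_pc j b (v : sub_mod (cycles j)) :
  boundary_set v -> boundary_set (pc b v).
Proof. by move=> [e he]; exists (pc b e); rewrite diff_pc he. Qed.
Lemma boundary_act j z (v : sub_mod (cycles j)) :
  boundary_set v -> boundary_set (act z v).
Proof. by move=> [e he]; exists (act z e); rewrite diff_act he. Qed.

Definition boundaries j : submod (sub_mod (cycles j)) :=
  SubMod (sm_sub := SubSuper (su_sp := Subspace (@boundary0 j) (@boundaryP j))
                             (@boundary_pc j)) (@boundary_act j).

(* H_j(U; V), with the L-module structure induced by the ideal U of L. *)
Definition homology j : smodule L := quo_mod (boundaries j).

End Homology.

Section LieConstructions.
Variable F : fieldType.

Record lhom (L1 L2 : lieSuper F) := LHom {
  lh_fun :> L1 -> L2;
  lh_lin : linear lh_fun;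
  lh_pc : forall b x, lh_fun (pc b x) = pc b (lh_fun x);
  lh_br : forall x y, lh_fun (br x y) = br (lh_fun x) (lh_fun y) }.

Lemma lh_homog L1 L2 (f : lhom L1 L2) b (x : L1) : homog b x -> homog b (f x).
Proof. by move=> hx; rewrite /homog -lh_pc hx. Qed.

Section Restriction.
Variables (L1 L2 : lieSuper F) (f : lhom L1 L2) (V : smodule L2).

Lemma res_linl (v : V) : linear (fun x => act (f x) v).
Proof. exact: (linear_comp (@act_linl _ _ V v) (lh_lin f)). Qed.
Lemma res_linr x : linear (fun v : V => act (f x) v).
Proof. exact: act_linr. Qed.
Lemma res_homog a b x (v : V) : homog a x -> homog b v ->
  homog (a (+) b) (act (f x) v).
Proof. by move=> hx; apply: act_homog; apply: lh_homog. Qed.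
Lemma res_br a b x y (v : V) : homog a x -> homog b y ->
  act (f (br x y)) v
  = act (f x) (act (f y) v) - ksign F a b *: act (f y) (act (f x) v).
Proof.
by move=> hx hy; rewrite lh_br (act_br _ (lh_homog f hx) (lh_homog f hy)).
Qed.
Definition res : smodule L1 := SModule res_linl res_linr res_homog res_br.
End Restriction.

(* Isomorphisms are required to be even. *)
Definition smod_iso (L : lieSuper F) (V W : smodule L) : Prop :=
  exists f : V -> W, [/\ linear f, bijective f,
    forall b v, f (pc b v) = pc b (f v) &
    forall x v, f (act x v) = act x (f v)].

Record subalg (L : lieSuper F) := SubAlg {
  sa_sub :> subsuper L;
  sa_br : forall x y, sa_sub x -> sa_sub y -> sa_sub (br x y) }.

Section SubAlgebra.
Variables (L : lieSuper F) (A : subalg L).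

Definition sub_br (x y : sub_ss A) : sub_ss A :=
  subsp_mk (sa_br (subsp_in x) (subsp_in y)).
Lemma sub_br_linl y : linear (sub_br^~ y).
Proof. by move=> a u v; apply: subsp_inj; rewrite /= br_linl. Qed.
Lemma sub_br_linr x : linear (sub_br x).
Proof. by move=> a u v; apply: subsp_inj; rewrite /= br_linr. Qed.
Lemma sub_br_homog a b x y : homog a x -> homog b y -> homog (a (+) b) (sub_br x y).
Proof. by move=> /homog_sub hx /homog_sub hy; apply/homog_sub/br_homog. Qed.
Lemma sub_br_skew a b x y : homog a x -> homog b y ->
  sub_br x y = - (ksign F a b *: sub_br y x).
Proof. by move=> /homog_sub hx /homog_sub hy; apply: subsp_inj; apply: br_skew. Qed.
Lemma sub_br_jacobi a b x y z : homog a x -> homog b y ->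
  sub_br x (sub_br y z)
  = sub_br (sub_br x y) z + ksign F a b *: sub_br y (sub_br x z).
Proof. by move=> /homog_sub hx /homog_sub hy; apply: subsp_inj; apply: br_jacobi. Qed.
Definition sub_lie : lieSuper F := LieSuper sub_br_linl sub_br_linr
  sub_br_homog sub_br_skew sub_br_jacobi.
End SubAlgebra.

Definition sub_le (L : lieSuper F) (A B : subalg L) : Prop := forall x, A x -> B x.

Section Inclusion.
Variables (L : lieSuper F) (A B : subalg L) (AB : sub_le A B).
Definition incl_fun (x : sub_lie A) : sub_lie B := subsp_mk (AB (subsp_in x)).
Lemma incl_lin : linear incl_fun.
Proof. by move=> a x y; apply: subsp_inj. Qed.
Lemma incl_pc b x : incl_fun (pc b x) = pc b (incl_fun x).
Proof. exact: subsp_inj. Qed.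
Lemma incl_br x y : incl_fun (br x y) = br (incl_fun x) (incl_fun y).
Proof. exact: subsp_inj. Qed.
Definition incl : lhom (sub_lie A) (sub_lie B) := LHom incl_lin incl_pc incl_br.
End Inclusion.

(* A, intersected with B, as an ideal of the subalgebra B. *)
Section Ideal.
Variables (L : lieSuper F) (A B : subalg L).
Hypothesis BA : forall x y, B x -> A y -> A (br x y).

Definition ideal_set (x : adj (sub_lie B)) : Prop := A (subsp_val (x : subsp B)).
Lemma ideal0 : ideal_set 0. Proof. exact: sp0. Qed.
Lemma idealP a x y : ideal_set x -> ideal_set y -> ideal_set (a *: x + y).
Proof. exact: spP. Qed.
Lemma ideal_pc b x : ideal_set x -> ideal_set (pc b x).
Proof. exact: su_pc. Qed.
Lemma ideal_act x y : ideal_set y -> ideal_set (act x y).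
Proof. by apply: BA; exact: subsp_in. Qed.
Definition ideal_of : submod (adj (sub_lie B)) :=
  SubMod (sm_sub := SubSuper (su_sp := Subspace ideal0 idealP) ideal_pc) ideal_act.
End Ideal.

End LieConstructions.

Section SuperCommutator.
Variables (F : fieldType) (A : superspace F) (mul sc : A -> A -> A).
Hypotheses (mull : forall y, linear (mul^~ y)) (mulr : forall x, linear (mul x)).
Hypothesis mulA : forall x y z, mul x (mul y z) = mul (mul x y) z.
Hypothesis mul_homog : forall a b x y,
  homog a x -> homog b y -> homog (a (+) b) (mul x y).
Hypotheses (scl : forall y, linear (sc^~ y)) (scr : forall x, linear (sc x)).
Hypothesis scE : forall a b x y, homog a x -> homog b y ->
  sc x y = mul x y - ksign F a b *: mul y x.

Let mulNl x z : mul (- x) z = - mul x z.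
Proof. exact: (linEN (mull z)). Qed.
Let mulNr x z : mul z (- x) = - mul z x.
Proof. exact: (linEN (mulr z)). Qed.
Let mulDr x y z : mul z (x + y) = mul z x + mul z y.
Proof. exact: (linED (mulr z)). Qed.
Let mulDl x y z : mul (x + y) z = mul x z + mul y z.
Proof. exact: (linED (mull z)). Qed.
Let mulZl a x z : mul (a *: x) z = a *: mul x z.
Proof. exact: (linEZ (mull z)). Qed.
Let mulZr a x z : mul z (a *: x) = a *: mul z x.
Proof. exact: (linEZ (mulr z)). Qed.

Lemma scomm_homog_gen a b x y :
  homog a x -> homog b y -> homog (a (+) b) (sc x y).
Proof.
move=> hx hy; rewrite (scE hx hy) -scaleNr addrC.
apply: homogP; last exact: mul_homog.
by rewrite addbC; exact: mul_homog.
Qed.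

Lemma scomm_skew_gen a b x y : homog a x -> homog b y ->
  sc x y = - (ksign F a b *: sc y x).
Proof.
move=> hx hy; rewrite (scE hx hy) (scE hy hx).
by case: a {hx}; case: b {hy}; rewrite !ksignE; lmod_eq F.
Qed.

Lemma scomm_jacobi_gen a b x y z : homog a x -> homog b y ->
  sc x (sc y z) = sc (sc x y) z + ksign F a b *: sc y (sc x z).
Proof.
move=> hx hy; apply: (@homog_ext _ A _ (fun z => sc x (sc y z))
  (fun z => sc (sc x y) z + ksign F a b *: sc y (sc x z))) => [||c {}z hz].
- exact: (linear_comp (scr x) (scr y)).
- apply: linear_add; first exact: scr.
  by apply: linear_scale; exact: (linear_comp (scr y) (scr x)).
rewrite (scE hx (scomm_homog_gen hy hz)) (scE (scomm_homog_gen hx hy) hz).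
rewrite (scE hy (scomm_homog_gen hx hz)) (scE hy hz) (scE hx hy) (scE hx hz).
rewrite !(mulDl, mulDr, mulNl, mulNr, mulZl, mulZr) !mulA.
by case: a {hx}; case: b {hy}; case: c {hz}; rewrite !ksignE; lmod_eq F.
Qed.

Variables (str : A -> F^o) (D : A -> A).
Hypotheses (lstr : linear str) (lD : linear D).
Hypothesis D_homog : forall a x, homog a x -> homog a (D x).
Hypothesis strC : forall a b x y, homog a x -> homog b y ->
  str (mul x y) = ksign F a b *: str (mul y x).
Hypothesis D_mul : forall x y, D (mul x y) = mul (D x) y + mul x (D y).

Lemma cocycle_jacobi_gen a b x y z : homog a x -> homog b y ->
  str (mul (D x) (sc y z))
  = str (mul (D (sc x y)) z) + ksign F a b *: str (mul (D y) (sc x z)).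
Proof.
move=> hx hy; apply: (@homog_ext _ A F^o (fun z => str (mul (D x) (sc y z)))
  (fun z => str (mul (D (sc x y)) z)
            + ksign F a b *: str (mul (D y) (sc x z)))) => [||c {}z hz].
- exact: (linear_comp lstr (linear_comp (mulr _) (scr y))).
- apply: linear_add; first exact: (linear_comp lstr (mulr _)).
  by apply: linear_scale; exact: (linear_comp lstr (linear_comp (mulr _) (scr x))).
rewrite (scE hy hz) (scE hx hy) (scE hx hz).
rewrite (linEB lD) (linEZ lD) !D_mul !(mulDl, mulDr, mulNl, mulNr, mulZl, mulZr).
rewrite !(linED lstr) !(linEN lstr) !(linEZ lstr) !(linED lstr).
have e1 : str (mul (mul x (D y)) z)
    = ksign F a (b (+) c) *: str (mul (D y) (mul z x)).
  by rewrite -mulA (strC hx (mul_homog (D_homog hy) hz)) mulA.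
have e2 : str (mul (mul y (D x)) z)
    = ksign F b (a (+) c) *: str (mul (D x) (mul z y)).
  by rewrite -mulA (strC hy (mul_homog (D_homog hx) hz)) mulA.
rewrite e1 e2 !mulA.
by case: a {hx e1 e2}; case: b {hy}; case: c {hz}; rewrite !ksignE; lmod_eq F.
Qed.
End SuperCommutator.

Section MatrixAlgebra.
Variables (F : fieldType) (k : nat).

(* The index set: [inl i] is the index \bar{i+1} of K, and [inr m] is the
   half-integer m/2. *)
Definition idx := ('I_k + int)%type.

Definition ltI (r s : idx) : bool :=
  match r, s with
  | inl i, inl j => (i < j)%N
  | inl _, inr n => 0 < n
  | inr m, inl _ => m <= 0
  | inr m, inr n => m < n
  end.
Definition leI r s := (r == s) || ltI r s.

Definition oddz (m : int) : bool := odd `|m|%N.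

Definition ipar (r : idx) : bool := if r is inr m then oddz m else false.

Definition nposI (r : idx) : bool := if r is inr m then m <= 0 else false.

(* gl(\tilde V): matrices with finitely many nonzero entries. *)
Definition mat := {malg F[(idx * idx)%type]}.
HB.instance Definition _ := GRing.Lmodule.copy mat {malg F[(idx * idx)%type]}.
Definition Emat (r s : idx) : mat := << (r, s) >>.

Definition mpar (p : idx * idx) : bool := ipar p.1 (+) ipar p.2.
Definition mpc (b : bool) : mat -> mat :=
  lext (fun p => if mpar p == b then Emat p.1 p.2 else 0).
Definition mmul (x y : mat) : mat :=
  lext (fun p => lext (fun q => if p.2 == q.1 then Emat p.1 q.2 else 0) y) x.
Definition scomm (x y : mat) : mat :=
  lext (fun p => lext (fun q =>
    mmul (Emat p.1 p.2) (Emat q.1 q.2)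
    - ksign F (mpar p) (mpar q) *: mmul (Emat q.1 q.2) (Emat p.1 p.2)) y) x.
Definition Str (x : mat) : F^o :=
  lext (fun p => if p.1 == p.2 then (-1) ^+ ipar p.1 else 0) x.
(* [J, x] for the infinite matrix J = sum_(r <= 0) E_rr. *)
Definition adJ : mat -> mat :=
  lext (fun p => ((nposI p.1)%:R - (nposI p.2)%:R) *: Emat p.1 p.2).
Definition alpha (x y : mat) : F^o := Str (mmul (adJ x) y).

Lemma mat_ext (V : lmodType F) (f g : mat -> V) : linear f -> linear g ->
  (forall r s, f (Emat r s) = g (Emat r s)) -> f =1 g.
Proof. by move=> lf lg fg; apply: malg_lin_ext => // -[r s]; apply: fg. Qed.

Lemma lextE_mat (V : lmodType F) (f : idx * idx -> V) r s :
  lext f (Emat r s) = f (r, s).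
Proof. exact: lextU. Qed.

Lemma lext_linf (V : lmodType F) (U : lmodType F) (g : idx * idx -> U -> V) x :
  (forall p, linear (g p)) -> linear (fun u => lext (fun p => g p u) x).
Proof.
move=> lg a u v; rewrite !lext_def scaler_sumr -big_split /=.
by apply: eq_bigr => p _; rewrite lg scalerDr !scalerA mulrC.
Qed.

Lemma mpc_lin b : linear (mpc b). Proof. exact: lext_lin. Qed.
Lemma mpcE b r s : mpc b (Emat r s) = if mpar (r, s) == b then Emat r s else 0.
Proof. exact: lextE_mat. Qed.
Lemma mpc_pc a b x : mpc a (mpc b x) = if a == b then mpc b x else 0.
Proof.
apply: (@mat_ext _ (fun x => mpc a (mpc b x)) (fun x => if a == b then mpc b x else 0)).
- exact: (linear_comp (mpc_lin a) (mpc_lin b)).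
- by case: (a == b); [exact: mpc_lin | exact: linear_zero].
move=> r s; rewrite mpcE; have [<-|ne] := eqVneq (mpar (r, s)) b.
  by rewrite mpcE eq_sym.
by rewrite (linE0 (mpc_lin a)) if_same.
Qed.
Lemma mpc_sum x : mpc false x + mpc true x = x.
Proof.
apply: (@mat_ext _ (fun x => mpc false x + mpc true x) (fun x => x)).
- by apply: linear_add; exact: mpc_lin.
- exact: linear_id.
by move=> r s; rewrite !mpcE; case: (mpar _); rewrite ?addr0 ?add0r.
Qed.
Definition mat_ss : superspace F := SuperSpace mpc_lin mpc_pc mpc_sum.

Lemma mat_hext (V : lmodType F) a (f g : mat -> V) : linear f -> linear g ->
  (forall r s, mpar (r, s) = a -> f (Emat r s) = g (Emat r s)) ->
  forall x : mat_ss, homog a x -> f x = g x.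
Proof.
move=> lf lg fg x <-; apply: (@mat_ext _ (fun x => f (mpc a x)) (fun x => g (mpc a x))).
- exact: (linear_comp lf (mpc_lin a)).
- exact: (linear_comp lg (mpc_lin a)).
move=> r s; rewrite mpcE; case: eqP => [e|_]; first exact: fg.
by rewrite (linE0 lf) (linE0 lg).
Qed.

Lemma mmul_linl y : linear (mmul^~ y). Proof. exact: lext_lin. Qed.
Lemma mmul_linr x : linear (mmul x).
Proof. by apply: lext_linf => p; exact: lext_lin. Qed.
Lemma mmulE r s t u :
  mmul (Emat r s) (Emat t u) = if s == t then Emat r u else 0.
Proof. by rewrite /mmul !lextE_mat. Qed.
Lemma mmul0r x : mmul x 0 = 0. Proof. exact: (linE0 (mmul_linr x)). Qed.
Lemma mmul0l x : mmul 0 x = 0. Proof. exact: (linE0 (mmul_linl x)). Qed.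

Lemma mmulA x y z : mmul x (mmul y z) = mmul (mmul x y) z.
Proof.
apply: (@mat_ext _ (fun x => mmul x (mmul y z)) (fun x => mmul (mmul x y) z)) => [||r s].
- exact: mmul_linl.
- exact: (linear_comp (mmul_linl z) (mmul_linl y)).
apply: (@mat_ext _ (fun y => mmul (Emat r s) (mmul y z))
                   (fun y => mmul (mmul (Emat r s) y) z)) => [||t u].
- exact: (linear_comp (mmul_linr _) (mmul_linl z)).
- exact: (linear_comp (mmul_linl z) (mmul_linr _)).
apply: (@mat_ext _ (fun z => mmul (Emat r s) (mmul (Emat t u) z))
                   (fun z => mmul (mmul (Emat r s) (Emat t u)) z)) => [||v w].
- exact: (linear_comp (mmul_linr _) (mmul_linr _)).
- exact: mmul_linr.
rewrite !mmulE; case: (eqVneq u v) => uv; case: (eqVneq s t) => st;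
  by rewrite ?(mmul0l, mmul0r) ?mmulE ?uv ?st ?eqxx ?(negbTE uv) ?(negbTE st).
Qed.

Lemma scomm_linl y : linear (scomm^~ y). Proof. exact: lext_lin. Qed.
Lemma scomm_linr x : linear (scomm x).
Proof. by apply: lext_linf => p; exact: lext_lin. Qed.

Lemma scommE a b (x y : mat_ss) : homog a x -> homog b y ->
  scomm x y = mmul x y - ksign F a b *: mmul y x.
Proof.
move=> hx hy.
apply: (@mat_hext _ a (fun x => scomm x y)
  (fun x => mmul x y - ksign F a b *: mmul y x)) hx => [||r s ha].
- exact: scomm_linl.
- apply: linear_sub; first exact: mmul_linl.
  by apply: linear_scale; exact: mmul_linr.
apply: (@mat_hext _ b (fun y => scomm (Emat r s) y)
  (fun y => mmul (Emat r s) y - ksign F a b *: mmul y (Emat r s))) hy => [||t u hb].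
- exact: scomm_linr.
- apply: linear_sub; first exact: mmul_linr.
  by apply: linear_scale; exact: mmul_linl.
by rewrite /scomm !lextE_mat ha hb.
Qed.

Lemma mmul_homog a b (x y : mat_ss) : homog a x -> homog b y ->
  homog (a (+) b) (mmul x y : mat_ss).
Proof.
move=> hx hy; rewrite /homog /=.
apply: (@mat_hext _ a (fun x => mpc (a (+) b) (mmul x y)) (fun x => mmul x y)) hx
   => [||r s ha].
- exact: (linear_comp (mpc_lin _) (mmul_linl y)).
- exact: mmul_linl.
apply: (@mat_hext _ b (fun y => mpc (a (+) b) (mmul (Emat r s) y))
   (fun y => mmul (Emat r s) y)) hy => [||t u hb].
- exact: (linear_comp (mpc_lin _) (mmul_linr _)).
- exact: mmul_linr.
rewrite mmulE; case: eqP => st; last exact: (linE0 (mpc_lin _)).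
rewrite mpcE -ha -hb /mpar /= st.
by case: (ipar r); case: (ipar t); case: (ipar u).
Qed.

Lemma Str_lin : linear Str. Proof. exact: lext_lin. Qed.
Lemma StrE r s : Str (Emat r s) = if r == s then (-1) ^+ ipar r else 0.
Proof. exact: lextE_mat. Qed.

Lemma Str_odd (x : mat_ss) : homog true x -> Str x = 0.
Proof.
apply: (@mat_hext _ true Str (fun=> 0)); [exact: Str_lin | exact: linear_zero |].
move=> r s; rewrite StrE /mpar /=; case: eqP => // ->.
by case: (ipar s).
Qed.

Lemma StrC a b (x y : mat_ss) : homog a x -> homog b y ->
  Str (mmul x y) = ksign F a b *: Str (mmul y x).
Proof.
move=> hx hy.
apply: (@mat_hext _ a (fun x => Str (mmul x y)) (fun x => ksign F a b *: Str (mmul y x)))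
  hx => [||r s ha].
- exact: (linear_comp Str_lin (mmul_linl y)).
- by apply: linear_scale; exact: (linear_comp Str_lin (mmul_linr y)).
apply: (@mat_hext _ b (fun y => Str (mmul (Emat r s) y))
  (fun y => ksign F a b *: Str (mmul y (Emat r s)))) hy => [||t u hb].
- exact: (linear_comp Str_lin (mmul_linr _)).
- by apply: linear_scale; exact: (linear_comp Str_lin (mmul_linl _)).
rewrite !mmulE [u == r]eq_sym.
case: (eqVneq s t) => [st|st]; case: (eqVneq r u) => [ru|ru];
  rewrite ?(linE0 Str_lin) ?scaler0 ?StrE ?(negbTE ru) //.
- rewrite st ru !eqxx -ha -hb /mpar /= st ru /ksign /GRing.scale /=.
  by case: (ipar u); case: (ipar t);
    rewrite /= ?expr0 ?expr1 ?mul1r ?mulrNN ?mulr1.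
- by rewrite eq_sym (negbTE st) scaler0.
Qed.

Lemma adJ_lin : linear adJ. Proof. exact: lext_lin. Qed.
Lemma adJE r s : adJ (Emat r s) = ((nposI r)%:R - (nposI s)%:R) *: Emat r s.
Proof. exact: lextE_mat. Qed.

Lemma adJ_homog a (x : mat_ss) : homog a x -> homog a (adJ x : mat_ss).
Proof.
apply: (@mat_hext _ a (fun x => mpc a (adJ x)) adJ) => [||r s ha].
- exact: (linear_comp (mpc_lin _) adJ_lin).
- exact: adJ_lin.
by rewrite adJE (linEZ (mpc_lin a)) mpcE ha eqxx.
Qed.

Lemma adJ_mul x y : adJ (mmul x y) = mmul (adJ x) y + mmul x (adJ y).
Proof.
apply: (@mat_ext _ (fun x => adJ (mmul x y)) (fun x => mmul (adJ x) y + mmul x (adJ y)))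
  => [||r s].
- exact: (linear_comp adJ_lin (mmul_linl y)).
- apply: linear_add; last exact: mmul_linl.
  exact: (linear_comp (mmul_linl y) adJ_lin).
apply: (@mat_ext _ (fun y => adJ (mmul (Emat r s) y))
  (fun y => mmul (adJ (Emat r s)) y + mmul (Emat r s) (adJ y))) => [||t u].
- exact: (linear_comp adJ_lin (mmul_linr _)).
- apply: linear_add; first exact: mmul_linr.
  exact: (linear_comp (mmul_linr _) adJ_lin).
rewrite !adJE (linEZ (mmul_linl _)) (linEZ (mmul_linr _)) mmulE.
case: eqP => [->|_]; last by rewrite (linE0 adJ_lin) !scaler0 addr0.
by rewrite adJE; lmod_eq F.
Qed.

Lemma Str_adJ x : Str (adJ x) = 0.
Proof.
apply: (@mat_ext _ (fun x => Str (adJ x)) (fun=> 0)) => [||r s].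
- exact: (linear_comp Str_lin adJ_lin).
- exact: linear_zero.
rewrite adJE (linEZ Str_lin) StrE; case: eqP => [->|_]; last by rewrite scaler0.
by rewrite subrr scale0r.
Qed.

Lemma alpha_linl y : linear (alpha^~ y).
Proof. exact: (linear_comp Str_lin (linear_comp (mmul_linl y) adJ_lin)). Qed.
Lemma alpha_linr x : linear (alpha x).
Proof. exact: (linear_comp Str_lin (mmul_linr _)). Qed.

Lemma alpha_skew a b (x y : mat_ss) : homog a x -> homog b y ->
  alpha x y = - (ksign F a b *: alpha y x).
Proof.
move=> hx hy; apply/eqP; rewrite -subr_eq0 opprK /alpha.
rewrite -(StrC hx (adJ_homog hy)) -(linED Str_lin) -adJ_mul.
by rewrite Str_adJ.
Qed.

Lemma scomm_homog a b (x y : mat_ss) : homog a x -> homog b y ->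
  homog (a (+) b) (scomm x y : mat_ss).
Proof. exact: (scomm_homog_gen mmul_homog scommE). Qed.

Lemma scomm_skew a b (x y : mat_ss) : homog a x -> homog b y ->
  scomm x y = - (ksign F a b *: scomm y x).
Proof. exact: (scomm_skew_gen scommE). Qed.

Lemma scomm_jacobi a b (x y : mat_ss) (z : mat) : homog a x -> homog b y ->
  scomm x (scomm y z) = scomm (scomm x y) z + ksign F a b *: scomm y (scomm x z).
Proof.
exact: (@scomm_jacobi_gen F mat_ss mmul scomm mmul_linl mmul_linr mmulA
  mmul_homog scomm_linr scommE a b x y z).
Qed.

Lemma alpha_jacobi a b (x y : mat_ss) (z : mat) : homog a x -> homog b y ->
  alpha x (scomm y z) = alpha (scomm x y) z + ksign F a b *: alpha y (scomm x z).
Proof.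
exact: (@cocycle_jacobi_gen F mat_ss mmul scomm mmul_linl mmul_linr mmulA
  mmul_homog scomm_linr scommE Str adJ Str_lin adJ_lin adJ_homog StrC adJ_mul
  a b x y z).
Qed.

(* The central extension gl(\tilde V) + F K. *)
Definition ghat := (mat * F^o)%type.
HB.instance Definition _ := GRing.Lmodule.copy ghat (mat * F^o)%type.

Definition gpc (b : bool) (x : ghat) : ghat := (mpc b x.1, if b then 0 else x.2).
Definition gbr (x y : ghat) : ghat := (scomm x.1 y.1, alpha x.1 y.1).

Lemma gpc_lin b : linear (gpc b).
Proof.
move=> a x y; apply/pair_equal_spec; split; first exact: mpc_lin.
case: b => //; exact: (esym (etrans (addr0 _) (scaler0 F^o a))).
Qed.
Lemma gpc_pc a b x : gpc a (gpc b x) = if a == b then gpc b x else 0.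
Proof. by rewrite /gpc /= mpc_pc; case: a; case: b. Qed.
Lemma gpc_sum x : gpc false x + gpc true x = x.
Proof.
case: x => x c; rewrite /gpc /=.
by apply/pair_equal_spec; split; [exact: mpc_sum | exact: addr0].
Qed.
Definition ghat_ss : superspace F := SuperSpace gpc_lin gpc_pc gpc_sum.

Lemma ghomogP b (x : ghat_ss) :
  homog b x <-> homog b (x.1 : mat_ss) /\ (b -> x.2 = 0).
Proof.
case: x => x c; rewrite /homog /= /gpc /=; split=> [[-> h]|[-> h]].
  by split=> // hb; rewrite hb in h.
by case: b h => // ->.
Qed.

Lemma gbr_linl (y : ghat_ss) : linear (fun x : ghat_ss => gbr x y : ghat_ss).
Proof.
move=> a u v; apply/pair_equal_spec; split; first exact: (scomm_linl y.1 a u.1 v.1).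
exact: (alpha_linl y.1 a u.1 v.1).
Qed.
Lemma gbr_linr (x : ghat_ss) : linear (fun y : ghat_ss => gbr x y : ghat_ss).
Proof.
move=> a u v; apply/pair_equal_spec; split; first exact: (scomm_linr x.1 a u.1 v.1).
exact: (alpha_linr x.1 a u.1 v.1).
Qed.
Lemma gbr_homog a b (x y : ghat_ss) : homog a x -> homog b y ->
  homog (a (+) b) (gbr x y : ghat_ss).
Proof.
move=> /ghomogP [hx _] /ghomogP [hy _]; apply/ghomogP; split=> /= [|ab].
  exact: scomm_homog.
by apply: Str_odd; rewrite -ab; apply: mmul_homog => //; exact: adJ_homog.
Qed.
Lemma gbr_skew a b (x y : ghat_ss) : homog a x -> homog b y ->
  gbr x y = - (ksign F a b *: (gbr y x : ghat_ss)) :> ghat_ss.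
Proof.
move=> /ghomogP [hx _] /ghomogP [hy _]; apply/pair_equal_spec; split.
  exact: scomm_skew.
exact: alpha_skew.
Qed.
Lemma gbr_jacobi a b (x y z : ghat_ss) : homog a x -> homog b y ->
  gbr x (gbr y z) = (gbr (gbr x y) z : ghat_ss)
    + ksign F a b *: (gbr y (gbr x z) : ghat_ss) :> ghat_ss.
Proof.
move=> /ghomogP [hx _] /ghomogP [hy _]; apply/pair_equal_spec; split.
  exact: scomm_jacobi.
exact: alpha_jacobi.
Qed.
Definition gl_hat : lieSuper F := @LieSuper F ghat_ss gbr
  gbr_linl gbr_linr gbr_homog gbr_skew gbr_jacobi.

Definition Ehat (r s : idx) : gl_hat := (Emat r s, 0).
Definition Khat : gl_hat := (0, 1).

End MatrixAlgebra.

Section SpannedSubalgebras.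
Variables (F : fieldType) (k : nat).
Local Notation idx := (idx k).
Local Notation gl_hat := (gl_hat F k).

Definition span_gen (S : idx -> idx -> Prop) (c : bool) (x : gl_hat) : Prop :=
  (c /\ x = Khat F k) \/ exists r s, S r s /\ x = Ehat F r s.

Lemma pc_Ehat b (r s : idx) :
  pc b (Ehat F r s : gl_hat) = if mpar (r, s) == b then Ehat F r s else 0.
Proof.
have -> : pc b (Ehat F r s : gl_hat)
    = (mpc b (Emat F r s), if b then 0 else 0) by [].
by rewrite mpcE if_same; case: eqP.
Qed.
Lemma pc_Khat b : pc b (Khat F k) = if b then 0 else Khat F k.
Proof.
have -> : pc b (Khat F k) = (mpc b 0, if b then 0 else 1) by [].
by rewrite (linE0 (@mpc_lin F k b)); case: b.
Qed.

Lemma br_Khatl (x : gl_hat) : br (Khat F k) x = 0.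
Proof.
apply/pair_equal_spec; split; first exact: (linE0 (@scomm_linl F k x.1)).
exact: (linE0 (@alpha_linl F k x.1)).
Qed.
Lemma br_Khatr (x : gl_hat) : br x (Khat F k) = 0.
Proof.
apply/pair_equal_spec; split; first exact: (linE0 (@scomm_linr F k x.1)).
exact: (linE0 (@alpha_linr F k x.1)).
Qed.

Lemma scomm_EE (r s t u : idx) : scomm (Emat F r s) (Emat F t u)
  = (if s == t then Emat F r u else 0)
    - ksign F (mpar (r, s)) (mpar (t, u)) *: (if u == r then Emat F t s else 0).
Proof. by rewrite /scomm !lextE_mat /= !mmulE. Qed.

Lemma alpha_EE (r s t u : idx) : ~~ ((s == t) && (r == u)) ->
  alpha (Emat F r s) (Emat F t u) = 0.
Proof.
rewrite /alpha adJE (linEZ (mmul_linl _)) mmulE; case: eqP => /= [_ ne|_ _].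
  by rewrite (linEZ (@Str_lin F k)) StrE (negbTE ne) scaler0.
by rewrite scaler0 (linE0 (@Str_lin F k)).
Qed.

Lemma br_EE (r s t u : idx) : br (Ehat F r s) (Ehat F t u) =
  (if s == t then Ehat F r u else 0)
  - ksign F (mpar (r, s)) (mpar (t, u)) *: (if u == r then Ehat F t s else 0)
  + (alpha (Emat F r s) (Emat F t u) : F) *: Khat F k.
Proof.
apply/pair_equal_spec; split.
  rewrite /= scomm_EE.
  have e (b : bool) p q : (if b then Ehat F p q else 0 : gl_hat)
    = ((if b then Emat F p q else 0, 0) : gl_hat) by case: b.
  by rewrite !e /= scaler0 addr0.
have e (b : bool) p q : (if b then Ehat F p q else 0 : gl_hat)
    = ((if b then Emat F p q else 0, 0) : gl_hat) by case: b.
rewrite !e /=.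
have -> : (0 : F^o) - ksign F (mpar (r, s)) (mpar (t, u)) *: (0 : F^o) = 0.
  by rewrite scaler0 subr0.
by rewrite add0r; exact: (esym (mulr1 _)).
Qed.

Section SpanAlg.
Variables (S : idx -> idx -> Prop) (c : bool).
Hypothesis Strans : forall r s t, S r s -> S s t -> S r t.
Hypothesis SK : c \/ forall r, ~ S r r.

Let W := lspan (span_gen S c).

Let WE r s : S r s -> W (Ehat F r s).
Proof. by move=> h; apply: lspan_sub; right; exists r, s. Qed.

Lemma span_alg_pc b (x : gl_hat) : W x -> W (pc b x).
Proof.
apply: (lspan_ind (@pc_lin _ gl_hat b)) => {}x [[hc ->]|[r [s [h ->]]]].
  rewrite pc_Khat; case: b; first exact: sp0.
  by apply: lspan_sub; left.
by rewrite pc_Ehat; case: eqP => _; [exact: WE | exact: sp0].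
Qed.

Lemma span_alg_br (x y : gl_hat) : W x -> W y -> W (br x y).
Proof.
move=> hx; apply: (lspan_ind (@br_linr _ gl_hat x)) => {}y hy.
move: x hx; apply: (lspan_ind (@br_linl _ gl_hat y)) => x.
case: hy => [[_ ->]|[t [u [htu ->]]]]; first by rewrite br_Khatr => _; exact: sp0.
case=> [[_ ->]|[r [s [hrs ->]]]]; first by rewrite br_Khatl; exact: sp0.
rewrite br_EE; apply: spD; first apply: spB.
- case: eqP => [e|_]; last exact: sp0.
  by apply: WE; rewrite e in hrs; exact: Strans htu.
- apply: spZ; case: eqP => [e|_]; last exact: sp0.
  by apply: WE; rewrite e in htu; exact: Strans hrs.
case: SK => [hc|irr]; first by apply: spZ; apply: lspan_sub; left.
rewrite alpha_EE ?scale0r; first exact: sp0.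
apply/negP => /andP[/eqP e1 /eqP e2].
by apply: (irr r); apply: Strans hrs _; rewrite e1 e2.
Qed.

Definition span_alg : subalg gl_hat :=
  SubAlg (sa_sub := SubSuper span_alg_pc) span_alg_br.
End SpanAlg.

Lemma span_alg_le (S S' : idx -> idx -> Prop) (c c' : bool) hS hK hS' hK' :
  (forall r s, S r s -> S' r s) -> (c -> c') ->
  sub_le (@span_alg S c hS hK) (@span_alg S' c' hS' hK').
Proof.
move=> SS' cc' x; apply: (lspan_ind (linear_id (V := gl_hat))) => {}x.
case=> [[hc ->]|[r [s [h ->]]]]; apply: lspan_sub.
  by left; split=> //; exact: cc'.
by right; exists r, s; split=> //; exact: SS'.
Qed.

End SpannedSubalgebras.

Section Levi.
Variables (F : fieldType) (k : nat).
Local Notation idx := (idx k).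
Variable (Y0 : {set 'I_k.-1}).

(* The index set K u {m/2 : Z m}. *)
Variable Z : pred int.
Definition inX (r : idx) : bool := if r is inr m then Z m else true.

Definition adjacent (r s : idx) : Prop :=
  [/\ inX r, inX s, ltI r s & forall t, inX t -> ~~ (ltI r t && ltI t s)].

(* The element l of Y0 stands for the root between the (l+1)-st and the
   (l+2)-nd element of K. *)
Definition inY0 (r s : idx) : Prop :=
  match r, s with
  | inl i, inl j => exists2 l, l \in Y0 & (i = l :> nat) /\ (j = l.+1 :> nat)
  | _, _ => False
  end.
Definition same_side (r s : idx) : bool :=
  match r, s with
  | inr m, inr n => (m < n <= 0) || (0 < m < n)
  | _, _ => false
  end.

(* The simple roots epsilon_r - epsilon_s of the Levi subalgebra. *)
Definition levi_simple (r s : idx) : Prop :=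
  adjacent r s /\ (inY0 r s \/ same_side r s).

Definition eroot (r s : idx) : idx -> int :=
  fun t => (t == r)%:R - (t == s)%:R.

(* epsilon_r - epsilon_s lies in the lattice spanned by the simple roots of the
   Levi subalgebra; for r = s it is 0. *)
Definition levi_root (r s : idx) : Prop :=
  exists c : seq (int * (idx * idx)),
    (forall x, x \in c -> levi_simple x.2.1 x.2.2) /\
    (forall t, eroot r s t = \sum_(x <- c) x.1 * eroot x.2.1 x.2.2 t).

Definition leviS (r s : idx) : Prop := [/\ inX r, inX s & levi_root r s].

Lemma levi_root_refl r : levi_root r r.
Proof. by exists [::]; split=> // t; rewrite big_nil /eroot subrr. Qed.

Lemma levi_root_sym r s : levi_root r s -> levi_root s r.
Proof.
move=> [c [hc e]]; exists [seq (- x.1, x.2) | x <- c]; split.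
  by move=> _ /mapP[x xc ->]; exact: (hc x xc).
move=> t; rewrite big_map /=.
have -> : eroot s r t = - eroot r s t by rewrite /eroot opprB.
by rewrite e -sumrN; apply: eq_bigr => x _; rewrite mulNr.
Qed.

Lemma levi_root_trans r s t : levi_root r s -> levi_root s t -> levi_root r t.
Proof.
move=> [c [hc e]] [d [hd f]]; exists (c ++ d); split.
  by move=> x; rewrite mem_cat => /orP[]; [exact: hc | exact: hd].
by move=> u; rewrite big_cat /= -e -f /eroot addrA subrK.
Qed.

Lemma levi_root1 r s : levi_simple r s -> levi_root r s.
Proof.
move=> h; exists [:: (1, (r, s))]; split=> [x|t]; first by rewrite inE => /eqP ->.
by rewrite big_seq1 mul1r.
Qed.

Definition block (r s : idx) : Prop :=
  match r, s with
  | inl i, inl j =>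
      forall l : 'I_k.-1, (minn i j <= l < maxn i j)%N -> l \in Y0
  | inr m, inr n => (m <= 0) = (n <= 0)
  | _, _ => False
  end.

Lemma block_sym r s : block r s -> block s r.
Proof. by case: r s => [i|m] [j|n] //= h l; rewrite minnC maxnC; exact: h. Qed.
Lemma block_trans r s t : block r s -> block s t -> block r t.
Proof.
case: r s t => [i|m] [j|n] [l|p] //=; last by move=> ->.
move=> h1 h2 q hq.
have [|] := boolP (minn i j <= q < maxn i j)%N; first exact: h1.
by move=> hn; apply: h2; move: hq hn; lia.
Qed.
Lemma block_simple r s : levi_simple r s -> block r s.
Proof.
move=> [[_ _ _ _] []]; case: r s => [i|m] [j|n] //=; last by lia.
move=> [l lY [ei ej]] q hq; suff -> : q = l by [].
by apply: val_inj => /=; move: hq; rewrite ei ej; lia.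
Qed.

Lemma levi_root_inv (B : pred idx) r s :
  (forall p q, levi_simple p q -> B p = B q) -> levi_root r s -> B r = B s.
Proof.
move=> hB [c [hc e]].
pose D := undup (r :: s :: flatten [seq [:: x.2.1; x.2.2] | x <- c]).
have val p q : p \in D -> q \in D ->
    \sum_(t <- D | B t) eroot p q t = (B p)%:R - (B q)%:R.
  have one u : u \in D -> \sum_(t <- D | B t) ((t == u)%:R : int) = (B u)%:R.
    move=> uD; rewrite big_mkcond (bigD1_seq u) ?undup_uniq //= eqxx.
    rewrite big1 ?addr0 => [|t ne]; last by rewrite (negbTE ne) if_same.
    by case: (B u).
  by move=> pD qD; rewrite /eroot sumrB !one.
have : \sum_(t <- D | B t) eroot r s t = 0.
  under eq_bigr do rewrite e.
  rewrite exchange_big /= big1_seq // => x /andP[_ xc].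
  rewrite -mulr_sumr val ?(hB _ _ (hc x xc)) ?subrr ?mulr0 //;
    rewrite mem_undup !inE; apply/orP; right; apply/orP; right;
    apply/flattenP; exists [:: x.2.1; x.2.2]; rewrite ?inE ?eqxx ?orbT //;
    by apply/mapP; exists x.
rewrite val ?mem_undup ?inE ?eqxx ?orbT // => /eqP; rewrite subr_eq0.
by case: (B r); case: (B s).
Qed.

Lemma levi_root_block r s : levi_root r s -> block r s.
Proof.
move=> h; have := @levi_root_inv (fun t => `[< block r t >]) r s _ h.
have -> : `[< block r r >] = true.
  by apply/asboolP; case: (r) => [i|m] //= l; rewrite minnn maxnn; lia.
move=> /(_ _)/esym/asboolP; apply=> p q hpq.
have hb := block_simple hpq.
by apply/asboolP/asboolP => hr; [exact: block_trans hb | exact: block_trans (block_sym hb)].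
Qed.

Lemma levi_half (m n : int) : Z m -> Z n -> m <= n -> (m <= 0) = (n <= 0) ->
  levi_root (inr m) (inr n).
Proof.
move=> Zm Zn le_mn side.
have [d hd] : exists d : nat, n - m < d%:Z.
  by exists (absz (n - m)).+1; lia.
elim: d m n Zm Zn le_mn side hd => [|d IHd] m n Zm Zn le_mn side hd; first by lia.
have [->|ne] := eqVneq m n; first exact: levi_root_refl.
have [[p [Zp /andP[mp pn]]]|no] := pselect (exists p, Z p /\ m < p < n).
  by apply: (@levi_root_trans _ (inr p)); apply: IHd => //; lia.
apply: levi_root1; split; last by right => /=; lia.
split=> //=; first by lia.
case=> [i|p] Zp /=; first by lia.
by apply/negP => h; apply: no; exists p.
Qed.

Lemma levi_K (i j : 'I_k) : (i <= j)%N -> block (inl i) (inl j) ->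
  levi_root (inl i) (inl j).
Proof.
move=> le_ij; have [d hd] : exists d, (j - i)%N = d by exists (j - i)%N.
elim: d i j le_ij hd => [|d IHd] i j le_ij hd bl.
  have -> : i = j by apply: val_inj => /=; lia.
  exact: levi_root_refl.
have lti : (i.+1 < k)%N by have := ltn_ord j; lia.
pose i' := Ordinal lti.
apply: (@levi_root_trans _ (inl i')); last first.
  apply: IHd => /=; [by lia | by lia |] => l hl; apply: bl; move: hl => /=; lia.
have ltl : (i < k.-1)%N by lia.
apply: levi_root1; split; last first.
  by left; exists (Ordinal ltl) => //; apply: bl => /=; lia.
by split=> //= -[l|p] _ /=; lia.
Qed.

Lemma leviE r s : leviS r s <-> [/\ inX r, inX s & block r s].
Proof.
split=> -[Xr Xs h]; split=> //; first exact: levi_root_block.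
case: r s Xr Xs h => [i|m] [j|n] //= Xr Xs h.
  have [le|/ltnW le] := leqP i j; first exact: levi_K.
  by apply: levi_root_sym; apply: levi_K => //; exact: (@block_sym (inl i) (inl j)).
have [le|lt] := boolP (m <= n); first exact: levi_half.
by apply: levi_root_sym; apply: levi_half => //; lia.
Qed.

Lemma ltI_trans (s r t : idx) : ltI r s -> ltI s t -> ltI r t.
Proof. by case: r s t => [i|m] [j|n] [l|p] /=; lia. Qed.
Lemma ltI_irr (r : idx) : ~~ ltI r r.
Proof. by case: r => [i|m] /=; lia. Qed.
Lemma ltI_total (r s : idx) : [|| r == s, ltI r s | ltI s r].
Proof.
case: r s => [i|m] [j|n] /=; rewrite ?(inj_eq inl_inj) ?(inj_eq inr_inj) -?val_eqE /=; lia.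
Qed.
Lemma block_convex r t s : ltI r t -> ltI t s -> block r s -> block r t /\ block t s.
Proof.
by case: r t s => [i|m] [j|n] [l|p] //= h1 h2 h; split; try lia;
  move=> q hq; apply: h; lia.
Qed.

(* Index pairs (r, s) of the elementary matrices spanning g, l, the opposite
   nilradical u_- and the opposite parabolic l + u_-. *)
Definition gS (r s : idx) : Prop := inX r /\ inX s.
Definition uS (r s : idx) : Prop := [/\ inX r, inX s, ltI s r & ~ leviS r s].
Definition pS (r s : idx) : Prop := leviS r s \/ uS r s.

Lemma gS_trans r s t : gS r s -> gS s t -> gS r t.
Proof. by move=> [? _] [_ ?]. Qed.
Lemma leviS_gS r s : leviS r s -> gS r s.
Proof. by case. Qed.
Lemma leviS_trans r s t : leviS r s -> leviS s t -> leviS r t.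
Proof. by move=> [? _ h] [_ ? h']; split=> //; exact: levi_root_trans h'. Qed.
Lemma leviS_sym r s : leviS r s -> leviS s r.
Proof. by move=> [? ? h]; split=> //; exact: levi_root_sym. Qed.

Lemma leviS_convex r t s : inX t -> ltI r t -> ltI t s -> leviS r s ->
  leviS r t /\ leviS t s.
Proof.
move=> Xt rt ts /leviE[Xr Xs b]; have [b1 b2] := block_convex rt ts b.
by split; apply/leviE.
Qed.

Lemma uS_trans r s t : uS r s -> uS s t -> uS r t.
Proof.
move=> [Xr Xs sr nrs] [_ Xt ts nst]; split=> //; first exact: ltI_trans sr.
by move=> /leviS_sym/(leviS_convex Xs ts sr)[/leviS_sym /nst].
Qed.
Lemma leviS_uS r s t : leviS r s -> uS s t -> uS r t.
Proof.
move=> rs [Xs Xt ts nst]; have [Xr _ _] := rs.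
have nrt : ~ leviS r t.
  by move=> rt; apply: nst; exact: leviS_trans (leviS_sym rs) rt.
split=> //; have /or3P[/eqP e|rt|//] := ltI_total r t.
  by case: nrt; rewrite -e; split=> //; exact: levi_root_refl.
have [tr ts'] := leviS_convex Xt rt ts rs.
by case: nrt.
Qed.
Lemma uS_leviS r s t : uS r s -> leviS s t -> uS r t.
Proof.
move=> [Xr Xs sr nrs] st; have [_ Xt _] := st.
have nrt : ~ leviS r t.
  by move=> rt; apply: nrs; exact: leviS_trans rt (leviS_sym st).
split=> //; have /or3P[/eqP e|rt|//] := ltI_total r t.
  by case: nrt; rewrite -e; split=> //; exact: levi_root_refl.
have [_ h] := leviS_convex Xr sr rt st.
by case: nrt.
Qed.
Lemma pS_uS r s t : pS r s -> uS s t -> uS r t.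
Proof. by case=> [|]; [exact: leviS_uS | exact: uS_trans]. Qed.
Lemma uS_pS r s t : uS r s -> pS s t -> uS r t.
Proof. by move=> h []; [exact: uS_leviS | exact: uS_trans]. Qed.
Lemma pS_trans r s t : pS r s -> pS s t -> pS r t.
Proof.
by case=> h [] h'; [left; exact: leviS_trans h'|right; exact: leviS_uS h'
  |right; exact: uS_leviS h'|right; exact: uS_trans h'].
Qed.
Lemma uS_irr r : ~ uS r r.
Proof. by case=> _ _; rewrite (negbTE (ltI_irr r)). Qed.

Definition g_alg : subalg (gl_hat F k) := span_alg F gS_trans (or_introl isT).
Definition l_alg : subalg (gl_hat F k) := span_alg F leviS_trans (or_introl isT).
Definition u_alg : subalg (gl_hat F k) :=
  @span_alg F k uS false uS_trans (or_intror uS_irr).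
Definition p_alg : subalg (gl_hat F k) := span_alg F pS_trans (or_introl isT).

Lemma l_p_le : sub_le l_alg p_alg.
Proof. by apply: span_alg_le => // r s; left. Qed.
Lemma p_g_le : sub_le p_alg g_alg.
Proof. by apply: span_alg_le => // r s [[]|[]]. Qed.
Lemma l_g_le : sub_le l_alg g_alg.
Proof. by apply: span_alg_le => // r s []. Qed.

Lemma u_ideal x y : p_alg x -> u_alg y -> u_alg (br x y).
Proof.
move=> hx; apply: (lspan_ind (@br_linr _ (gl_hat F k) x)) => {}y [[//]|[t [u [htu ->]]]].
move: x hx; apply: (lspan_ind (@br_linl _ (gl_hat F k) _)) => x.
case=> [[_ ->]|[r [s [hrs ->]]]]; first by rewrite br_Khatl; exact: sp0.
have uE a b : uS a b -> u_alg (Ehat F a b).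
  by move=> h; apply: lspan_sub; right; exists a, b.
rewrite br_EE; apply: spD; first apply: spB.
- case: eqP => [e|_]; last exact: sp0.
  by apply: uE; rewrite e in hrs; exact: pS_uS htu.
- apply: spZ; case: eqP => [e|_]; last exact: sp0.
  by apply: uE; rewrite e in htu; exact: uS_pS hrs.
rewrite alpha_EE ?scale0r; first exact: sp0.
apply/negP => /andP[/eqP e1 /eqP e2]; apply: (@uS_irr r).
by apply: (pS_uS hrs); rewrite e1 e2.
Qed.

(* H_j(u_-; V) as an l-module, for a g-module V. *)
Definition u_homology (V : smodule (sub_lie g_alg)) (j : nat) :
    smodule (sub_lie l_alg) :=
  res (incl l_p_le) (homology (ideal_of u_ideal) (res (incl p_g_le) V) j).

End Levi.

Section Weights.
Variables (F : fieldType) (k : nat).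
Local Notation idx := (idx k).
Local Notation gl_hat := (gl_hat F k).

(* The weight sum_r w_eps(r) epsilon_r + w_K Lambda_0, given by its values on
   the \hat E_{rr} and on K. *)
Record weight := Weight { w_eps : idx -> F; w_K : F }.

Definition aval (A : subalg gl_hat) (x : sub_lie A) : gl_hat :=
  subsp_val (x : subsp A).

Definition wspace (A : subalg gl_hat) (V : smodule (sub_lie A)) (g : weight)
    (v : V) : Prop :=
  (forall x r, aval x = Ehat F r r -> act x v = w_eps g r *: v) /\
  (forall x, aval x = Khat F k -> act x v = w_K g *: v).

(* The weights vanishing on \hat E_{rr} for r outside of the index set of Z. *)
Definition supported (Z : pred int) (g : weight) : Prop :=
  forall r : idx, ~~ inX Z r -> w_eps g r = 0.

Section Truncation.
Variables (Z : pred int) (S : idx -> idx -> Prop) (c : bool).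
Hypotheses (hS : forall r s t, S r s -> S s t -> S r t)
           (hK : c \/ forall r, ~ S r r).
Hypothesis SZ : forall r s, S r s -> gS Z r s.
Let B : subalg gl_hat := span_alg F hS hK.
Variable A : subalg gl_hat.
Hypothesis BA : sub_le B A.
Variable V : smodule (sub_lie A).

(* The sum of the weight spaces of V whose weights are supported on Z. *)
Definition trunc_set : V -> Prop :=
  lspan_set (fun v => exists2 g, supported Z g & wspace g v).
Definition trunc_sp : subspace V :=
  lspan (fun v => exists2 g, supported Z g & wspace g v).

Lemma aval_pc b (x : sub_lie A) : aval (pc b x) = pc b (aval x).
Proof. by []. Qed.

Lemma aval_homog b (x : sub_lie A) : homog b (aval x) -> homog b x.
Proof. by move=> h; apply/homog_sub. Qed.

Lemma act_even (x : sub_lie A) b (v : V) :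
  homog false (aval x) -> act x (pc b v) = pc b (act x v).
Proof.
move=> hx; have {}hx : homog false x by apply/homog_sub.
rewrite -{2}(pc_sum v) (linED (@act_linr _ _ V x)) (linED (@pc_lin _ V b)).
have h d : homog d (act x (pc d v)) by apply: (act_homog hx); exact: homog_pc.
rewrite (pc_homog b (h false)) (pc_homog b (h true)).
by case: b; rewrite ?addr0 ?add0r.
Qed.

Lemma trunc_pc b v : trunc_sp v -> trunc_sp (pc b v).
Proof.
apply: (lspan_ind (@pc_lin _ V b)) => {}v [g sg [h1 h2]].
apply: lspan_sub; exists g => //; split=> [x r e|x e];
  rewrite act_even ?(h1 x r e) ?(h2 x e) ?(linEZ (@pc_lin _ V b)) // e.
- by rewrite /homog pc_Ehat /mpar addbb.
- by rewrite /homog pc_Khat.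
Qed.

Lemma br_diag t (r s : idx) : br (Ehat F t t) (Ehat F r s) =
  ((t == r)%:R - (t == s)%:R) *: Ehat F r s.
Proof.
rewrite br_EE.
have -> : alpha (Emat F t t) (Emat F r s) = 0.
  by rewrite /alpha adJE subrr scale0r (linE0 (@mmul_linl F k _)) (linE0 (@Str_lin F k)).
rewrite /mpar /= addbb ksignFl scale1r scale0r addr0 scalerBl [s == t]eq_sym.
by case: eqP => [->|_]; case: eqP => [->|_]; rewrite ?scale1r ?scale0r.
Qed.

Definition shift (g : weight) (r s : idx) : weight :=
  Weight (fun t => w_eps g t + ((t == r)%:R - (t == s)%:R)) (w_K g).

Lemma wspace_shift g (e : sub_lie A) r s (v : V) : aval e = Ehat F r s ->
  wspace g v -> wspace (shift g r s) (act e v).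
Proof.
move=> he [h1 h2]; split=> [x t hx|x hx].
- have x0 : homog false x.
    by apply: aval_homog; rewrite hx /homog pc_Ehat /mpar addbb.
  have eb : homog (mpar (r, s)) e.
    by apply: aval_homog; rewrite he /homog pc_Ehat eqxx.
  have -> : act x (act e v) = act (br x e) v + act e (act x v).
    by rewrite (act_br _ x0 eb) ksignFl scale1r subrK.
  have -> : br x e = ((t == r)%:R - (t == s)%:R) *: e.
    by apply: subsp_inj; rewrite -[LHS]/(br (aval x) (aval e)) hx he br_diag -he.
  rewrite (linEZ (@act_linl _ _ V v)) (h1 x t hx) (linEZ (@act_linr _ _ V e)).
  by rewrite -scalerDl addrC.
- have x0 : homog false x.
    by apply: aval_homog; rewrite hx /homog pc_Khat.
  have eb : homog (mpar (r, s)) e.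
    by apply: aval_homog; rewrite he /homog pc_Ehat eqxx.
  have -> : act x (act e v) = act (br x e) v + act e (act x v).
    by rewrite (act_br _ x0 eb) ksignFl scale1r subrK.
  have -> : br x e = 0.
    by apply: subsp_inj; rewrite -[LHS]/(br (aval x) (aval e)) hx br_Khatl.
  by rewrite (linE0 (@act_linl _ _ V v)) add0r (h2 x hx) (linEZ (@act_linr _ _ V e)).
Qed.

Lemma trunc_gen (e : sub_lie A) v :
  span_gen S c (aval e) -> trunc_sp v -> trunc_sp (act e v).
Proof.
move=> he; apply: (lspan_ind (@act_linr _ _ V e)) => {}v [g sg hg].
case: he => [[_ he]|[r [s [hrs he]]]].
  by rewrite (hg.2 e he); apply: spZ; apply: lspan_sub; exists g.
apply: lspan_sub; exists (shift g r s); last exact: wspace_shift.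
move=> t ht; rewrite /= (sg t ht); have [Xr Xs] := SZ hrs.
have -> : (t == r) = false by apply/eqP => e1; rewrite e1 Xr in ht.
have -> : (t == s) = false by apply/eqP => e1; rewrite e1 Xs in ht.
by rewrite subrr addr0.
Qed.

Lemma trunc_act (x : sub_lie B) v :
  trunc_sp v -> trunc_sp (act (incl BA x) v).
Proof.
move=> hv.
suff h (y : gl_hat) : lspan (span_gen S c) y ->
    A y /\ forall e : sub_lie A, aval e = y -> trunc_sp (act e v).
  by have [_] := h (aval x) (subsp_in x); apply.
have w0 : A 0 /\ forall e : sub_lie A, aval e = 0 -> trunc_sp (act e v).
  split=> [|e he]; first exact: sp0.
  have -> : e = 0 by apply: subsp_inj.
  by rewrite (linE0 (@act_linl _ _ V v)); exact: sp0.
have wP a (p q : gl_hat) :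
   (A p /\ forall e : sub_lie A, aval e = p -> trunc_sp (act e v)) ->
   (A q /\ forall e : sub_lie A, aval e = q -> trunc_sp (act e v)) ->
   (A (a *: p + q) /\
    forall e : sub_lie A, aval e = a *: p + q -> trunc_sp (act e v)).
  move=> [Ap hp] [Aq hq]; split=> [|e he]; first exact: spP.
  have -> : e = a *: (subsp_mk Ap : sub_lie A) + subsp_mk Aq by apply: subsp_inj.
  by rewrite act_linl; apply: spP; [exact: hp | exact: hq].
move=> /(_ (Subspace w0 wP)); apply=> z hz; split=> [|e he].
  by apply: BA; apply: lspan_sub.
by apply: trunc_gen => //; rewrite he.
Qed.

Definition trunc_submod : submod (res (incl BA) V) :=
  @SubMod _ _ (res (incl BA) V) (SubSuper trunc_pc) trunc_act.

Definition trunc : smodule (sub_lie B) := sub_mod trunc_submod.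
End Truncation.
End Weights.

Section Category.
Variables (F : fieldType) (k : nat) (Y0 : {set 'I_k.-1}).
Local Notation idx := (idx k).

Definition half_all : pred int := predT.

Definition gtilde : subalg (gl_hat F k) := g_alg F k half_all.
Definition ltilde : subalg (gl_hat F k) := l_alg F Y0 half_all.

Lemma l_gtilde_le : sub_le ltilde gtilde.
Proof. exact: l_g_le. Qed.
Lemma g_gtilde_le Z : sub_le (g_alg F k Z) gtilde.
Proof. by apply: span_alg_le => // -[i|m] [j|n]. Qed.
Lemma l_ltilde_le Z : sub_le (l_alg F Y0 Z) ltilde.
Proof.
apply: span_alg_le => // r s /leviE[_ _ b]; apply/leviE; split=> //;
  by [case: (r) | case: (s)].
Qed.

Definition is_part (mu : seq nat) : bool := sorted geq mu && (0%N \notin mu).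

(* The i-th column length mu'_i, for i >= 1. *)
Definition conj_part (mu : seq nat) (i : nat) : nat := count (leq i) mu.
Definition conj_seq (mu : seq nat) : seq nat :=
  [seq conj_part mu i | i <- iota 1 (head 0%N mu)].

(* theta(mu)_(n/2), for n >= 1. *)
Definition theta (mu : seq nat) (n : nat) : nat :=
  (if odd n then (conj_part mu n.+1./2).+1 - n.+1./2
   else nth 0 mu n./2.-1 - n./2)%N.

(* The elements (a, lambda^0; lambda^-, lambda^+) of P^+. *)
Record dominant := Dominant {
  dw_a : F;
  dw_0 : 'I_k -> F;
  dw_m : seq nat;
  dw_p : seq nat;
  dw_mP : is_part dw_m;
  dw_pP : is_part dw_p;
  dw_0P : forall i j : 'I_k, inY0 Y0 (inl i) (inl j) ->
    exists n : nat, dw_0 i - dw_0 j = n%:R }.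

(* The weight \tilde lambda; for m <= 0 one has m/2 = -r + 1/2 with
   r = (1 - m)/2. *)
Definition wt_tilde (l : dominant) : weight F k :=
  Weight (fun r => match r with
    | inl i => dw_0 l i
    | inr m => if m <= 0 then - (theta (conj_seq (dw_m l)) (absz (1 - m)))%:R
               else (theta (dw_p l) (absz m))%:R
    end) (dw_a l).

Definition irr_hw (V : smodule (sub_lie ltilde)) (N : submod V)
    (g : weight F k) : Prop :=
  (exists v, [/\ N v, v <> 0, wspace g v &
     forall (x : sub_lie ltilde) r s,
       aval x = Ehat F r s -> ltI r s -> act x v = 0]) /\
  (forall N' : submod V, (forall v, N' v -> N v) ->
     (forall v, N' v -> v = 0) \/ (forall v, N v -> N' v)).

Definition direct_sum (V : lmodType F) (J : Type) (N : J -> V -> Prop) : Prop :=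
  (forall v, lspan (fun w => exists i, N i w) v) /\
  (forall i v, N i v -> lspan (fun w => exists2 j, j <> i & N j w) v -> v = 0).

Definition lin_span (V : lmodType F) (s : seq V) (v : V) : Prop :=
  exists c : 'I_(size s) -> F, v = \sum_(i < size s) c i *: s`_i.

Definition catO (a : F) (M : smodule (sub_lie gtilde)) : Prop :=
  [/\ forall (x : sub_lie gtilde) (v : M), aval x = Khat F k -> act x v = a *: v,
      (forall v : M, lspan (fun w => exists g, wspace g w) v) /\
      (forall g, exists s : seq M, forall v, wspace g v -> lin_span s v),
      exists (J : Type) (N : J -> submod (res (incl l_gtilde_le) M))
             (mu : J -> dominant),
        direct_sum (fun i => (N i : _ -> Prop)) /\
        forall i, irr_hw (N i) (wt_tilde (mu i)) &
      exists (n : nat) (lam : 'I_n -> dominant),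
        forall (g : weight F k) (v : M), v <> 0 -> wspace g v ->
        exists (i : 'I_n) (c : seq (idx * idx)),
          [/\ forall x, x \in c -> adjacent half_all x.1 x.2,
              forall r, w_eps g r
                = w_eps (wt_tilde (lam i)) r - (\sum_(x <- c) eroot x.1 x.2 r)%:~R &
              w_K g = w_K (wt_tilde (lam i))]].

(* The functors T, \bar T, T^diamond, \bar T^diamond, on \tilde g-modules and
   on \tilde l-modules. *)
Definition T_g (Z : pred int) (M : smodule (sub_lie gtilde)) :
    smodule (sub_lie (g_alg F k Z)) :=
  trunc (Z := Z) (fun r s h => h) (@g_gtilde_le Z) M.
Definition T_l (Z : pred int) (M : smodule (sub_lie ltilde)) :
    smodule (sub_lie (l_alg F Y0 Z)) :=
  trunc (Z := Z) (@leviS_gS _ Y0 Z) (@l_ltilde_le Z) M.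

End Category.

(* The half-integers m/2 belonging to I, \bar I, I^diamond, \bar I^diamond. *)
Definition Z_I : pred int := fun m => ~~ oddz m.
Definition Z_Ibar : pred int := fun m => if m <= 0 then ~~ oddz m else oddz m.
Definition Z_Idia : pred int := fun m => if m <= 0 then oddz m else ~~ oddz m.
Definition Z_Ibardia : pred int := fun m => oddz m.

(* Main.v *)
(* All weights of a module M of the category have coordinates in N at positive
   half-integers and in -N at non-positive ones.  The weights
   epsilon_r - epsilon_s of the opposite nilradical have the same signs, so a
   product of weight vectors in Lambda(u_-) (x) M has total weight supported on
   the smaller index set if and only if each factor does.  Hence the projection
   of the chain complex onto the weights supported on the smaller set is induced
   by the projections of u_- and of M, and identifies that part of the large
   complex with the small complex; taking homology commutes with taking weight
   spaces.

   The signs come from the irreducible constituents of M over the Levi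
   subalgebra.  Let p < s < q be consecutive half-integers on one side.  All
   simple roots there are odd, and the odd reflection in epsilon_p - epsilon_s
   makes epsilon_p - epsilon_q simple; as theta strictly decreases in steps of
   two, the reflected highest weight is dominant for the sl_2 of
   epsilon_p - epsilon_q, so E_qp is locally nilpotent.  The resulting symmetry
   of the weights moves a coordinate of the wrong sign away from 0, two steps at
   a time, until it is the last nonzero one; this contradicts the bound of the
   weights by the highest weights lambda_i. *)

From mathcomp Require Import all_boot all_order all_algebra.
From mathcomp Require Import zify ring boolp reals complex.
Require Import Defs.
Set Implicit Arguments. Unset Strict Implicit. Unset Printing Implicit Defensive.
Import Order.TTheory GRing.Theory Num.Theory.
Local Open Scope ring_scope.

(** * Simultaneous eigenspaces *)

(** The projection of M onto its supported weight spaces is not a module map for the large algebra,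
    and no homomorphism between the two opposite parabolics accompanies it. What remains is a
    relation between single elements: [compat x x'] says that x upstairs and x' downstairs
    correspond under the projections of u_- and of M. It holds for an element of u_- and its
    compression, which makes the projection a chain map; for an element of the small Levi subalgebra
    and itself, which makes the isomorphism equivariant; and for a diagonal E_rr with r outside the
    small index set and 0, which forces the projection to kill homology classes of unsupported
    weight. The inclusion is a section of the projection, so what is left is an argument on weight
    vectors upstairs.

    For the signs, a weak reflection suffices. A weight vector is pushed to the end of its
    E_qp-string and then raised again; the result may overshoot the exact reflection, but this only
    enlarges the absolute value of the coordinate of the wrong sign. *)

Section Spans.
Variable F : fieldType.

Lemma lspan_min (V : lmodType F) (P : V -> Prop) (W : subspace V) :
  (forall u, P u -> W u) -> forall u, lspan P u -> W u.
Proof. by move=> PW u; apply. Qed.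

Lemma lspan_mono (V : lmodType F) (P Q : V -> Prop) :
  (forall u, P u -> lspan Q u) -> forall u, lspan P u -> lspan Q u.
Proof. exact: lspan_min. Qed.

(** Transfers a spanning statement from an ambient space to a subspace, along the inclusion h: the
    generators are named in the ambient space, while W lives on the subspace. *)
Lemma lspan_inj (T V : lmodType F) (h : T -> V) (G : V -> Prop) (W : subspace T) :
  linear h -> injective h ->
  (forall g, G g -> exists2 t, h t = g & W t) ->
  forall t, lspan G (h t) -> W t.
Proof.
move=> lh ih hG t.
have w0 : exists2 u, h u = 0 & W u by exists 0; [exact: linE0 | exact: sp0].
have wP a p q : (exists2 u, h u = p & W u) -> (exists2 u, h u = q & W u) ->
    exists2 u, h u = a *: p + q & W u.
  move=> [u <- Wu] [v <- Wv]; exists (a *: u + v); first exact: lh.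
  exact: spP.
by move=> /(_ (Subspace w0 wP) hG)[u /ih <-].
Qed.

Lemma eq_on_span (U V : lmodType F) (f g : U -> V) (P : U -> Prop) :
  linear f -> linear g -> (forall u, P u -> f u = g u) ->
  forall u, lspan P u -> f u = g u.
Proof.
move=> lf lg fg u hu; apply/eqP; rewrite -subr_eq0; apply/eqP.
move: u hu; apply: (@lspan_ind F U V (fun u => f u - g u) (linear_sub lf lg) (zero_sp V)).
by move=> u Pu; rewrite /= fg // subrr.
Qed.

Lemma lspan_image (U V : lmodType F) (f : U -> V) (P : U -> Prop) (Q : V -> Prop) :
  linear f -> (forall u, P u -> lspan Q (f u)) ->
  forall u, lspan P u -> lspan Q (f u).
Proof. by move=> lf h; apply: lspan_ind. Qed.

Lemma lspan_image2 (U V W : lmodType F) (f : U -> V -> W) (P : U -> Prop)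
    (Q : V -> Prop) (S : subspace W) :
  (forall v, linear (f^~ v)) -> (forall u, linear (f u)) ->
  (forall u v, P u -> Q v -> S (f u v)) ->
  forall u v, lspan P u -> lspan Q v -> S (f u v).
Proof.
move=> lf rf h u v hu; move: v; apply: (lspan_ind (rf u)) => v Qv.
by move: u hu; apply: (lspan_ind (lf v)) => u Pu; exact: h.
Qed.

End Spans.

Section SimultaneousEigenvectors.
Variables (F : fieldType) (V : lmodType F) (J : Type) (D : J -> V -> V).
Hypothesis Dlin : forall j, linear (D j).
Local Notation wt := {classic J -> F}.

Definition eigen (g : J -> F) (v : V) := forall j, D j v = g j *: v.

Lemma eigen0 g : eigen g 0.
Proof. by move=> j; rewrite (linE0 (Dlin j)) scaler0. Qed.
Lemma eigenP g a u v : eigen g u -> eigen g v -> eigen g (a *: u + v).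
Proof. by move=> hu hv j; rewrite Dlin hu hv; lmod_eq F. Qed.
Definition eigen_sp g := Subspace (@eigen0 g) (@eigenP g).

Definition Dstable (S : subspace V) := forall j v, S v -> S (D j v).

(** The operator [D j - g0 j] preserves S, removes the component of weight g0 and rescales the
    others. The index j is chosen to separate the one component g from g0; other factors may vanish,
    which is harmless because the induction hypothesis covers every family of eigenvectors. *)
Lemma stable_components (S : subspace V) (s : seq wt) (v : wt -> V) :
  Dstable S -> uniq s -> (forall g, eigen g (v g)) ->
  S (\sum_(g <- s) v g) -> forall g, g \in s -> S (v g).
Proof.
move=> St; elim: s v => [|g0 s IHs] v //= /andP[g0s us] hv.
rewrite big_cons => hS.
have hs g : g \in s -> S (v g).
  move=> gs; have [j ne] : exists j, g j != g0 j.
    apply/not_existsP => h; case/negP: g0s; suff -> : g0 = g by [].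
    by apply: funext => j; have /negP := h j; rewrite negbK => /eqP ->.
  have := IHs (fun g => (g j - g0 j) *: v g) us _ _ g gs.
  have hd : g j - g0 j != 0 by rewrite subr_eq0.
  move=> h; rewrite -[v g]scale1r -(mulVf hd) -scalerA; apply: spZ; apply: h.
    by move=> g' i; rewrite (linEZ (Dlin i)) hv scalerA mulrC -scalerA.
  have -> : \sum_(g' <- s) (g' j - g0 j) *: v g'
    = D j (v g0 + \sum_(g' <- s) v g') - g0 j *: (v g0 + \sum_(g' <- s) v g').
    rewrite (linED (Dlin j)) hv (linE_sum (Dlin j)) scalerDr scaler_sumr.
    rewrite opprD addrACA subrr add0r -sumrB; apply: eq_bigr => g' _.
    by rewrite hv scalerBl.
  by apply: spB; [exact: St | exact: spZ].
move=> g; rewrite inE => /orP[/eqP ->|]; last exact: hs.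
rewrite -[v g0](addrK (\sum_(g' <- s) v g')); apply: spB => //.
by rewrite big_seq; apply: sp_sum.
Qed.

Lemma components_eq0 (s : seq wt) (v : wt -> V) :
  uniq s -> (forall g, eigen g (v g)) ->
  \sum_(g <- s) v g = 0 -> forall g, g \in s -> v g = 0.
Proof.
move=> us hv h0; apply: (@stable_components (zero_sp V)) => // j w /= ->.
exact: linE0.
Qed.

Definition eigenvector (v : V) := exists g, eigen g v.

Lemma lspan_components (P : V -> Prop) : (forall u, P u -> eigenvector u) ->
  forall x, lspan P x -> exists (s : seq wt) (v : wt -> V),
    [/\ uniq s, forall g, g \notin s -> v g = 0,
        forall g, lspan (fun u => P u /\ eigen g u) (v g) &
        x = \sum_(g <- s) v g].
Proof.
move=> hP.
pose R x := exists (s : seq wt) (v : wt -> V),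
    [/\ uniq s, forall g, g \notin s -> v g = 0,
        forall g, lspan (fun u => P u /\ eigen g u) (v g) &
        x = \sum_(g <- s) v g].
have R0 : R 0.
  by exists [::], (fun=> 0); split=> // [g|]; [exact: sp0 | rewrite big_nil].
have RP a x y : R x -> R y -> R (a *: x + y).
  move=> [s [v [us v0 hv ->]]] [t [w [ut w0 hw ->]]].
  have ext (s1 s2 : seq wt) (z : wt -> V) : uniq s1 -> (forall g, g \notin s1 -> z g = 0) ->
      \sum_(g <- s1) z g = \sum_(g <- undup (s1 ++ s2)) z g.
    move=> u1 z0; rewrite [RHS](bigID (mem s1)) /= [X in _ + X]big1 ?addr0; last first.
      by move=> g; exact: z0.
    rewrite -[RHS]big_filter; apply: perm_big; apply: uniq_perm => //.
      by rewrite filter_uniq // undup_uniq.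
    by move=> g; rewrite mem_filter mem_undup mem_cat /=; case: (g \in s1).
  exists (undup (s ++ t)), (fun g => a *: v g + w g); split.
  - exact: undup_uniq.
  - by move=> g; rewrite mem_undup mem_cat negb_or => /andP[/v0 -> /w0 ->]; rewrite scaler0 addr0.
  - by move=> g; apply: spP.
  - rewrite (ext s t v) // (ext t s w) // scaler_sumr [RHS]big_split /=; congr (_ + _).
    apply: perm_big; apply: uniq_perm; rewrite ?undup_uniq // => g.
    by rewrite !mem_undup !mem_cat orbC.
move=> x hx; move: x hx; apply: (lspan_min (W := Subspace R0 RP)) => u Pu /=.
have [g hg] := hP u Pu.
exists [:: g : wt], (fun g' : wt => if g' == g :> wt then u else 0); split=> //.
- by move=> g'; rewrite inE => /negbTE ->.
- by move=> g'; case: eqP => [->|_]; [apply: lspan_sub | exact: sp0].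
- by rewrite big_seq1 eqxx.
Qed.

(** Subtracting v from its own component of weight g leaves components that sum to 0, hence all
    vanish. So v equals that component, which is built from generators of weight g. *)
Lemma lspan_eigen (P : V -> Prop) g v : (forall u, P u -> eigenvector u) ->
  lspan P v -> eigen g v -> lspan (fun u => P u /\ eigen g u) v.
Proof.
move=> hP /(lspan_components hP)[s [w [us w0 hw e]]] hv.
have hwe g' : eigen g' (w g').
  by apply: (lspan_min (W := eigen_sp g')) (hw g') => u [].
pose z (g' : wt) := if g' == g :> wt then w g' - v else w g'.
have hz g' : eigen g' (z g').
  rewrite /z; case: eqP => [->|_]; last exact: hwe.
  by apply: (@spB _ _ (eigen_sp g)); [exact: hwe | exact: hv].
have [gs|gs] := boolP ((g : wt) \in s).
  have : z g = 0.
    apply: (@components_eq0 s) => //; rewrite (bigD1_seq (g : wt)) //= /z eqxx.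
    rewrite addrAC (eq_bigr w) => [|g' /negbTE -> //].
    by rewrite -(bigD1_seq (g : wt)) //= -e subrr.
  by rewrite /z eqxx => /eqP; rewrite subr_eq0 => /eqP <-; exact: hw.
suff -> : v = 0 by exact: sp0.
apply/eqP; rewrite -oppr_eq0; apply/eqP.
have : z g = 0.
  apply: (@components_eq0 (g :: s : seq wt)) => //=; rewrite ?gs ?inE ?eqxx //.
  rewrite big_cons {1}/z eqxx w0 // sub0r big_seq (eq_bigr w).
    by rewrite -big_seq -e addNr.
  by move=> g' g's; rewrite /z; case: eqP => // e'; rewrite -e' g's in gs.
by rewrite /z eqxx w0 // sub0r.
Qed.

Lemma lspan_eigen_stable (S : subspace V) v : Dstable S ->
  lspan eigenvector v -> S v -> lspan (fun u => S u /\ eigenvector u) v.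
Proof.
move=> St /(@lspan_components eigenvector (fun u h => h))[s [w [us w0 hw e]]] Sv.
have hwe g' : eigen g' (w g').
  by apply: (lspan_min (W := eigen_sp g')) (hw g') => u [].
have h := stable_components St us hwe; rewrite -e in h.
rewrite e big_seq; apply: sp_sum => g gs; apply: lspan_sub; split; first exact: h.
by exists g.
Qed.

Lemma eigen_inj g g' v : eigen g v -> eigen g' v -> v <> 0 -> g = g'.
Proof.
move=> h h' v0; apply: funext => j; apply/eqP; rewrite -subr_eq0; apply/eqP.
have : (g j - g' j) *: v = 0 by rewrite scalerBl -h -h' subrr.
by move=> /eqP; rewrite scaler_eq0 => /orP[/eqP //|/eqP].
Qed.

Lemma eigen_weight (P : V -> Prop) g v : (forall u, P u -> eigenvector u) ->
  lspan P v -> eigen g v -> v <> 0 -> exists2 u, P u & eigen g u /\ u <> 0.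
Proof.
move=> hP hv hg v0; apply: contrapT => no; apply: v0.
have := lspan_eigen hP hv hg; apply: (lspan_min (W := zero_sp V)) => u [Pu hu] /=.
by apply: contrapT => u0; apply: no; exists u.
Qed.

(** A and B are the sums of the eigenspaces with weight inside and outside Q. They span everything,
    and they meet in 0 because a nonzero component of a common vector would have a weight of both
    kinds. Uniqueness of the decomposition makes the chosen p linear. *)
Lemma eigen_projection (Q : (J -> F) -> Prop) :
  (forall v, lspan eigenvector v) ->
  exists p : V -> V, linear p /\
    forall g v, eigen g v -> p v = if pselect (Q g) then v else 0.
Proof.
move=> hV.
pose A := lspan (fun u => exists2 g, Q g & eigen g u).
pose B := lspan (fun u => exists2 g, ~ Q g & eigen g u).
have AB v : exists p : V, A p /\ B (v - p).
  have w0 : exists p : V, A p /\ B (0 - p).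
    by exists 0; rewrite subr0; split; exact: sp0.
  have wP a x y : (exists p : V, A p /\ B (x - p)) -> (exists p : V, A p /\ B (y - p)) ->
     exists p : V, A p /\ B (a *: x + y - p).
    move=> [p [Ap Bp]] [q [Aq Bq]]; exists (a *: p + q); split; first exact: spP.
    have -> : a *: x + y - (a *: p + q) = a *: (x - p) + (y - q) by lmod_eq F.
    exact: spP.
  apply: (lspan_min (W := Subspace w0 wP)) (hV v) => u [g hg] /=.
  have [Qg|nQg] := pselect (Q g).
    exists u; rewrite subrr; split; last exact: (sp0 B).
    by apply: lspan_sub; exists g.
  exists 0; rewrite subr0; split; first exact: (sp0 A).
  by apply: lspan_sub; exists g.
have ind v : A v -> B v -> v = 0.
  have hA u : (exists2 g, Q g & eigen g u) -> eigenvector u by case=> g _ ?; exists g.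
  have hB u : (exists2 g, ~ Q g & eigen g u) -> eigenvector u by case=> g _ ?; exists g.
  move=> Av; have [s [w [us w0 hw e]]] := lspan_components hA Av.
  have hwe g' : eigen g' (w g').
    by apply: (lspan_min (W := eigen_sp g')) (hw g') => u [].
  have BD : Dstable B.
    move=> j; apply: (lspan_ind (Dlin j)) => u [g nQ hg].
    by rewrite hg; apply: spZ; apply: lspan_sub; exists g.
  move=> Bv; have h := stable_components BD us hwe; rewrite -e in h.
  rewrite e big_seq; apply: big1 => g gs; apply: contrapT => wg0.
  have [u [[g' Qg' hg'] [hgu u0]]] : exists u, (exists2 g, Q g & eigen g u) /\ eigen g u /\ u <> 0.
    apply: contrapT => no; apply: wg0.
    apply: (lspan_min (W := zero_sp V)) (hw g) => u [Pu hu] /=.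
    by apply: contrapT => u0; apply: no; exists u.
  have [u' [g2 nQ2 hg2] [h2 u'0]] := eigen_weight hB (h Bv g gs) (hwe g) wg0.
  by apply: nQ2; rewrite (eigen_inj hg2 h2 u'0) -(eigen_inj hg' hgu u0).
have [p hp] := choice AB.
have pu v x : A x -> B (v - x) -> p v = x.
  move=> Ax Bx; have [Ap Bp] := hp v; apply/eqP; rewrite -subr_eq0; apply/eqP.
  apply: ind; first exact: spB.
  have -> : p v - x = (v - x) - (v - p v) by lmod_eq F.
  exact: spB.
exists p; split=> [a x y|g v hg].
  have [[Ax Bx] [Ay By]] := (hp x, hp y); apply: pu; first exact: spP.
  have -> : a *: x + y - (a *: p x + p y) = a *: (x - p x) + (y - p y) by lmod_eq F.
  exact: spP.
case: pselect => Qg; apply: pu; rewrite ?subrr ?subr0 /=.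
- by apply: lspan_sub; exists g.
- exact: (sp0 B).
- exact: (sp0 A).
- by apply: lspan_sub; exists g.
Qed.

End SimultaneousEigenvectors.

(** * Functoriality of homology *)

Section Functoriality.
Variables (F : fieldType) (L1 L2 : lieSuper F).
Variables (I1 : submod (adj L1)) (I2 : submod (adj L2)).
Variables (V1 : smodule L1) (V2 : smodule L2).
Variables (fU : sub_mod I1 -> sub_mod I2) (fV : V1 -> V2).

(** Stated for a pair of elements, because the maps need not come from a homomorphism from L1 to
    L2. *)
Definition intertwines (z1 : L1) (z2 : L2) : Prop :=
  (forall y, fU (act z1 y) = act z2 (fU y)) /\
  (forall v, fV (act z1 v) = act z2 (fV v)).

Hypotheses (fUlin : linear fU) (fVlin : linear fV).
Hypotheses (fUpc : forall b x, fU (pc b x) = pc b (fU x))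
           (fVpc : forall b x, fV (pc b x) = pc b (fV x)).

Fixpoint tmap j : tpow I1 V1 j -> tpow I2 V2 j :=
  match j return tpow I1 V1 j -> tpow I2 V2 j with
  | 0%N => fV
  | i.+1 => tlift (fun x c => tcons (fU x) (@tmap i c))
  end.

Let tmapl j (c : tpow I1 V1 j) : linear (fun x => tcons (fU x) (tmap c)).
Proof. exact: (linear_comp (@tcons_linl _ _ I2 V2 j (tmap c)) fUlin). Qed.
Let tmapr j : linear (@tmap j) ->
  forall x, linear (fun c : tpow I1 V1 j => tcons (fU x) (tmap c)).
Proof. by move=> h x; exact: (linear_comp (@tcons_linr _ _ I2 V2 j (fU x)) h). Qed.

Lemma tmap_lin j : linear (@tmap j).
Proof.
elim: j => [|j IHj]; first exact: fVlin.
exact: (tlift_lin (@tmapl j) (tmapr IHj)).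
Qed.

Lemma tmap_cons j x (c : tpow I1 V1 j) : tmap (tcons x c) = tcons (fU x) (tmap c).
Proof. exact: (tlift_pure (@tmapl j) (tmapr (@tmap_lin j)) x c). Qed.

Lemma fU_homog b x : homog b x -> homog b (fU x).
Proof. by move=> hx; rewrite /homog -fUpc hx. Qed.

Lemma tmap_pc j b (t : tpow I1 V1 j) : tmap (pc b t) = pc b (tmap t).
Proof.
elim: j b t => [|j IHj] b t; first exact: fVpc.
apply: (@tcons_homog_ext _ _ _ _ _ _ (fun t => tmap (pc b t)) (fun t => pc b (tmap t))).
- exact: (linear_comp (@tmap_lin j.+1) (@pc_lin _ (tpow I1 V1 j.+1) b)).
- exact: (linear_comp (@pc_lin _ (tpow I2 V2 j.+1) b) (@tmap_lin j.+1)).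
move=> a d x c hx hc; rewrite (pc_hcons _ _ hx) !tmap_cons (pc_hcons _ _ (fU_homog hx)).
by rewrite IHj.
Qed.

Lemma tmap_act a z1 z2 j (t : tpow I1 V1 j) :
  homog a z1 -> homog a z2 -> intertwines z1 z2 ->
  tmap (act z1 t) = act z2 (tmap t).
Proof.
move=> h1 h2 [iU iV]; elim: j t => [|j IHj] t; first exact: iV.
apply: (@tcons_homog_ext _ _ _ _ _ _ (fun t => tmap (act z1 t)) (fun t => act z2 (tmap t))).
- exact: (linear_comp (@tmap_lin j.+1) (@act_linr _ _ (tpow I1 V1 j.+1) z1)).
- exact: (linear_comp (@act_linr _ _ (tpow I2 V2 j.+1) z2) (@tmap_lin j.+1)).
move=> b d x c hx hc; rewrite (act_tcons _ h1 hx).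
rewrite (linED (@tmap_lin j.+1)) (linEZ (@tmap_lin j.+1)) !tmap_cons.
by rewrite (act_tcons _ h2 (fU_homog hx)) IHj iU.
Qed.

Lemma tmap_skew j (t : tpow I1 V1 j) : skew_sp I1 V1 j t -> skew_sp I2 V2 j (tmap t).
Proof.
elim: j t => [|j IHj] t; first by move=> ->; exact: (linE0 fVlin).
apply: (lspan_ind (@tmap_lin j.+1)) => {}t [|[x [r [hr ->]]]]; last first.
  by rewrite tmap_cons; apply: skew_cons; exact: IHj.
case: j IHj t => [|j] _ t; first by case.
case=> a [b [x [y [c [hx hy ->]]]]].
rewrite (linED (@tmap_lin j.+2)) (linEZ (@tmap_lin j.+2)) !tmap_cons.
by apply: skew_swap; exact: fU_homog.
Qed.

Definition cmap j (q : chains I1 V1 j) : chains I2 V2 j :=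
  qpi (skew I2 V2 j) (tmap (qrepr q)).

Lemma cmap_qpi j (t : tpow I1 V1 j) :
  cmap (qpi (skew I1 V1 j) t : chains I1 V1 j) = qpi (skew I2 V2 j) (tmap t).
Proof.
apply/qpiP; rewrite -(linEB (@tmap_lin j)); apply: tmap_skew.
by apply/(qpiP (skew I1 V1 j)); rewrite qreprK.
Qed.

Lemma cmap_lin j : linear (@cmap j).
Proof.
move=> a p q; rewrite -(qreprK p) -(qreprK q) -(qpi_lin (skew I1 V1 j)) !cmap_qpi.
by rewrite tmap_lin qpi_lin.
Qed.

Lemma cmap_pc j b (q : chains I1 V1 j) : cmap (pc b q) = pc b (cmap q).
Proof.
rewrite -(qreprK q) cmap_qpi.
have -> : pc b (qpi (skew I1 V1 j) (qrepr q) : chains I1 V1 j)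
  = qpi (skew I1 V1 j) (pc b (qrepr q)) by exact: quo_pcE.
by rewrite cmap_qpi tmap_pc; symmetry; exact: quo_pcE.
Qed.

Lemma cmap_act a z1 z2 j (q : chains I1 V1 j) :
  homog a z1 -> homog a z2 -> intertwines z1 z2 ->
  cmap (act z1 q) = act z2 (cmap q).
Proof.
move=> h1 h2 h; rewrite -(qreprK q) cmap_qpi.
have -> : act z1 (qpi (skew I1 V1 j) (qrepr q) : chains I1 V1 j)
  = qpi (skew I1 V1 j) (act z1 (qrepr q)) by exact: quo_actE.
by rewrite cmap_qpi (tmap_act _ h1 h2 h); symmetry; exact: quo_actE.
Qed.

(** On the ideal, fU is a homomorphism and fV is equivariant along it. The differential involves
    only actions of the ideal, so this yields a chain map. *)
Hypothesis fUV : forall b x, homog b x -> intertwines (uval x) (uval (fU x)).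

Lemma tmap_uval j x (t : tpow I1 V1 j) :
  tmap (act (uval x) t) = act (uval (fU x)) (tmap t).
Proof.
apply: (@homog_ext _ (sub_mod I1) _ (fun x => tmap (act (uval x) t))
  (fun x => act (uval (fU x)) (tmap t))) => [||b {}x hx].
- exact: (linear_comp (@tmap_lin j)
    (linear_comp (@act_linl _ _ (tpow I1 V1 j) t) (@uval_lin _ _ I1))).
- exact: (linear_comp (@act_linl _ _ (tpow I2 V2 j) (tmap t))
    (linear_comp (@uval_lin _ _ I2) fUlin)).
by apply: (tmap_act _ (uval_homog hx) (uval_homog (fU_homog hx))); exact: fUV hx.
Qed.

Lemma tmap_diff j (t : tpow I1 V1 j.+1) : tmap (tdiff t) = tdiff (tmap t).
Proof.
elim: j t => [|j IHj] t;
  apply: (@tcons_homog_ext _ _ _ _ _ _ (fun t => tmap (tdiff t)) (fun t => tdiff (tmap t)));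
  try exact: (linear_comp (@tmap_lin _) (@tdiff_lin _ _ I1 V1 _));
  try exact: (linear_comp (@tdiff_lin _ _ I2 V2 _) (@tmap_lin _.+1));
  move=> a b x c hx hc; rewrite tmap_cons.
- by rewrite !tdiff_cons0 tmap_uval.
by rewrite !tdiff_cons (linEB (@tmap_lin j.+1)) tmap_uval tmap_cons IHj.
Qed.

Lemma cmap_diff j (q : chains I1 V1 j.+1) : cmap (diff q) = diff (cmap q).
Proof. by rewrite -(qreprK q) diff_qpi !cmap_qpi diff_qpi tmap_diff. Qed.

Lemma cmap_cycle j (q : chains I1 V1 j) : cycles I1 V1 j q -> cycles I2 V2 j (cmap q).
Proof.
case: j q => // j q hq; rewrite /= -cmap_diff (hq : diff q = 0).
exact: (linE0 (@cmap_lin j)).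
Qed.

Definition zmap j (z : sub_mod (cycles I1 V1 j)) : sub_mod (cycles I2 V2 j) :=
  subsp_mk (cmap_cycle (subsp_in (z : subsp (cycles I1 V1 j)))).

Lemma zmap_lin j : linear (@zmap j).
Proof. by move=> a x y; apply: subsp_inj; exact: (@cmap_lin j). Qed.

Definition hmap j (h : homology I1 V1 j) : homology I2 V2 j :=
  qpi (boundaries I2 V2 j) (zmap (qrepr h)).

Lemma hmap_qpi j z :
  hmap (qpi (boundaries I1 V1 j) z : homology I1 V1 j) = qpi (boundaries I2 V2 j) (zmap z).
Proof.
apply/qpiP; rewrite -(linEB (@zmap_lin j)).
have : boundaries I1 V1 j (qrepr (qpi (boundaries I1 V1 j) z) - z).
  by apply/(qpiP (boundaries I1 V1 j)); rewrite qreprK.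
move: (qrepr _ - z) => {}z [e he].
by exists (cmap e); rewrite -cmap_diff he.
Qed.

Lemma hmap_lin j : linear (@hmap j).
Proof.
move=> a p q; rewrite -(qreprK p) -(qreprK q) -(qpi_lin (boundaries I1 V1 j)) !hmap_qpi.
by rewrite zmap_lin qpi_lin.
Qed.

Lemma hmap_pc j b (h : homology I1 V1 j) : hmap (pc b h) = pc b (hmap h).
Proof.
rewrite -(qreprK h) hmap_qpi.
have -> : pc b (qpi (boundaries I1 V1 j) (qrepr h) : homology I1 V1 j)
  = qpi (boundaries I1 V1 j) (pc b (qrepr h)) by exact: quo_pcE.
have zpc z : zmap (pc b z) = pc b (zmap z) :> sub_mod (cycles I2 V2 j).
  by apply: subsp_inj; exact: (@cmap_pc j).
by rewrite hmap_qpi zpc; symmetry; exact: quo_pcE.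
Qed.

Lemma hmap_act a z1 z2 j (h : homology I1 V1 j) :
  homog a z1 -> homog a z2 -> intertwines z1 z2 ->
  hmap (act z1 h) = act z2 (hmap h).
Proof.
move=> h1 h2 hi; rewrite -(qreprK h) hmap_qpi.
have -> : act z1 (qpi (boundaries I1 V1 j) (qrepr h) : homology I1 V1 j)
  = qpi (boundaries I1 V1 j) (act z1 (qrepr h)) by exact: quo_actE.
have zact z : zmap (act z1 z) = act z2 (zmap z) :> sub_mod (cycles I2 V2 j).
  by apply: subsp_inj; exact: (cmap_act _ h1 h2 hi).
by rewrite hmap_qpi zact; symmetry; exact: quo_actE.
Qed.

End Functoriality.

Section Retract.
Variables (F : fieldType) (L1 L2 : lieSuper F).
Variables (I1 : submod (adj L1)) (I2 : submod (adj L2)).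
Variables (V1 : smodule L1) (V2 : smodule L2).
Variables (fU : sub_mod I1 -> sub_mod I2) (fV : V1 -> V2).
Variables (gU : sub_mod I2 -> sub_mod I1) (gV : V2 -> V1).
Hypotheses (fUlin : linear fU) (fVlin : linear fV).
Hypotheses (gUlin : linear gU) (gVlin : linear gV).
Hypotheses (fgU : cancel gU fU) (fgV : cancel gV fV).

Lemma tmapK j (t : tpow I2 V2 j) : tmap fU fV (tmap gU gV t) = t.
Proof.
elim: j t => [|j IHj] t; first exact: fgV.
have lf j := @tmap_lin _ _ _ _ _ _ _ _ _ fUlin fVlin j.
have lg j := @tmap_lin _ _ _ _ _ _ _ _ _ gUlin gVlin j.
apply: (@tcons_homog_ext _ _ _ _ _ _ (fun t => tmap fU fV (tmap gU gV t)) (fun t => t)).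
- exact: linear_comp (lf j.+1) (lg j.+1).
- exact: linear_id.
by move=> a b x c _ _; rewrite !tmap_cons // fgU IHj.
Qed.
End Retract.

(** * Elementary matrices acting on modules *)

Section Operators.
Variables (F : fieldType) (k : nat).
Local Notation idx := (idx k).
Local Notation gl_hat := (gl_hat F k).

Section OneAlgebra.
Variable A : subalg gl_hat.

(* Extended by 0 outside of A, so that no membership proof occurs in terms. *)
Definition toA (x : gl_hat) : sub_lie A :=
  if pselect (A x) is left h then subsp_mk h else 0.

Lemma aval_toA x : A x -> aval (toA x) = x.
Proof. by rewrite /toA; case: pselect. Qed.

Lemma aval_inj : injective (@aval F k A).
Proof. exact: (@subsp_inj _ _ A). Qed.

Lemma aval_lin : linear (@aval F k A).
Proof. by []. Qed.

Lemma toA_aval (x : sub_lie A) : toA (aval x) = x.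
Proof. by apply: aval_inj; rewrite aval_toA //; exact: (subsp_in (x : subsp A)). Qed.

Lemma toA_br x y : A x -> A y -> br (toA x) (toA y) = toA (br x y).
Proof.
move=> Ax Ay; apply: aval_inj; rewrite aval_toA; last exact: sa_br.
by rewrite -[LHS]/(br (aval (toA x)) (aval (toA y))) !aval_toA.
Qed.

Lemma toAP a x y : A x -> A y -> toA (a *: x + y) = a *: toA x + toA y.
Proof.
by move=> Ax Ay; apply: aval_inj; rewrite aval_lin !aval_toA //; exact: spP.
Qed.

Lemma toA0 : toA 0 = 0.
Proof. by apply: aval_inj; rewrite aval_toA //; exact: sp0. Qed.

Lemma toA_homog b x : homog b x -> homog b (toA x).
Proof.
rewrite /toA; case: pselect => [Ax|_] hx; last exact: homog0.
by apply: aval_homog.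
Qed.

Lemma toA_span (G : gl_hat -> Prop) (W : subspace (sub_lie A)) :
  (forall x, A x -> lspan G x) -> (forall x, G x -> A x) ->
  (forall g, G g -> W (toA g)) -> forall x, W x.
Proof.
move=> AG GA GW x; apply: (lspan_inj aval_lin aval_inj (G := G)).
  by move=> g Gg; exists (toA g); [exact: aval_toA (GA _ Gg) | exact: GW].
exact: AG (subsp_in (x : subsp A)).
Qed.

Variable V : smodule (sub_lie A).

Definition eop (r s : idx) (v : V) : V := act (toA (Ehat F r s)) v.

(** The index [None] stands for the central element, so that a weight becomes a single function on
    [option idx]. *)
Definition Dhat (j : option idx) : gl_hat := if j is Some r then Ehat F r r else Khat F k.
Definition dop (j : option idx) (v : V) : V := act (toA (Dhat j)) v.
Definition diagonal : Prop := forall j, A (Dhat j).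

Lemma dop_lin j : linear (dop j).
Proof. exact: act_linr. Qed.
Lemma eop_lin r s : linear (eop r s).
Proof. exact: act_linr. Qed.

Lemma Ehat_homog (r s : idx) : homog (mpar (r, s)) (Ehat F r s : gl_hat).
Proof. by rewrite /homog pc_Ehat eqxx. Qed.

Lemma Dhat_homog j : homog false (Dhat j).
Proof.
case: j => [r|]; last by rewrite /homog pc_Khat.
by have := Ehat_homog r r; rewrite /mpar addbb.
Qed.

Lemma eop_homog r s a (v : V) : homog a v -> homog (mpar (r, s) (+) a) (eop r s v).
Proof. by apply: act_homog; apply: toA_homog; exact: Ehat_homog. Qed.

Definition wfun (g : weight F k) : option idx -> F :=
  fun j => if j is Some r then w_eps g r else w_K g.
Definition wgt (g : option idx -> F) : weight F k := Weight (fun r => g (Some r)) (g None).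

Lemma wgtK g : wfun (wgt g) = g.
Proof. by apply: funext => -[]. Qed.

Lemma wspace_eigen g v : diagonal -> wspace g v <-> eigen dop (wfun g) v.
Proof.
move=> hD; split=> [[h1 h2] [r|]|h].
- by apply: h1; rewrite (aval_toA (hD (Some r))).
- by apply: h2; rewrite (aval_toA (hD None)).
split=> [x r hx|x hx]; rewrite -[x]toA_aval hx; first exact: (h (Some r)).
exact: (h None).
Qed.

Definition wshift (g : option idx -> F) (r s : idx) : option idx -> F :=
  fun j => if j is Some t then g j + ((t == r)%:R - (t == s)%:R) else g j.

Lemma eigen_shift g r s v : diagonal -> A (Ehat F r s) ->
  eigen dop g v -> eigen dop (wshift g r s) (eop r s v).
Proof.
move=> hD AE hv.
have := @wspace_shift F k A V (wgt g) (toA (Ehat F r s)) r s v (aval_toA AE).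
rewrite !wspace_eigen //= wgtK => /(_ hv).
by congr (eigen _ _ _); apply: funext => -[].
Qed.

(** The excluded pairs, E_rs with E_sr, are the only ones to which the cocycle can contribute. *)
Lemma eop_br r s t u v : A (Ehat F r s) -> A (Ehat F t u) ->
  ~~ ((s == t) && (r == u)) ->
  eop r s (eop t u v) = (if s == t then eop r u v else 0)
    - ksign F (mpar (r, s)) (mpar (t, u)) *: (if u == r then eop t s v else 0)
    + ksign F (mpar (r, s)) (mpar (t, u)) *: eop t u (eop r s v).
Proof.
move=> A1 A2 ne.
have := @act_br _ _ V _ _ _ _ v (toA_homog (Ehat_homog r s)) (toA_homog (Ehat_homog t u)).
rewrite toA_br // br_EE alpha_EE // scale0r addr0 => h.
rewrite /eop -[LHS](subrK (ksign F (mpar (r, s)) (mpar (t, u)) *: eop t u (eop r s v))).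
congr (_ + _); rewrite -h.
have Aru : s == t -> A (Ehat F r u).
  move=> e; have := sa_br A1 A2; rewrite br_EE alpha_EE // scale0r addr0 e.
  case: ifP => [/eqP eu|_]; first by rewrite e eu eqxx in ne.
  by rewrite scaler0 subr0.
(* [toA] is linear on A only, so E_ts has to be known to lie in A; it is the bracket of the two
   given matrices. *)
have Ats : u == r -> A (Ehat F t s).
  move=> e; have ne2 : ~~ ((u == r) && (t == s)).
    by rewrite andbC [t == s]eq_sym [u == r]eq_sym.
  have := sa_br A2 A1; rewrite br_EE alpha_EE // scale0r addr0 e.
  by rewrite e /= in ne2; rewrite (eq_sym s) (negbTE ne2) scaler0 subr0.
have l0 := linE0 (@act_linl _ _ V v).
case: (eqVneq s t) => [e1|n1]; case: (eqVneq u r) => [e2|n2].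
- by rewrite e1 e2 !eqxx in ne.
- by rewrite !scaler0 !subr0.
- rewrite !sub0r -!scaleNr -[_ *: Ehat F t s]addr0 toAP; last exact: sp0.
    by rewrite toA0 addr0 (linEZ (@act_linl _ _ V v)).
  by apply: Ats; rewrite e2.
- by rewrite !scaler0 !subr0 toA0 l0.
Qed.

(** Both indices lie on the same side of the cut that defines J, so J commutes with E_rs. *)
Lemma alpha_block (r s : idx) : nposI r = nposI s -> alpha (Emat F r s) (Emat F s r) = 0.
Proof.
move=> e; rewrite /alpha adJE e subrr scale0r (linE0 (@mmul_linl F k _)).
exact: (linE0 (@Str_lin F k)).
Qed.

Lemma eop_opp r s v : A (Ehat F r s) -> A (Ehat F s r) -> diagonal ->
  nposI r = nposI s ->
  eop r s (eop s r v) = eop r r v - ksign F (mpar (r, s)) (mpar (r, s)) *: eop s s v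
    + ksign F (mpar (r, s)) (mpar (r, s)) *: eop s r (eop r s v).
Proof.
move=> A1 A2 hD np.
have mC : mpar (s, r) = mpar (r, s) by rewrite /mpar /= addbC.
have := @act_br _ _ V _ _ _ _ v (toA_homog (Ehat_homog r s)) (toA_homog (Ehat_homog s r)).
rewrite toA_br // br_EE alpha_block // scale0r addr0 !eqxx mC => h.
rewrite /eop -[LHS](subrK (ksign F (mpar (r, s)) (mpar (r, s)) *: eop s r (eop r s v))).
congr (_ + _); rewrite -h addrC -scaleNr toAP; try exact: (hD (Some _)).
by rewrite act_linl; lmod_eq F.
Qed.

Lemma eop_opp_eigen g r s v : A (Ehat F r s) -> A (Ehat F s r) -> diagonal ->
  nposI r = nposI s -> eigen dop g v ->
  eop r s (eop s r v) = (g (Some r) - ksign F (mpar (r, s)) (mpar (r, s)) * g (Some s)) *: v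
    + ksign F (mpar (r, s)) (mpar (r, s)) *: eop s r (eop r s v).
Proof.
move=> A1 A2 hD np hv; rewrite eop_opp //; congr (_ + _).
by rewrite -[eop r r v]/(dop (Some r) v) -[eop s s v]/(dop (Some s) v) !hv; lmod_eq F.
Qed.

End OneAlgebra.

Lemma toA_incl (A B : subalg gl_hat) (BA : sub_le B A) x : B x ->
  incl BA (toA B x) = toA A x.
Proof.
move=> Bx; apply: aval_inj; rewrite (aval_toA (BA _ Bx)).
by rewrite -[LHS]/(aval (toA B x)) aval_toA.
Qed.

(** * Compression of matrices to the smaller index set *)

Section Projection.
Local Arguments br : simpl never.
Variable Z : pred int.
Local Notation X := (inX (k := k) Z).

Definition mproj : mat F k -> mat F k :=
  lext (fun p => if X p.1 && X p.2 then Emat F p.1 p.2 else 0).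
Definition gproj (x : gl_hat) : gl_hat := (mproj x.1, x.2).

Lemma mproj_lin : linear mproj.
Proof. exact: lext_lin. Qed.

Lemma gproj_lin : linear gproj.
Proof. by move=> a x y; apply/pair_equal_spec; split=> //; exact: mproj_lin. Qed.

Lemma gproj_E r s : gproj (Ehat F r s) = if X r && X s then Ehat F r s else 0.
Proof. by rewrite /gproj /mproj /= lextE_mat /=; case: ifP. Qed.

Lemma gproj_K : gproj (Khat F k) = Khat F k.
Proof. by rewrite /gproj (linE0 mproj_lin). Qed.

Lemma gproj_pc b x : gproj (pc b x) = pc b (gproj x).
Proof.
apply/pair_equal_spec; split=> //=.
apply: (@mat_ext _ _ _ (fun x => mproj (mpc b x)) (fun x => mpc b (mproj x))).
- exact: (linear_comp mproj_lin (@mpc_lin F k b)).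
- exact: (linear_comp (@mpc_lin F k b) mproj_lin).
move=> r s; rewrite mpcE {2}/mproj lextE_mat /=.
have m0 := linE0 (@mpc_lin F k b).
case: ifP => h1; case: ifP => h2; rewrite ?m0 ?(linE0 mproj_lin) /mproj ?lextE_mat ?mpcE /= ?h1 ?h2 //.
Qed.

(** Compression respects a matrix product when the inner index lies in X; the two products in the
    bracket have inner indices s and r. The cocycle contributes only when both products are nonzero,
    and then every index lies in X. *)
Lemma gproj_br r s t u : (s == t -> X s) -> (u == r -> X r) ->
  br (gproj (Ehat F r s)) (gproj (Ehat F t u)) = gproj (br (Ehat F r s) (Ehat F t u)).
Proof.
move=> h1 h2.
have l0 x : br (0 : gl_hat) x = 0 by exact: (linE0 (@br_linl _ gl_hat x)).
have r0 x : br x (0 : gl_hat) = 0 by exact: (linE0 (@br_linr _ gl_hat x)).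
have p0 : gproj 0 = 0 by exact: (linE0 gproj_lin).
rewrite [in RHS]br_EE (linED gproj_lin) (linEB gproj_lin) !(linEZ gproj_lin) gproj_K.
rewrite !(fun_if gproj) !gproj_E p0.
case: (eqVneq s t) h1 => [<-{t}|nst] h1; case: (eqVneq u r) h2 => [->{u}|nur] h2.
- by rewrite h1 // h2 //= br_EE !eqxx.
- rewrite h1 // andbT /= scaler0 subr0 alpha_EE ?eqxx 1?eq_sym // scale0r addr0.
  case: (X r) => /=; last by rewrite l0.
  case: (X u) => /=; last by rewrite ?r0.
  by rewrite br_EE eqxx (negbTE nur) scaler0 subr0 alpha_EE ?eqxx 1?eq_sym // scale0r addr0.
- rewrite h2 //= andbT alpha_EE ?(negbTE nst) // scale0r addr0.
  case: (X s) => /=; last by rewrite andbF l0 scaler0 subr0.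
  case: (X t) => /=; last by rewrite ?r0 scaler0 subr0.
  by rewrite br_EE (negbTE nst) eqxx alpha_EE ?(negbTE nst) // scale0r addr0.
rewrite scaler0 subr0 alpha_EE ?(negbTE nst) // scale0r addr0.
case: ifP => _; last by rewrite l0.
case: ifP => _; last by rewrite r0.
by rewrite br_EE (negbTE nst) (negbTE nur) scaler0 subr0 alpha_EE ?(negbTE nst) // scale0r addr0.
Qed.

End Projection.
End Operators.

Arguments eop {F k A} V r s v.
Arguments dop {F k A} V j v.
Arguments eop_lin {F k A} V r s.
Arguments dop_lin {F k A} V j.

(** * Singular vectors in irreducible modules *)

Section LocalNilpotency.
Variables (F : fieldType) (V : lmodType F) (f : V -> V).
Hypothesis lf : linear f.

Lemma iter_lin n : linear (iter n f).
Proof.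
elim: n => [|n IHn]; first exact: linear_id.
by move=> a x y; rewrite !iterS IHn lf.
Qed.

(** B raises the order of nilpotency under f by at most d. This holds for an operator killed by d +
    1 successive commutators with f, as [nilshift0] and [nilshiftS] show step by step. *)
Definition nilshift d (B : V -> V) :=
  forall n x, iter n f x = 0 -> iter (n + d) f (B x) = 0.

Lemma iter_nil n m x : (n <= m)%N -> iter n f x = 0 -> iter m f x = 0.
Proof. by move=> /subnK <- h; rewrite iterD h (linE0 (iter_lin _)). Qed.

Lemma nilshift_le d e B : (d <= e)%N -> nilshift d B -> nilshift e B.
Proof. by move=> de hB n x /hB; apply: iter_nil; rewrite leq_add2l. Qed.

Lemma nilshift_lin d a B C : nilshift d B -> nilshift d C ->
  nilshift d (fun x => a *: B x + C x).
Proof. by move=> hB hC n x h; rewrite iter_lin hB // hC // scaler0 addr0. Qed.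

Lemma nilshift0 (A : V -> V) : linear A -> (forall x, f (A x) = A (f x)) -> nilshift 0 A.
Proof.
move=> lA fA n x; rewrite addn0 => h.
suff -> : iter n f (A x) = A (iter n f x) by rewrite h linE0.
by elim: n {h} => //= n ->.
Qed.

Lemma nilshiftS d (A B : V -> V) : linear A ->
  (forall x, f (A x) = A (f x) + B x) -> nilshift d B -> nilshift d.+1 A.
Proof.
move=> lA fA hB; elim=> [|n IHn] x h.
  by rewrite /= in h; rewrite h (linE0 lA) (linE0 (iter_lin _)).
rewrite addSn iterSr fA (linED (iter_lin _)) IHn ?add0r; last by rewrite -iterSr.
by rewrite addnS -addSn; apply: hB.
Qed.

End LocalNilpotency.

(** * Strings for the sl_2 of an even root *)

Section Sl2.
Variables (F : fieldType) (k : nat).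
Local Notation idx := (idx k).
Variables (A : subalg (gl_hat F k)) (V : smodule (sub_lie A)).
Hypothesis hD : diagonal A.
Local Notation e := (eop V).

Lemma iter_wshift (g : option idx -> F) r s j t :
  iter j (fun g => wshift g r s) g (Some t)
    = g (Some t) + j%:R * ((t == r)%:R - (t == s)%:R).
Proof.
elim: j => [|j IHj]; first by rewrite mul0r addr0.
by rewrite iterS /= IHj -natr1 [in RHS]mulrDl mul1r -[LHS]addrA.
Qed.

Lemma eigen_iter g r s j v : A (Ehat F r s) -> eigen (dop V) g v ->
  eigen (dop V) (iter j (fun g => wshift g r s) g) (iter j (e r s) v).
Proof. by move=> hA hv; elim: j => //= j IHj; exact: eigen_shift. Qed.

(** The classical identity for a vector killed by the raising operator. Even parity makes the
    bracket of E_ab and E_ba a commutator, and the two indices being on one side removes its central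
    term. *)
Lemma sl2_string g (a b : idx) w j : A (Ehat F a b) -> A (Ehat F b a) -> a != b ->
  mpar (a, b) = false -> nposI a = nposI b ->
  eigen (dop V) g w -> e a b w = 0 ->
  e a b (iter j.+1 (e b a) w)
    = (j.+1%:R * (g (Some a) - g (Some b) - j%:R)) *: iter j (e b a) w.
Proof.
move=> A1 A2 nab ev np hw h0.
have step i y : eigen (dop V) (iter i (fun g => wshift g b a) g) y ->
    e a b (e b a y) = (g (Some a) - g (Some b) - i%:R *+ 2) *: y + e b a (e a b y).
  move=> hy; rewrite (eop_opp_eigen A1 A2 hD np hy) ev ksignFl scale1r mul1r !iter_wshift.
  have nba : (b == a) = false by rewrite eq_sym (negbTE nab).
  by rewrite !eqxx (negbTE nab) nba /= subr0 sub0r mulrN1 mulr1; congr (_ *: _ + _); ring.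
elim: j => [|j IHj].
  by rewrite (step 0%N) //= h0 (linE0 (eop_lin _ _ _)) addr0; congr (_ *: _); ring.
rewrite iterS (step j.+1); last exact: eigen_iter.
rewrite IHj (linEZ (eop_lin _ _ _)) -iterS -scalerDl; congr (_ *: _).
by rewrite -!natr1; ring.
Qed.
End Sl2.

(** * Submodules generated by a singular vector *)

Section Irreducible.
Variables (F : numFieldType) (k : nat) (Y0 : {set 'I_k.-1}).
Local Notation idx := (idx k).
Local Notation A := (ltilde F Y0).
Variables (V : smodule (sub_lie A)) (N : submod V).
Local Notation lev := (leviS Y0 half_all).
Local Notation e := (eop V).
Local Notation wt := (option idx -> F).

Lemma ltilde_E r s : lev r s -> A (Ehat F r s).
Proof. by move=> h; apply: lspan_sub; right; exists r, s. Qed.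

Lemma ltilde_K : A (Khat F k).
Proof. by apply: lspan_sub; left. Qed.

Lemma lev_refl r : lev r r.
Proof. by split; [case: r | case: r | exact: levi_root_refl]. Qed.

Lemma ltilde_diag : diagonal A.
Proof. by case=> [r|]; [apply: ltilde_E; exact: lev_refl | exact: ltilde_K]. Qed.

Lemma lev_npos r s : lev r s -> nposI r = nposI s.
Proof. by move=> /leviE[_ _]; case: r s => [i|m] [j|n]. Qed.

Lemma submod_gen (S : subspace V) :
  (forall b v, S v -> S (pc b v)) -> (forall r s v, lev r s -> S v -> S (e r s v)) ->
  (forall v, S v -> S (dop V None v)) ->
  exists N' : submod V, forall v, N' v <-> S v.
Proof.
move=> hpc hE hK.
have hact x v : S v -> S (act x v).
  move=> Sv; apply: (@toA_span _ _ A (span_gen lev true) (preim_sp (@act_linl _ _ V v) S)).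
  - by [].
  - by move=> y; exact: lspan_sub.
  move=> g [[_ ->]|[r [s [h ->]]]]; [exact: hK | exact: hE].
by exists (@SubMod _ _ V (SubSuper hpc) hact).
Qed.

Definition word (l : seq (idx * idx)) (x : V) : V := foldr (fun p => e p.1 p.2) x l.
Definition wword (l : seq (idx * idx)) (g : wt) : wt :=
  foldr (fun p g => wshift g p.1 p.2) g l.

Lemma erootE (r s t : idx) : (eroot r s t)%:~R = (t == r)%:R - (t == s)%:R :> F.
Proof. by rewrite /eroot rmorphB /= !rmorph_nat. Qed.

Lemma wwordE l g t : wword l g (Some t) = g (Some t) + (\sum_(x <- l) eroot x.1 x.2 t)%:~R.
Proof.
elim: l => [|p l IHl] /=; first by rewrite big_nil addr0.
by rewrite IHl big_cons [in RHS]rmorphD /= erootE -[LHS]addrA [X in _ + X]addrC.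
Qed.

Hypothesis irr : forall N' : submod V, (forall v, N' v -> N v) ->
  (forall v, N' v -> v = 0) \/ (forall v, N v -> N' v).

Section Order.
Variable lt : idx -> idx -> bool.

(** The order is a parameter, as both the given order and the one after an odd reflection occur. *)
Definition singular (x : V) := forall a b, lev a b -> lt a b -> e a b x = 0.

(** Asking only that [lt] fail lets diagonal letters count as lowering, so every letter of the Levi
    subalgebra is either raising or lowering. *)
Definition lowering (l : seq (idx * idx)) :=
  forall p, p \in l -> lev p.1 p.2 /\ ~~ lt p.1 p.2.

Lemma word_eigen l g x : lowering l -> eigen (dop V) g x ->
  eigen (dop V) (wword l g) (word l x).
Proof.
elim: l => [|p l IHl] //= hl hx; apply: eigen_shift.
- exact: ltilde_diag.
- by apply: ltilde_E; case: (hl p); rewrite ?mem_head.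
by apply: IHl => // q ql; apply: hl; rewrite inE ql orbT.
Qed.

Lemma word_homog l b x : homog b x -> exists b', homog b' (word l x).
Proof.
move=> hx; elim: l => [|p l [b' IHl]] /=; first by exists b.
by exists (mpar p (+) b'); case: p => r s; exact: eop_homog.
Qed.

Lemma word_N l x : N x -> N (word l x).
Proof. by move=> Nx; elim: l => //= p l; exact: sm_act. Qed.

(** The lowering words applied to x span a submodule: a raising operator is commuted to the right
    until it meets x. By irreducibility this submodule contains N. *)
Lemma singular_generates x g b : N x -> homog b x -> x <> 0 ->
  eigen (dop V) g x -> singular x ->
  forall y, N y -> lspan (fun v => exists2 l, lowering l & v = word l x) y.
Proof.
move=> Nx hx x0 gx sx.
set P := (fun v => _); set W := lspan P.
have Wlow a c v : lev a c -> ~~ lt a c -> W v -> W (e a c v).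
  move=> lac nac; apply: (lspan_ind (eop_lin V a c)) => {}v [l hl ->].
  apply: lspan_sub; exists ((a, c) :: l) => // p; rewrite inE => /orP[/eqP -> //|].
  exact: hl.
have Wword l : lowering l -> forall a c, lev a c -> W (e a c (word l x)).
  elim: l => [|p l IHl] hl a c lac.
    have [ltac|nac] := boolP (lt a c); first by rewrite sx //; exact: sp0.
    by apply: Wlow => //; apply: lspan_sub; exists [::].
  have hl' : lowering l by move=> q ql; apply: hl; rewrite inE ql orbT.
  have Wl : W (word l x) by apply: lspan_sub; exists l.
  have [lp np] := hl p (mem_head _ _).
  have [ltac|nac] := boolP (lt a c); last first.
    by apply: Wlow => //; apply: lspan_sub; exists (p :: l).
  have Ap := ltilde_E lp; have Aac := ltilde_E lac.
  have -> : word (p :: l) x = e p.1 p.2 (word l x) by [].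
  case: p {hl} lp np Ap => r s lrs nrs Ars; rewrite [(_, _).1]/= [(_, _).2]/= in lrs nrs Ars *.
  (* For opposite root vectors the bracket is diagonal and acts by the weight of the remaining
     word. *)
  have [/andP[/eqP e1 /eqP e2]|ne] := boolP ((c == r) && (a == s)).
    rewrite -e1 -e2 in lrs nrs Ars *.
    rewrite (eop_opp_eigen Aac Ars ltilde_diag (lev_npos lac) (word_eigen hl' gx)).
    by apply: spD; apply: spZ => //; apply: Wlow => //; exact: IHl.
  rewrite eop_br //; apply: spD; first apply: spB.
  - case: eqP => [e1|_]; last exact: sp0.
    by apply: IHl => //; rewrite e1 in lac; exact: leviS_trans lrs.
  - apply: spZ; case: eqP => [e1|_]; last exact: sp0.
    by apply: IHl => //; rewrite e1 in lrs; exact: leviS_trans lac.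
  by apply: spZ; apply: Wlow => //; exact: IHl.
have [||| N' hN'] := @submod_gen W.
- move=> d v; apply: (lspan_ind (@pc_lin _ V d)) => {}v [l hl ->].
  have [b' hb] := word_homog l hx; rewrite (pc_homog _ hb).
  by case: eqP => _; [apply: lspan_sub; exists l | exact: sp0].
- move=> r s v lrs; apply: (lspan_ind (eop_lin V r s)) => {}v [l hl ->].
  exact: Wword.
- move=> v; apply: (lspan_ind (dop_lin V None)) => {}v [l hl ->].
  by rewrite (word_eigen hl gx); apply: spZ; apply: lspan_sub; exists l.
case: (@irr N').
- move=> v /hN'; apply: (lspan_min (W := N)) => {}v [l _ ->]; exact: word_N.
- by move=> /(_ x) h; case: x0; apply: h; apply/hN'; apply: lspan_sub; exists [::].
by move=> h y /h /hN'.
Qed.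

Lemma sum_eroot (D : seq idx) (B : pred idx) (p q : idx) : uniq D -> p \in D -> q \in D ->
  \sum_(t <- D | B t) eroot p q t = (B p)%:R - (B q)%:R.
Proof.
move=> uD; have one u : u \in D -> \sum_(t <- D | B t) ((t == u)%:R : int) = (B u)%:R.
  move=> uD'; rewrite big_mkcond (bigD1_seq u) //= eqxx.
  rewrite big1 ?addr0 => [|t ne]; last by rewrite (negbTE ne) if_same.
  by case: (B u).
by move=> pD qD; rewrite /eroot sumrB !one.
Qed.

Hypotheses (lt_total : forall a b, [|| a == b, lt a b | lt b a])
  (lt_trans : forall a b c, lt a b -> lt b c -> lt a c) (lt_irr : forall a, ~~ lt a a).

(** If x were nonzero it would generate N by lowering words, and the higher weight gy could not
    occur. The two weights are compared by adding coordinates over an initial segment of the order: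
    a lowering root never increases such a sum. *)
Lemma singular_eq0 x y gx gy b p q c : N x -> homog b x -> eigen (dop V) gx x ->
  singular x -> N y -> y <> 0 -> eigen (dop V) gy y -> lt p q -> (0 < c)%N ->
  (forall t, gy (Some t) = gx (Some t) + c%:R * ((t == p)%:R - (t == q)%:R)) ->
  x = 0.
Proof.
move=> Nx hx ex sx Ny y0 ey ltpq c0 hg; apply: contrapT => x0.
have hy := singular_generates Nx hx x0 ex sx Ny.
have [|u [l hl ul] [eu u0]] := eigen_weight (dop_lin V) _ hy ey y0.
  by move=> u [l hl ->]; exists (wword l gx); exact: word_eigen.
have := eigen_inj eu (_ : eigen _ (wword l gx) u) u0.
rewrite ul => /(_ (word_eigen hl ex)) hgl.
have hr t : c%:Z * eroot p q t = \sum_(z <- l) eroot z.1 z.2 t.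
  apply: (@intr_inj F); have := hg t; rewrite hgl wwordE => /addrI ->.
  by rewrite rmorphM /= erootE.
pose D := undup (p :: q :: flatten [seq [:: z.1; z.2] | z <- l]).
(* The segment ends at p and so separates p from q: the total on the left is c. D collects the
   finitely many indices that occur. *)
pose B t := (t == p) || lt t p.
have Dp : p \in D by rewrite mem_undup mem_head.
have Dq : q \in D by rewrite mem_undup !inE eqxx orbT.
have Dl z : z \in l -> z.1 \in D /\ z.2 \in D.
  move=> zl; rewrite !mem_undup !inE; split; apply/orP; right; apply/orP; right;
   by apply/flattenP; exists [:: z.1; z.2]; rewrite ?inE ?eqxx ?orbT //; apply/mapP; exists z.
have : \sum_(t <- D | B t) (c%:Z * eroot p q t) = \sum_(t <- D | B t) \sum_(z <- l) eroot z.1 z.2 t.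
  by apply: eq_bigr => t _; exact: hr.
rewrite -mulr_sumr sum_eroot ?undup_uniq // exchange_big /=.
have -> : B p = true by rewrite /B eqxx.
have -> : B q = false.
  apply/negbTE/negP => /orP[/eqP qp|ltqp]; first by rewrite qp (negbTE (lt_irr _)) in ltpq.
  by have := lt_irr p; rewrite (lt_trans ltpq ltqp).
rewrite subr0 mulr1 => hc.
suff : \sum_(z <- l) \sum_(t <- D | B t) eroot z.1 z.2 t <= 0 by rewrite -hc; move: c0; lia.
rewrite big_seq; apply: sumr_le0 => z zl; have [z1 z2] := Dl z zl.
rewrite sum_eroot ?undup_uniq // subr_le0.
have [_ nz] := hl z zl.
have : B z.1 -> B z.2.
  have /or3P[/eqP -> //|h|h] := lt_total z.1 z.2; first by rewrite h in nz.
  rewrite /B => /orP[/eqP <-|h']; first by rewrite h orbT.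
  by rewrite (lt_trans h h') orbT.
by case: (B z.1); case: (B z.2) => // /(_ isT).
Qed.
End Order.
End Irreducible.

(** * Local nilpotency by odd reflection *)

Section Triple.
Variables (F : numFieldType) (k : nat) (Y0 : {set 'I_k.-1}).
Local Notation idx := (idx k).
Local Notation A := (ltilde F Y0).
Variables (V : smodule (sub_lie A)) (N : submod V).
Local Notation lev := (leviS Y0 half_all).
Local Notation e := (eop V).
Local Notation wt := (option idx -> F).
Hypothesis irr : forall N' : submod V, (forall v, N' v -> N v) ->
  (forall v, N' v -> v = 0) \/ (forall v, N v -> N' v).

Lemma oddzS m : oddz (m + 1) = ~~ oddz m.
Proof. by rewrite /oddz; lia. Qed.

Let near_int (m n : int) : n != m -> n != m + 1 -> (n < m) = (n < m + 1) /\ (m < n) = (m + 1 < n).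
Proof. by move=> h1 h2; split; apply/idP/idP; lia. Qed.

Let side_int (m : int) : (m <= 0) = (m + 2 <= 0) -> (m + 1 <= 0) = (m <= 0).
Proof. by move=> h; apply/idP/idP; lia. Qed.

Let no_int (m n : int) : m + 1 < n -> n < m + 2 -> False.
Proof. by lia. Qed.

Variables (m : int) (side : (m <= 0) = (m + 2 <= 0)).
Let p : idx := inr m.
Let s : idx := inr (m + 1).
Let q : idx := inr (m + 2).

(** Exchanging p and s gives the order after the odd reflection, in which s, p, q are
    consecutive. *)
Let swap (t : idx) : idx := if t == p then s else if t == s then p else t.
Let lt' (a b : idx) : bool := ltI (swap a) (swap b).

Let inrE (i j : int) : ((inr i : idx) == inr j) = (i == j).
Proof. exact: (inj_eq inr_inj). Qed.

Let ps : (p == s) = false. Proof. by rewrite inrE; lia. Qed.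
Let pq : (p == q) = false. Proof. by rewrite inrE; lia. Qed.
Let sp : (s == p) = false. Proof. by rewrite inrE; lia. Qed.
Let qp : (q == p) = false. Proof. by rewrite inrE; lia. Qed.
Let qs : (q == s) = false. Proof. by rewrite inrE; lia. Qed.
Let lps : ltI p s. Proof. by rewrite /=; lia. Qed.
Let lpq : ltI p q. Proof. by rewrite /=; lia. Qed.

Let lev_inr i j : (i <= 0) = (j <= 0) -> lev (inr i) (inr j).
Proof. by move=> h; apply/leviE. Qed.
Let levsp : lev s p. Proof. by apply: lev_inr; rewrite side_int. Qed.
Let levps : lev p s. Proof. exact: leviS_sym levsp. Qed.
Let levqp : lev q p. Proof. by apply: lev_inr; rewrite side. Qed.
Let levpq : lev p q. Proof. exact: leviS_sym levqp. Qed.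
Let mps : mpar (p, s) = true.
Proof. by rewrite /mpar /= oddzS; case: (oddz m). Qed.
Let mpq : mpar (p, q) = false.
Proof. by rewrite /mpar /= (_ : m + 2 = (m + 1) + 1) ?oddzS ?negbK ?addbb // -addrA. Qed.
Let mqp : mpar (q, p) = false. Proof. by move: mpq; rewrite /mpar /= addbC. Qed.
Let nps : nposI p = nposI s. Proof. exact: lev_npos levps. Qed.
Let npq : nposI p = nposI q. Proof. exact: lev_npos levpq. Qed.

Let swap_inj : injective swap.
Proof.
move=> a b; rewrite /swap; case: (eqVneq a p) => [->|ap]; case: (eqVneq b p) => [->|bp] //.
- by case: eqP => [->|ne] // h; case: ne; rewrite h.
- by case: eqP => [->|ne] // h; case: ne; rewrite -h.
case: (eqVneq a s) => [->|as_]; case: (eqVneq b s) => [->|bs] // h.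
- by rewrite h eqxx in bp.
- by rewrite h eqxx in ap.
Qed.

Let lt'_total a b : [|| a == b, lt' a b | lt' b a].
Proof. by have := ltI_total (swap a) (swap b); rewrite (inj_eq swap_inj). Qed.
Let lt'_trans a b c : lt' a b -> lt' b c -> lt' a c.
Proof. exact: ltI_trans. Qed.
Let lt'_irr a : ~~ lt' a a.
Proof. exact: ltI_irr. Qed.

Let near_ps (a : idx) : a != p -> a != s -> ltI a p = ltI a s /\ ltI p a = ltI s a.
Proof.
case: a => [i|n]; last by rewrite !inrE; exact: near_int.
by rewrite /p /s /= !ltNge (side_int side).
Qed.

Let no_between (a : idx) : ltI s a -> ltI a q -> False.
Proof.
case: a => [i|n]; last exact: no_int.
by rewrite /s /q /= (side_int side) side ltNge => ->.
Qed.

(** The reflection trades the root of (p, s) for its negative; since p and s are adjacent, all other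
    pairs keep their order. *)
Let lt'E a b : lt' a b -> (a, b) = (s, p) \/ (ltI a b /\ (a, b) <> (p, s)).
Proof.
rewrite /lt' /swap; case: (eqVneq a p) => [->|ap].
  case: (eqVneq b p) => [->|bp]; first by rewrite (negbTE (ltI_irr _)).
  case: (eqVneq b s) => [->|bs].
    by move=> h; have := ltI_irr p; rewrite (ltI_trans lps h).
  by move=> h; right; rewrite (near_ps bp bs).2 h; split=> // -[e1]; rewrite e1 eqxx in bs.
case: (eqVneq a s) => [->|as_].
  case: (eqVneq b p) => [->|bp]; first by left.
  case: (eqVneq b s) => [->|bs]; first by rewrite (negbTE (ltI_irr _)).
  by move=> h; right; rewrite -(near_ps bp bs).2 h; split=> // -[/eqP]; rewrite -inrE sp.
case: (eqVneq b p) => [->|bp].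
  by move=> h; right; rewrite (near_ps ap as_).1 h; split=> // -[e1 _]; rewrite e1 eqxx in ap.
case: (eqVneq b s) => [->|bs].
  by move=> h; right; rewrite -(near_ps ap as_).1 h; split=> // -[e1]; rewrite e1 eqxx in ap.
by move=> h; right; split=> // -[e1]; rewrite e1 eqxx in ap.
Qed.

Let lt'_pq : lt' p q.
Proof. by rewrite /lt' /swap eqxx qp qs /= ltrD2l. Qed.
Let eE a b c d v : lev a b -> lev c d -> ~~ ((b == c) && (a == d)) ->
  (b = c -> e a d v = 0) -> (d = a -> e c b v = 0) -> e a b v = 0 -> e a b (e c d v) = 0.
Proof.
move=> l1 l2 ne h1 h2 h0; rewrite eop_br //; [|exact: ltilde_E..].
rewrite h0 (linE0 (eop_lin V _ _)) scaler0 addr0.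
by case: eqP => [/h1 ->|_]; case: eqP => [/h2 ->|_]; rewrite ?scaler0 ?subr0.
Qed.

(** Up to sign, the bracket of E_ab with E_sp is E_ap, E_sb or 0. The first two still raise, because
    no index lies between p and s. *)
Let raise_from_s v : singular (V := V) (Y0 := Y0) (@ltI k) v ->
  forall a b, lev a b -> ltI a b -> (a, b) <> (p, s) -> e a b (e s p v) = 0.
Proof.
move=> sv a b lab h ne; apply: eE => //.
- by apply/negP => /andP[/eqP e1 /eqP e2]; apply: ne; rewrite e1 e2.
- move=> e1; apply: sv; first by rewrite e1 in lab; exact: leviS_trans levsp.
  have ap : a != p by apply/eqP => e2; apply: ne; rewrite e1 e2.
  by rewrite e1 in h; rewrite (near_ps ap _).1 //; apply/eqP => e2; rewrite e2 (negbTE (ltI_irr _)) in h.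
- move=> e1; apply: sv; first by rewrite -e1 in lab; exact: leviS_trans lab.
  have bs : b != s by apply/eqP => e2; apply: ne; rewrite -e1 e2.
  by rewrite -e1 in h; rewrite -(near_ps _ bs).2 //; apply/eqP => e2; rewrite e2 (negbTE (ltI_irr _)) in h.
exact: sv.
Qed.

Let f := e q p.

Let fbr a b x : lev a b -> ~~ ((p == a) && (q == b)) ->
  f (e a b x) = (if p == a then e q b x else 0) - (if b == q then e a p x else 0)
    + e a b (f x).
Proof.
move=> lab ne; rewrite /f (eop_br x (ltilde_E levqp) (ltilde_E lab) ne).
by rewrite mqp ksignFl !scale1r.
Qed.

Let lf : linear f. Proof. exact: (eop_lin V). Qed.

Let nil_f0 a b : lev a b -> a != p -> b != q -> nilshift f 0 (e a b).
Proof.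
move=> lab ap bq; apply: nilshift0; first exact: (eop_lin V).
have pa : (p == a) = false by rewrite eq_sym (negbTE ap).
by move=> x; rewrite fbr ?pa // (negbTE bq) subr0 add0r.
Qed.

Let nil_fN a b : nilshift f 0 (e a b) -> nilshift f 0 (fun x => - e a b x).
Proof. by move=> h n x hx; rewrite (linEN (iter_lin lf _)) h ?oppr0. Qed.

Let nil_f1l b : lev p b -> b != q -> nilshift f 1 (e p b).
Proof.
move=> lpb bq; have lqb : lev q b by exact: leviS_trans levqp lpb.
apply: (nilshiftS lf (eop_lin V p b) (B := e q b)); last by apply: nil_f0; rewrite ?qp.
have qb : (q == b) = false by rewrite eq_sym (negbTE bq).
by move=> x; rewrite fbr ?qb ?andbF // eqxx (negbTE bq) subr0 addrC.
Qed.

Let nil_f1r a : lev a q -> a != p -> nilshift f 1 (e a q).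
Proof.
move=> laq ap; have lap : lev a p by exact: leviS_trans laq levqp.
apply: (nilshiftS lf (eop_lin V a q) (B := fun x => - e a p x)); last first.
  by apply: nil_fN; apply: nil_f0; rewrite ?pq.
have pa : (p == a) = false by rewrite eq_sym (negbTE ap).
by move=> x; rewrite fbr ?pa // eqxx sub0r addrC.
Qed.

(** The extreme case is E_pq: its commutator with f is diagonal, the next one is a multiple of f,
    and the third vanishes. *)
Let nil_f a b : lev a b -> nilshift f 2 (e a b).
Proof.
move=> lab; case: (eqVneq a p) lab => [->|ap] lab; case: (eqVneq b q) lab => [->|bq] lab.
- have h1 : nilshift f 1 (e p p) by apply: nil_f1l; rewrite ?pq //; exact: lev_refl.
  have h2 : nilshift f 1 (e q q) by apply: nil_f1r; rewrite ?qp //; exact: lev_refl.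
  apply: (nilshiftS lf (eop_lin V p q) (B := fun x => (-1) *: e p p x + e q q x)).
    move=> x; rewrite /f (eop_opp x (ltilde_E levqp) (ltilde_E levpq)
      (@ltilde_diag F k Y0) (esym npq)) mqp ksignFl !scale1r.
    by rewrite scaleN1r addrC [- _ + _]addrC.
  exact: (nilshift_lin lf).
- by apply: (nilshift_le lf (d := 1)) => //; exact: nil_f1l.
- by apply: (nilshift_le lf (d := 1)) => //; exact: nil_f1r.
by apply: (nilshift_le lf (d := 0)) => //; exact: nil_f0.
Qed.

Variable (lam : wt).
Hypothesis hw : exists v, [/\ N v, v <> 0, eigen (dop V) lam v &
  forall a b, lev a b -> ltI a b -> e a b v = 0].
(** The sum is the pairing of lam with the odd root of (p, s). If it is nonzero, the reflected
    highest weight is lam - eps_p + eps_s, which accounts for the 1; if it is zero, the reflection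
    leaves lam unchanged. *)
Hypothesis dom1 : lam (Some p) + lam (Some s) <> 0 ->
  exists c : nat, lam (Some p) - 1 - lam (Some q) = c%:R.
Hypothesis dom0 : lam (Some p) + lam (Some s) = 0 ->
  exists c : nat, lam (Some p) - lam (Some q) = c%:R.

Let even_eop r t b v : mpar (r, t) = false -> e r t (pc b v) = pc b (e r t v).
Proof.
move=> h; have [la|na] := pselect (A (Ehat F r t)).
  by apply: act_even; rewrite aval_toA //; rewrite -h; exact: Ehat_homog.
rewrite /eop /toA; case: pselect => // _.
by rewrite !(linE0 (@act_linl _ _ V _)) (linE0 (@pc_lin _ V b)).
Qed.

(** A highest weight vector need not be homogeneous. Root vectors are homogeneous and diagonal
    elements are even, so any nonzero homogeneous component is again a highest weight vector. *)
Let homog_hw : exists b v, [/\ N v, v <> 0, homog b v, eigen (dop V) lam v &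
  singular (V := V) (Y0 := Y0) (@ltI k) v].
Proof.
have [v [Nv v0 ev sv]] := hw.
have [b vb0] : exists b, pc b v <> 0.
  apply: contrapT => no; apply: v0; rewrite -(pc_sum v).
  have h b : pc b v = 0 by apply: contrapT => h; apply: no; exists b.
  by rewrite !h addr0.
exists b, (pc b v); split=> //.
- exact: su_pc.
- exact: homog_pc.
- move=> j; rewrite -(linEZ (@pc_lin _ V b)) -ev; apply: act_even.
  by rewrite (aval_toA (@ltilde_diag F k Y0 j)); exact: Dhat_homog.
move=> a c lac h; have := sv a c lac h.
rewrite -{1}(pc_sum v) (linED (eop_lin V _ _)) => h0.
have hh d : homog (mpar (a, c) (+) d) (e a c (pc d v)) by apply: eop_homog; exact: homog_pc.
have := congr1 (pc (mpar (a, c) (+) b)) h0.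
rewrite (linED (@pc_lin _ V _)) (linE0 (@pc_lin _ V _)) !(pc_homog _ (hh _)).
by case: (mpar _); case: (b) => /=; rewrite ?add0r ?addr0.
Qed.

(* The odd reflection in the root of (p, s) makes (p, q) adjacent. *)
Let swapped : exists b v g c, [/\ N v, v <> 0, homog b v, eigen (dop V) g v &
  singular (V := V) (Y0 := Y0) lt' v] /\ g (Some p) - g (Some q) = c%:R.
Proof.
have [b [v [Nv v0 hb ev sv]]] := homog_hw.
have hsp : A (Ehat F s p) by exact: ltilde_E.
have hps : A (Ehat F p s) by exact: ltilde_E.
(* For an odd root the two root vectors anticommute to E_pp + E_ss, hence a sum instead of a
   difference. *)
have key : e p s (e s p v) = (lam (Some p) + lam (Some s)) *: v.
  rewrite (eop_opp_eigen hps hsp (@ltilde_diag F k Y0) nps ev) mps ksignT mulN1r opprK.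
  by rewrite sv // (linE0 (eop_lin V _ _)) scaler0 addr0.
have [l0|/eqP l0] := pselect (lam (Some p) + lam (Some s) = 0); last first.
  have [c hc] := dom1 (elimN eqP l0).
  exists (mpar (s, p) (+) b), (e s p v), (wshift lam s p), c; split; last first.
    by rewrite /wshift eqxx ps qs qp /= subr0 addr0 sub0r.
  split.
  - exact: sm_act.
  - move=> h; move: key; rewrite h (linE0 (eop_lin V _ _)) => /esym/eqP.
    by rewrite scaler_eq0 (negbTE l0) => /eqP.
  - exact: eop_homog.
  - by apply: eigen_shift => //; exact: ltilde_diag.
  move=> a d lad /lt'E[[-> ->]|[h ne]]; last exact: raise_from_s.
  (* E_sp is odd with zero bracket with itself, so its square equals its own negative. *)
  have h : e s p (e s p v) = (-1) *: e s p (e s p v).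
    rewrite {1}eop_br // ?ps ?sp // scaler0 subr0 add0r.
    by rewrite (_ : mpar (s, p) = true) ?ksignT //; move: mps; rewrite /mpar /= addbC.
  have : (1 + 1) *: e s p (e s p v) = 0 by rewrite scalerDl scale1r {1}h scaleN1r addNr.
  by move=> /eqP; rewrite scaler_eq0 -[1 + 1]/(2%:R) pnatr_eq0 => /eqP.
have [c hc] := dom0 l0.
(* Here E_sp v is singular for the original order while v has higher weight, so it vanishes. *)
have sp0 : e s p v = 0.
  apply: (@singular_eq0 F k Y0 V N irr (@ltI k) (@ltI_total k)
    (fun a b c => @ltI_trans k b a c) (@ltI_irr k) (e s p v) v (wshift lam s p) lam
    (mpar (s, p) (+) b) p s 1).
  - exact: sm_act.
  - exact: eop_homog.
  - by apply: eigen_shift => //; exact: ltilde_diag.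
  - move=> a d lad h; have [[-> ->]|ne] := pselect ((a, d) = (p, s)).
      by rewrite key l0 scale0r.
    exact: raise_from_s.
  - exact: Nv.
  - exact: v0.
  - exact: ev.
  - exact: lps.
  - by [].
  by move=> t; rewrite /wshift; ring.
exists b, v, lam, c; split; last exact: hc.
split; [exact: Nv | exact: v0 | exact: hb | exact: ev |] => a d lad.
by case/lt'E=> [[-> ->]|[h _]]; [exact: sp0 | exact: sv].
Qed.

Lemma locally_nilpotent y : N y -> exists n, iter n (eop V q p) y = 0.
Proof.
have [b [v [g [c [[Nv v0 hb ev sv] hc]]]]] := swapped.
have hqp : A (Ehat F q p) by exact: ltilde_E.
have hpq : A (Ehat F p q) by exact: ltilde_E.
have xN j : N (iter j f v) by elim: j => //= j; exact: sm_act.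
have xh j : homog b (iter j f v).
  by elim: j => //= j IHj; have := eop_homog q p IHj; rewrite mqp.
(* In the new order p and q are adjacent, so the bracket of f with a raising operator other than
   E_pq is 0 or, up to sign, again such an operator. *)
have xs j : forall a d, lev a d -> lt' a d -> (a, d) <> (p, q) -> e a d (iter j f v) = 0.
  elim: j => [|j IHj] a d lad h ne; first exact: sv.
  rewrite iterS; apply: eE => //.
  - by apply/negP => /andP[/eqP e1 /eqP e2]; apply: ne; rewrite e1 e2.
  - move=> e1; apply: IHj.
    + by rewrite e1 in lad; exact: leviS_trans levqp.
    + have /or3P[/eqP e2|//|h'] := lt'_total a p; first by case: ne; rewrite e1 e2.
      move: h h'; rewrite e1 /lt' /swap eqxx qp qs => h h'.
      by case: (no_between h' h).
    + by move=> /eqP; rewrite xpair_eqE pq andbF.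
  - move=> e1; apply: IHj.
    + by rewrite -e1 in lad; exact: leviS_trans lad.
    + have dq : d != q by apply/eqP => e2; apply: ne; rewrite -e1 e2.
      have /or3P[/eqP e2|//|h'] := lt'_total q d; first by rewrite e2 eqxx in dq.
      move: h h'; rewrite -e1 /lt' /swap eqxx qp qs => h h'.
      by case: (no_between h h').
    + by move=> /eqP; rewrite xpair_eqE qp.
  exact: IHj.
(* The factor in [sl2_string] vanishes after exactly c steps, so f^(c+1) v is singular, of lower
   weight than v. *)
have x0 : iter c.+1 f v = 0.
  apply: (@singular_eq0 F k Y0 V N irr lt' lt'_total lt'_trans lt'_irr (iter c.+1 f v) v
    (iter c.+1 (fun g => wshift g q p) g) g b p q c.+1) => //.
  - by apply: eigen_iter => //; exact: ltilde_diag.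
  - move=> a d lad h; have [[-> ->]|ne] := pselect ((a, d) = (p, q)); last exact: xs.
    have hv0 : e p q v = 0 by apply: sv; [exact: levpq | exact: lt'_pq].
    rewrite /f (@sl2_string F k A V (@ltilde_diag F k Y0) g p q v c hpq hqp
      (negbT pq) mpq npq ev hv0).
    by rewrite hc subrr mulr0 scale0r.
  by move=> t; rewrite iter_wshift; ring.
have f0 n : iter n f 0 = 0 by exact: (linE0 (iter_lin (eop_lin V q p) n)).
(* The vectors of N killed by some power of f form a submodule. It contains v, so it is all of N. *)
have nil0 : N 0 /\ exists n, iter n f 0 = 0 by split; [exact: sp0 | exists 0].
have nilP a u w : (N u /\ exists n, iter n f u = 0) -> (N w /\ exists n, iter n f w = 0) ->
    N (a *: u + w) /\ exists n, iter n f (a *: u + w) = 0.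
  move=> [Nu [n hn]] [Nw [n' hn']]; split; first exact: spP.
  exists (maxn n n'); rewrite (iter_lin (eop_lin V q p)).
  rewrite (iter_nil (eop_lin V q p) (leq_maxl n n') hn).
  by rewrite (iter_nil (eop_lin V q p) (leq_maxr n n') hn') scaler0 addr0.
have [||| N' hN'] := @submod_gen F k Y0 V (Subspace nil0 nilP).
- move=> d u [Nu [n hn]]; split; first exact: su_pc.
  exists n; suff -> : iter n f (pc d u) = pc d (iter n f u) by rewrite hn (linE0 (@pc_lin _ V d)).
  by elim: n {hn} => //= n ->; exact: even_eop.
- move=> r t u lrt [Nu [n hn]]; split; first exact: sm_act.
  by exists (n + 2)%N; exact: nil_f.
- move=> u [Nu [n hn]]; split; first exact: sm_act.
  exists n; suff -> : iter n f (dop V None u) = dop V None (iter n f u).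
    by rewrite hn (linE0 (dop_lin V _)).
  elim: n {hn} => //= n ->.
  have h1 : homog false (toA A (Khat F k)).
    by apply: toA_homog; exact: (Dhat_homog F (None : option idx)).
  have h2 : homog false (toA A (Ehat F q p)).
    by rewrite -mqp; apply: toA_homog; exact: Ehat_homog.
  have := @act_br _ _ V _ _ _ _ (iter n f u) h1 h2.
  rewrite (toA_br (@ltilde_K F k Y0) hqp) br_Khatl toA0.
  rewrite (linE0 (@act_linl _ _ V _)) ksignFl scale1r => /esym/eqP.
  by rewrite subr_eq0 => /eqP h3; exact: (esym h3).
have subN u : N' u -> N u by move=> /hN'[].
have v'N : N' v by apply/hN'; split=> //; exists c.+1.
case: (irr subN) => [h|h Ny]; first by case: v0; exact: h.
by have /hN'[] := h y Ny.
Qed.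

End Triple.

(** * The weights of the category *)

Section Theta.
Implicit Type mu : seq nat.

(** Both sides say that the cell in row i + 1 and column a belongs to the Young diagram. *)
Lemma count_leq_sorted mu a i : sorted geq mu -> (0 < a)%N ->
  (i < conj_part mu a)%N = (a <= nth 0 mu i)%N.
Proof.
rewrite /conj_part => + a0; elim: mu i => [|x mu IHmu] i; first by rewrite nth_nil leqn0; case: (a) a0.
rewrite /= (path_sortedE (rev_trans leq_trans)) => /andP[/allP xmu smu].
have [ax|xa] := leqP a x.
  by case: i => [|i] //=; rewrite add1n ltnS IHmu.
have small j : (nth 0 mu j <= x)%N.
  by have [lt|ge] := ltnP j (size mu); [apply: xmu; rewrite mem_nth | rewrite nth_default].
have -> : count (leq a) mu = 0%N.
  apply/eqP; rewrite -leqn0 leqNgt -has_count; apply/hasPn => y /xmu /= yx.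
  by rewrite -ltnNge; exact: leq_ltn_trans xa.
case: i => [|i] /=; rewrite ?add0n ltn0; symmetry; apply/negbTE; rewrite -ltnNge //.
exact: leq_ltn_trans (small i) xa.
Qed.

Lemma conj_part_anti mu i j : (i <= j)%N -> (conj_part mu j <= conj_part mu i)%N.
Proof. by move=> ij; apply: sub_count => x /=; exact: leq_trans. Qed.

Lemma conj_seq_sorted mu : sorted geq (conj_seq mu).
Proof.
rewrite /conj_seq sorted_map; apply: sub_sorted (iota_sorted _ _) => i j.
exact: conj_part_anti.
Qed.

Lemma theta_odd mu i : theta mu i.*2.+1 = (conj_part mu i.+1 - i)%N.
Proof. by rewrite /theta /= odd_double /= doubleK subSS. Qed.

Lemma theta_even mu i : theta mu i.*2.+2 = (nth 0 mu i - i.+1)%N.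
Proof. by rewrite /theta /= odd_double /= doubleK. Qed.

Lemma theta_ind (P : nat -> Prop) : (forall i, P i.*2.+1) -> (forall i, P i.*2.+2) ->
  forall n, (0 < n)%N -> P n.
Proof.
move=> h1 h2 [|n] // _; rewrite -(odd_double_half n).
by case: (odd n); [exact: h2 | exact: h1].
Qed.

(** The coordinates count, in turn, the cells weakly below a diagonal cell and those strictly to its
    right. If one count is 0, the cell at which the next count would start is missing as well. *)
Lemma theta_eq0S mu n : sorted geq mu -> (0 < n)%N -> theta mu n = 0%N -> theta mu n.+1 = 0%N.
Proof.
move=> smu; move: n; apply: theta_ind => i; rewrite ?theta_odd theta_even.
  move=> h; have := @count_leq_sorted mu i.+1 i smu isT; move: h; lia.
rewrite -doubleS theta_odd => h.
by have := @count_leq_sorted mu i.+2 i smu isT; move: h; lia.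
Qed.

(** Two steps on, the diagonal has moved by one cell while rows and columns have not become
    longer. *)
Lemma theta_strict mu n : sorted geq mu -> (0 < n)%N ->
  theta mu n = 0%N \/ (theta mu n.+2 < theta mu n)%N.
Proof.
move=> smu; move: n; apply: theta_ind => i.
  rewrite -doubleS !theta_odd.
  by have := @conj_part_anti mu i.+1 i.+2 (leqnSn _); lia.
rewrite -doubleS !theta_even.
have : (nth 0 mu i.+1 <= nth 0 mu i)%N.
  have [lt|ge] := ltnP i.+1 (size mu); last by rewrite nth_default.
  by apply: (sorted_ltn_nth (leT := geq) (rev_trans leq_trans) 0%N smu); rewrite ?inE //; exact: ltnW.
lia.
Qed.

Lemma theta_bounded mu n : ((size mu).*2 < n)%N -> theta mu n = 0%N.
Proof.
move=> h; have n0 : (0 < n)%N by exact: leq_trans h.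
move: n n0 h; apply: theta_ind => i h; rewrite ?theta_odd ?theta_even.
  have : (conj_part mu i.+1 <= size mu)%N by exact: count_size.
  by move: h; lia.
by rewrite nth_default //; move: h; lia.
Qed.
End Theta.

Section TildeWeights.
Variables (F : numFieldType) (k : nat) (Y0 : {set 'I_k.-1}) (l : dominant F Y0).

Definition wt_int (m : int) : int :=
  if m <= 0 then - (theta (conj_seq (dw_m l)) (absz (1 - m)))%:Z
  else (theta (dw_p l) (absz m))%:Z.

Lemma wt_intE m : w_eps (wt_tilde l) (inr m) = (wt_int m)%:~R.
Proof. by rewrite /= /wt_int; case: ifP => _ //; rewrite mulrNz. Qed.

(** The 1 comes from the strict decrease of theta. This fails only where theta has reached 0, and
    there the odd root pairs to 0 too, so the second clause applies. On the non-positive side the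
    numbering of theta runs backwards and the values are negated. *)
Lemma wt_int_dominant (m : int) : (m <= 0) = (m + 2 <= 0) ->
  (wt_int m + wt_int (m + 1) != 0 -> 0 <= wt_int m - 1 - wt_int (m + 2)) /\
  (wt_int m + wt_int (m + 1) = 0 -> 0 <= wt_int m - wt_int (m + 2)).
Proof.
move=> side; rewrite /wt_int -side.
have -> : (m + 1 <= 0) = (m <= 0) by apply/idP/idP; move: side; lia.
case: ifP side => [m0 side|m0 _].
  have [n hn] : exists n : nat, m = - (n.+2)%:Z by exists (absz (m + 2)); lia.
  have -> : absz (1 - m)%R = n.+3 by lia.
  have -> : absz (1 - (m + 1))%R = n.+2 by lia.
  have -> : absz (1 - (m + 2))%R = n.+1 by lia.
  have sm := conj_seq_sorted (dw_m l).
  have := @theta_eq0S _ n.+1 sm isT; have := @theta_eq0S _ n.+2 sm isT.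
  by have := @theta_strict _ n.+1 sm isT; lia.
have [n hn] : exists n : nat, m = (n.+1)%:Z by exists (absz (m - 1)); lia.
have -> : absz m = n.+1 by lia.
have -> : absz (m + 1)%R = n.+2 by lia.
have -> : absz (m + 2)%R = n.+3 by lia.
have sm : sorted geq (dw_p l) by have /andP[] := dw_pP l.
have := @theta_eq0S _ n.+1 sm isT; have := @theta_eq0S _ n.+2 sm isT.
by have := @theta_strict _ n.+1 sm isT; lia.
Qed.

Lemma wt_int_bounded : exists B : nat, forall m : int, (B < absz m)%N -> wt_int m = 0.
Proof.
exists ((size (conj_seq (dw_m l))).*2 + (size (dw_p l)).*2)%N => m hm.
by rewrite /wt_int; case: ifP => m0; rewrite theta_bounded //; lia.
Qed.

Lemma wt_int_sign m : if m <= 0 then wt_int m <= 0 else 0 <= wt_int m.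
Proof. by rewrite /wt_int; case: (m <= 0); lia. Qed.

End TildeWeights.

(** * Coordinate bounds from the highest weights *)

Section Cone.
Variables (F : numFieldType) (k : nat) (Y0 : {set 'I_k.-1}).
Local Notation idx := (idx k).
Local Notation wt := (option idx -> F).

(** A weakening of the weight bound of the category: increasing pairs replace adjacent ones, and the
    value at K is dropped. *)
Definition in_cone (g : wt) := exists (l : dominant F Y0) (c : seq (idx * idx)),
  (forall x, x \in c -> ltI x.1 x.2) /\
  forall r, g (Some r) = w_eps (wt_tilde l) r - (\sum_(x <- c) eroot x.1 x.2 r)%:~R.

Lemma cone_int g : in_cone g -> exists G : int -> int, forall m, g (Some (inr m)) = (G m)%:~R.
Proof.
move=> [l [c [_ h]]].
exists (fun m => wt_int l m - \sum_(x <- c) eroot x.1 x.2 (inr m)) => m.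
by rewrite h wt_intE rmorphB.
Qed.

Lemma seq_bound (s : seq idx) : exists B : nat, forall m : int, (B < `|m|)%N -> (inr m : idx) \notin s.
Proof.
elim: s => [|[i|n] s [B hB]]; first by exists 0%N.
  by exists B => m /hB; rewrite inE.
exists (B + `|n|)%N => m hm; rewrite inE negb_or hB ?andbT; last by move: hm; lia.
by apply/eqP => -[e]; move: hm; rewrite e; lia.
Qed.

Lemma cone_bounded g : in_cone g -> exists B : nat, forall m : int, (B < `|m|)%N ->
  g (Some (inr m)) = 0.
Proof.
move=> [l [c [_ h]]]; have [B1 h1] := wt_int_bounded l.
have [B2 h2] := seq_bound (flatten [seq [:: x.1; x.2] | x <- c]).
exists (B1 + B2)%N => m hm; rewrite h wt_intE h1 ?sub0r; last by move: hm; lia.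
rewrite big1_seq ?oppr0 // => x /andP[_ xc].
have : (inr m : idx) \notin flatten [seq [:: x.1; x.2] | x <- c] by apply: h2; move: hm; lia.
move=> hn; rewrite /eroot.
have -> : (inr m == x.1) = false.
  apply/negbTE; apply: contra hn => /eqP ->; apply/flattenP.
  by exists [:: x.1; x.2]; rewrite ?inE ?eqxx //; apply/mapP; exists x.
have -> : (inr m == x.2) = false.
  apply/negbTE; apply: contra hn => /eqP ->; apply/flattenP.
  by exists [:: x.1; x.2]; rewrite ?inE ?eqxx ?orbT //; apply/mapP; exists x.
by rewrite subrr.
Qed.

(** When g vanishes on T away from m, its coordinate at m is its total over T, and totals are easy
    to follow when roots are subtracted. *)
Lemma cone_sum g (T : pred idx) m : in_cone g -> T (inr m) ->
  (forall r, T r -> r != inr m -> g (Some r) = 0) ->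
  exists (l : dominant F Y0) (D : seq idx) (c : seq (idx * idx)),
    (forall x, x \in c -> ltI x.1 x.2) /\ forall M : int, g (Some (inr m)) = M%:~R ->
    (forall r, T r -> exists n, r = inr n) ->
    M = \sum_(r <- D | T r) (if r is inr n then wt_int l n else 0)
        - \sum_(x <- c) ((T x.1)%:R - (T x.2)%:R).
Proof.
move=> [l [c [hc h]]] Tm g0.
pose D := undup (inr m :: flatten [seq [:: x.1; x.2] | x <- c]).
exists l, D, c; split=> // M hM Tr; apply: (@intr_inj F); rewrite -hM.
have uD : uniq D := undup_uniq _.
have Dm : (inr m : idx) \in D by rewrite mem_undup mem_head.
have -> : g (Some (inr m)) = \sum_(r <- D | T r) g (Some r).
  rewrite big_mkcond (bigD1_seq (inr m : idx)) //= Tm big1 ?addr0 // => r ne.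
  by case: ifP => // Tr'; exact: g0.
rewrite (eq_bigr (fun r => w_eps (wt_tilde l) r - (\sum_(x <- c) eroot x.1 x.2 r)%:~R)) => [|r _];
  last exact: h.
rewrite sumrB rmorphB /= -!rmorph_sum /= exchange_big /=; congr (_ - _%:~R).
  rewrite rmorph_sum /=; apply: eq_bigr => r /Tr [n ->]; exact: wt_intE.
rewrite big_seq [RHS]big_seq; apply: eq_bigr => x xc.
rewrite sum_eroot // mem_undup !inE; apply/orP; right; apply/flattenP;
  by exists [:: x.1; x.2]; rewrite ?inE ?eqxx ?orbT //; apply/mapP; exists x.
Qed.

(** T is a final segment of the order inside the positive half-integers. Each subtracted root has
    total at most 0 on it, and the highest weight is non-negative there. *)
Lemma cone_tail_pos g (m M : int) : in_cone g -> 0 < m ->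
  (forall n, m < n -> g (Some (inr n)) = 0) -> g (Some (inr m)) = M%:~R -> 0 <= M.
Proof.
move=> hg m0 hz hM.
pose T (r : idx) := if r is inr n then m <= n else false.
have [||l [D [c [hc h]]]] := @cone_sum g T m hg.
- exact: lexx.
- case=> [//|n] /= mn ne; apply: hz; rewrite lt_neqAle mn andbT.
  by apply: contra ne => /eqP ->.
rewrite (h M hM); last by case=> [//|n] _; exists n.
rewrite subr_ge0; apply: (@le_trans _ _ 0).
  rewrite big_seq; apply: sumr_le0 => x /hc; rewrite subr_le0 ler_nat.
  have : ltI x.1 x.2 -> T x.1 -> T x.2.
    case: (x.1) (x.2) => [i|n1] [j|n2] //=; first by move: m0; lia.
    by move=> h1 h2; exact: le_trans h2 (ltW h1).
  by case: (T x.1) => // h1 h2; rewrite h1.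
apply: sumr_ge0 => -[//|n] /= mn; have := wt_int_sign l n.
by rewrite leNgt (lt_le_trans m0 mn).
Qed.

Lemma cone_tail_neg g (m M : int) : in_cone g -> m <= 0 ->
  (forall n, n < m -> g (Some (inr n)) = 0) -> g (Some (inr m)) = M%:~R -> M <= 0.
Proof.
move=> hg m0 hz hM.
pose T (r : idx) := if r is inr n then n <= m else false.
have [||l [D [c [hc h]]]] := @cone_sum g T m hg.
- exact: lexx.
- case=> [//|n] /= mn ne; apply: hz; rewrite lt_neqAle mn andbT.
  by apply: contra ne => /eqP ->.
rewrite (h M hM); last by case=> [//|n] _; exists n.
rewrite subr_le0; apply: (@le_trans _ _ 0).
  apply: sumr_le0 => -[//|n] /= mn; have := wt_int_sign l n.
  by rewrite (le_trans mn m0).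
rewrite big_seq; apply: sumr_ge0 => x /hc; rewrite subr_ge0 ler_nat.
have : ltI x.1 x.2 -> T x.2 -> T x.1.
  case: (x.1) (x.2) => [i|n1] [j|n2] //=; first by move: m0; lia.
  by move=> h1 h2; exact: le_trans (ltW h1) h2.
by case: (T x.2) => // h1 h2; rewrite h1.
Qed.

End Cone.

(** * Signs of the weights of modules in the category *)

Definition sign_definite (F : fieldType) (k : nat) (g : option (idx k) -> F) : Prop :=
  forall m : int, exists n : nat, g (Some (inr m)) = if m <= 0 then - n%:R else n%:R.

(** * Reflections of weights in an irreducible summand *)

Section Reflection.
Variables (F : numFieldType) (k : nat) (Y0 : {set 'I_k.-1}).
Local Notation idx := (idx k).
Local Notation A := (ltilde F Y0).
Variables (V : smodule (sub_lie A)) (N : submod V).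
Local Notation lev := (leviS Y0 half_all).
Local Notation e := (eop V).
Local Notation wt := (option idx -> F).

(** Let w be the last nonzero vector of the E_qp-string of v, reached after i steps. There the
    weights at q and p differ by d + 2i, so [sl2_string] shows that w survives d + 2i applications
    of E_pq. The net shift is d + i; the exact reflection would be i = 0. *)
Lemma reflection (p q : idx) (v : V) (g : wt) (d : nat) :
  lev p q -> p != q -> mpar (p, q) = false ->
  (forall y, N y -> exists n, iter n (e q p) y = 0) ->
  N v -> v <> 0 -> eigen (dop V) g v -> g (Some q) - g (Some p) = d%:R ->
  exists i v' g', [/\ N v', v' <> 0, eigen (dop V) g' v' &
    forall t, g' (Some t) = g (Some t) + (d + i)%:R * ((t == p)%:R - (t == q)%:R)].
Proof.
move=> lpq npq mpq nil Nv v0 gv hd.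
have hpq : A (Ehat F p q) := ltilde_E lpq.
have hqp : A (Ehat F q p) := ltilde_E (leviS_sym lpq).
have mqp : mpar (q, p) = false by move: mpq; rewrite /mpar /= addbC.
have iterN a b j w : N w -> N (iter j (e a b) w).
  by move=> Nw; elim: j => //= j; exact: sm_act.
have hex : exists n, iter n.+1 (e q p) v == 0.
  have [[|n] hn] := nil v Nv; first by case: v0.
  by exists n; rewrite hn eqxx.
case: (ex_minnP hex) => i /eqP hi imin.
pose w := iter i (e q p) v.
have w0 : w <> 0.
  case: (i) imin @w => [|i'] imin //= h; have := imin i'.
  by rewrite iterS h eqxx ltnn => /(_ isT).
have ew := eigen_iter (@ltilde_diag F k Y0) i hqp gv.
set gw := iter i _ g in ew.
have nqp : q != p by rewrite eq_sym.
have hgw : gw (Some q) - gw (Some p) = (d + i.*2)%:R.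
  rewrite /gw !iter_wshift !eqxx (negbTE npq) (negbTE nqp) /= subr0 sub0r mulr1 mulrN1.
  by rewrite natrD -addnn natrD -hd; ring.
have hw0 : e q p w = 0 by exact: hi.
have nz j : (j <= d + i.*2)%N -> iter j (e p q) w <> 0.
  elim: j => [//|j IHj] hj h.
  have := @sl2_string F k A V (@ltilde_diag F k Y0) gw q p w j hqp hpq nqp mqp
    (esym (lev_npos lpq)) ew hw0.
  rewrite h (linE0 (eop_lin V q p)) hgw => /esym/eqP.
  rewrite scaler_eq0 -natrB ?(ltnW hj) // mulf_eq0 !pnatr_eq0 subn_eq0 leqNgt hj /=.
  by move=> /eqP; apply: IHj; exact: ltnW.
exists i, (iter (d + i.*2) (e p q) w), (iter (d + i.*2) (fun g => wshift g p q) gw); split.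
- by apply: (iterN); exact: iterN.
- exact: nz.
- by apply: eigen_iter ew => //; exact: ltilde_diag.
move=> t; rewrite iter_wshift /gw iter_wshift !natrD -addnn natrD; ring.
Qed.

Variable (l : dominant F Y0).
Hypothesis irrN : irr_hw N (wt_tilde l).
Hypothesis coneN : forall v g, N v -> v <> 0 -> eigen (dop V) g v -> in_cone Y0 g.

(** The integer y is the overshoot of the weak reflection. *)
Lemma half_step (m : int) : (m <= 0) = (m + 2 <= 0) ->
  forall v g (x : int), N v -> v <> 0 -> eigen (dop V) g v ->
  g (Some (inr (m + 2))) - g (Some (inr m)) = x%:~R -> 0 <= x ->
  exists v' g' (y : int), [/\ N v', v' <> 0, eigen (dop V) g' v', 0 <= y &
    [/\ g' (Some (inr m)) = g (Some (inr m)) + (x + y)%:~R,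
     g' (Some (inr (m + 2))) = g (Some (inr (m + 2))) - (x + y)%:~R &
     forall n : int, n != m -> n != m + 2 -> g' (Some (inr n)) = g (Some (inr n))]].
Proof.
move=> side v g x Nv v0 gv hx x0.
have [n hn] : exists n : nat, x = n%:Z by exists (absz x); lia.
have [hw irr] := irrN.
have hw' : exists v, [/\ N v, v <> 0, eigen (dop V) (wfun (wt_tilde l)) v &
    forall a b, lev a b -> ltI a b -> e a b v = 0].
  have [u [Nu u0 gu su]] := hw; exists u; split=> //.
    by apply/(wspace_eigen _ _ (@ltilde_diag F k Y0)).
  move=> a b lab h; apply: (su _ a b) h; rewrite aval_toA //; exact: ltilde_E.
have [d1 d0] := wt_int_dominant l side.
have toint (y : int) : 0 <= y -> exists c : nat, y%:~R = c%:R :> F.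
  by case: y => // c _; exists c.
pose p : idx := inr m; pose q : idx := inr (m + 2).
have lpq : lev p q by apply/leviE.
have npq : p != q by apply/eqP => -[] h; move: h; clear; lia.
have mpq : mpar (p, q) = false.
  by rewrite /mpar /= (_ : m + 2 = m + 1 + 1) ?oddzS ?negbK ?addbb // -addrA.
have nil : forall y, N y -> exists c, iter c (e q p) y = 0.
  have lamE y : wfun (wt_tilde l) (Some (inr y)) = (wt_int l y)%:~R := wt_intE l y.
  apply: (locally_nilpotent irr side hw'); rewrite !lamE -rmorphD /= => /eqP;
    rewrite intr_eq0.
    by move=> /d1 /toint[c hc]; exists c; rewrite -hc !rmorphB.
  by move=> /eqP/d0 /toint[c hc]; exists c; rewrite -hc rmorphB.
have hx' : g (Some q) - g (Some p) = n%:R by rewrite hx hn.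
have [i [v' [g' [Nv' v'0 gv' hg]]]] := reflection lpq npq mpq nil Nv v0 gv hx'.
have nqp : q != p by rewrite eq_sym.
exists v', g', i%:Z; split=> //; rewrite hn; split.
- by rewrite hg eqxx (negbTE npq) subr0 mulr1.
- by rewrite hg eqxx (negbTE nqp) sub0r mulrN1.
move=> n' n1 n2; rewrite hg.
have -> : (inr n' == p) = false by apply/negbTE; apply: contra n1 => /eqP[->].
have -> : (inr n' == q) = false by apply/negbTE; apply: contra n2 => /eqP[->].
by rewrite subr0 mulr0 addr0.
Qed.

(** d bounds the distance from m to B, beyond which the coordinates vanish. Either the coordinate at
    m + 2 is already negative, or a reflection carries a negative value there; once m reaches B,
    [cone_tail_pos] gives the contradiction. *)
Lemma no_negative (d : nat) v g (m B x : int) : N v -> v <> 0 -> eigen (dop V) g v ->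
  0 < m -> B - m <= d%:Z -> (forall n, B < n -> g (Some (inr n)) = 0) ->
  g (Some (inr m)) = x%:~R -> x < 0 -> False.
Proof.
elim: d v g m B x => [|d IHd] v g m B x Nv v0 gv m0 hd hB gm x0; have cg := coneN Nv v0 gv.
  have : 0 <= x by apply: cone_tail_pos cg m0 _ gm => n mn; apply: hB; move: hd mn; clear; lia.
  by rewrite leNgt x0.
have [Bm|mB] := leP B m.
  have : 0 <= x by apply: cone_tail_pos cg m0 _ gm => n mn; apply: hB; exact: le_lt_trans mn.
  by rewrite leNgt x0.
have [G hG] := cone_int cg.
have side : (m <= 0) = (m + 2 <= 0) by move: m0; clear; lia.
(* If B = m + 1, the reflection makes the coordinate m + 2, beyond B, nonzero; hence the maximum. *)
have hd2 : Num.max B (m + 2) - (m + 2) <= d%:Z by move: hd mB; clear; lia.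
have m2 : 0 < m + 2 by move: m0; clear; lia.
have [neg|pos] := ltP (G (m + 2)) 0.
  apply: (IHd v g (m + 2) (Num.max B (m + 2)) (G (m + 2))) => // n.
  by rewrite gt_max => /andP[/hB].
have xy : 0 <= G (m + 2) - x by move: pos x0; clear; lia.
have hxy : g (Some (inr (m + 2))) - g (Some (inr m)) = (G (m + 2) - x)%:~R.
  by rewrite gm hG rmorphB.
have [v' [g' [y [Nv' v'0 gv' y0 [_ h2 h3]]]]] := half_step side Nv v0 gv hxy xy.
apply: (IHd v' g' (m + 2) (Num.max B (m + 2)) (x - y)) => //.
- move=> n; rewrite gt_max => /andP[Bn mn]; rewrite h3 ?hB //;
    by move: mn; clear; lia.
- by rewrite h2 hG -rmorphB /=; congr (_%:~R); ring.
by move: x0 y0; clear; lia.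
Qed.

(** The mirror image of [no_negative]: a positive value at m is carried to m - 2 and on towards
    B. *)
Lemma no_positive (d : nat) v g (m B x : int) : N v -> v <> 0 -> eigen (dop V) g v ->
  m <= 0 -> m - B <= d%:Z -> (forall n, n < B -> g (Some (inr n)) = 0) ->
  g (Some (inr m)) = x%:~R -> 0 < x -> False.
Proof.
elim: d v g m B x => [|d IHd] v g m B x Nv v0 gv m0 hd hB gm x0; have cg := coneN Nv v0 gv.
  have : x <= 0 by apply: cone_tail_neg cg m0 _ gm => n mn; apply: hB; move: hd mn; clear; lia.
  by rewrite leNgt x0.
have [Bm|mB] := leP m B.
  have : x <= 0 by apply: cone_tail_neg cg m0 _ gm => n mn; apply: hB; exact: lt_le_trans Bm.
  by rewrite leNgt x0.
have [G hG] := cone_int cg.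
have [p hp] : exists p : int, m = p + 2 by exists (m - 2); rewrite subrK.
subst m.
have side : (p <= 0) = (p + 2 <= 0) by move: m0; clear; lia.
have hd2 : p - Num.min B p <= d%:Z by move: hd mB; clear; lia.
have p0 : p <= 0 by rewrite side.
have [pos|neg] := ltP 0 (G p).
  apply: (IHd v g p (Num.min B p) (G p)) => // n.
  by rewrite lt_min => /andP[/hB].
have xy : 0 <= x - G p by move: neg x0; clear; lia.
have hxy : g (Some (inr (p + 2))) - g (Some (inr p)) = (x - G p)%:~R.
  by rewrite gm hG rmorphB.
have [v' [g' [y [Nv' v'0 gv' y0 [h1 _ h3]]]]] := half_step side Nv v0 gv hxy xy.
apply: (IHd v' g' p (Num.min B p) (x + y)) => //.
- move=> n; rewrite lt_min => /andP[Bn mn]; rewrite h3 ?hB //;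
    by move: mn; clear; lia.
- by rewrite h1 hG -rmorphD /=; congr (_%:~R); ring.
by move: x0 y0; clear; lia.
Qed.

Lemma weight_sign_definite v g : N v -> v <> 0 -> eigen (dop V) g v -> sign_definite g.
Proof.
move=> Nv v0 gv m; have cg := coneN Nv v0 gv.
have [G hG] := cone_int cg; have [B hB] := cone_bounded cg.
rewrite hG; case: (leP m 0) => m0.
  exists (absz (G m)); have [G0|G0] := leP (G m) 0.
    by rewrite -[in LHS](_ : - (absz (G m))%:Z = G m) ?rmorphN //; move: G0; clear; lia.
  have [d hd] : exists d : nat, m - - B%:Z <= d%:Z by exists (absz (m + B%:Z)); clear; lia.
  case: (@no_positive d v g m (- B%:Z) (G m)) => // n hn; apply: hB.
  by move: hn; clear; lia.
exists (absz (G m)); have [G0|G0] := ltP (G m) 0; last first.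
  by rewrite -[in LHS](_ : (absz (G m))%:Z = G m) //; move: G0; clear; lia.
have [d hd] : exists d : nat, B%:Z - m <= d%:Z by exists (absz (B%:Z - m)%R); clear; lia.
case: (@no_negative d v g m B%:Z (G m)) => // n hn; apply: hB.
by move: hn; clear; lia.
Qed.
End Reflection.

Section Category.
Variables (F : numFieldType) (k : nat) (Y0 : {set 'I_k.-1}) (a : F).
Variables (M : smodule (sub_lie (gtilde F k))).
Hypothesis hM : catO Y0 a M.

Lemma gtilde_E (r s : idx k) : gtilde F k (Ehat F r s).
Proof. by apply: lspan_sub; right; exists r, s; split=> //; split; [case: r | case: s]. Qed.

Lemma gtilde_diag : diagonal (gtilde F k).
Proof. by case=> [r|]; [exact: gtilde_E | apply: lspan_sub; left]. Qed.

(** Each irreducible summand is stable under the diagonal operators, so it is spanned by weight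
    vectors of its own, and the sign result applies to these. *)
Lemma catO_span v : lspan (fun u => exists2 g, sign_definite g & eigen (dop M) g u) v.
Proof.
have [_ [hspan _] [J [N [mu [[hsum _] hirr]]]] [n [lam hlam]]] := hM.
pose L := res (incl (@l_gtilde_le F k Y0)) M.
have dopE j u : dop L j u = dop M j u.
  rewrite /dop -[act _ u]/(act (incl (@l_gtilde_le F k Y0) (toA (ltilde F Y0) (Dhat F j))) (u : M)).
  by rewrite (toA_incl _ (@ltilde_diag F k Y0 j)).
have eE g (u : M) : eigen (dop L) g u <-> eigen (dop M) g u.
  by split=> h j; [rewrite -dopE | rewrite dopE]; exact: h.
move: v (hsum v); apply: lspan_min => u [i Niu].
have cone v g : N i v -> v <> 0 -> eigen (dop L) g v -> in_cone Y0 g.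
  move=> Nv v0 /eE gv.
  have hw : wspace (wgt g) (v : M) by apply/(wspace_eigen _ _ gtilde_diag); rewrite wgtK.
  have [i0 [c [hc h1 _]]] := hlam _ _ v0 hw.
  by exists (lam i0), c; split=> // x /hc[].
have hu : lspan (eigenvector (dop L)) u.
  move: u {Niu} (hspan u); apply: lspan_mono => u [g hg]; apply: lspan_sub.
  by exists (wfun g); apply/eE; apply/(wspace_eigen _ _ gtilde_diag).
have st : Dstable (dop L) (N i : submod L) by move=> j w; exact: sm_act.
have := lspan_eigen_stable (dop_lin L) st hu Niu.
apply: lspan_mono => w [Niw [g hg]].
have [->|w0] := pselect (w = 0); first exact: sp0.
apply: lspan_sub; exists g; last exact/eE.
exact: (weight_sign_definite (hirr i) cone Niw w0 hg).
Qed.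
End Category.

(** * Truncation of homology *)

Lemma tens_span (F : fieldType) (A B : lmodType F) (W : subspace (tens A B)) :
  (forall u v, W (pure u v)) -> forall t, W t.
Proof.
move=> h t; apply/(qpi0 W).
apply: (@tens_ext _ _ _ _ (qpi W) (fun=> 0)) => [||u v].
- exact: qpi_lin.
- exact: linear_zero.
by apply/(qpi0 W); exact: h.
Qed.

Section Truncation.
Variables (F : numFieldType) (k : nat) (Y0 : {set 'I_k.-1}) (Z : pred int).
Local Notation idx := (idx k).
Local Notation gl_hat := (gl_hat F k).
Local Notation wt := (option idx -> F).
Local Notation G := (gtilde F k).
Variable M : smodule (sub_lie G).
Local Notation X := (inX (k := k) Z).
Local Notation P1 := (p_alg F Y0 half_all).
Local Notation P2 := (p_alg F Y0 Z).
Local Notation Lt := (ltilde F Y0).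
Local Notation Lz := (l_alg F Y0 Z).
Local Notation Ut := (u_alg F Y0 half_all).
Local Notation Uz := (u_alg F Y0 Z).
Local Notation uSt := (uS Y0 half_all).
Local Notation E := (Ehat F).

Definition It : submod (adj (sub_lie P1)) := ideal_of (@u_ideal F k Y0 half_all).
Definition Iz : submod (adj (sub_lie P2)) := ideal_of (@u_ideal F k Y0 Z).
Definition Vt : smodule (sub_lie P1) := res (incl (@p_g_le F k Y0 half_all)) M.
Definition Vz : smodule (sub_lie P2) := res (incl (@p_g_le F k Y0 Z)) (T_g Z M).

Lemma gtilde_all x : G x.
Proof.
have hE r s : G (E r s) by exact: gtilde_E.
have hK : G (Khat F k) by apply: lspan_sub; left.
have -> : x = ((x.1, 0) : gl_hat) + x.2 *: Khat F k.
  case: x => x c; apply/pair_equal_spec; split; first by rewrite /= scaler0 addr0.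
  by rewrite /= add0r; exact: (esym (mulr1 _)).
apply: spD; last exact: spZ.
apply/(qpi0 G); apply: (@mat_ext F k _ (fun y => qpi G ((y, 0) : gl_hat)) (fun=> 0)) => [||r s].
- move=> a u v; rewrite -qpi_lin; congr qpi; apply/pair_equal_spec; split=> //=.
  by rewrite scaler0 addr0.
- exact: linear_zero.
by apply/(qpi0 G); exact: hE.
Qed.

(** As [gtilde] is all of [gl_hat], one action serves the elements of both parabolics. *)
Definition gact (x : gl_hat) (v : M) : M := act (toA G x) v.

Lemma gact_linl v : linear (gact^~ v).
Proof. by move=> a x y; rewrite /gact toAP ?act_linl //; exact: gtilde_all. Qed.
Lemma gact_linr x : linear (gact x).
Proof. exact: act_linr. Qed.

Lemma act_Vt z (v : Vt) : act z v = gact (aval z) v :> M.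
Proof.
rewrite /gact; congr act; apply: aval_inj.
by rewrite aval_toA //; exact: gtilde_all.
Qed.

Definition tval (v : Vz) : M := subsp_val (v : subsp (trunc_sp Z M)).

Lemma tval_inj : injective tval.
Proof. by move=> u v h; exact: subsp_inj. Qed.

Lemma tval_trunc v : trunc_sp Z M (tval v).
Proof. exact: (subsp_in (v : subsp (trunc_sp Z M))). Qed.

Lemma act_Vz z (v : Vz) : tval (act z v) = gact (aval z) (tval v).
Proof.
rewrite /gact -[LHS]/(act (incl (@g_gtilde_le F k Z) (incl (@p_g_le F k Y0 Z) z)) (tval v)).
by congr act; apply: aval_inj; rewrite aval_toA //; exact: gtilde_all.
Qed.

Definition utval (y : sub_mod It) : gl_hat := aval (uval y).
Definition uzval (y : sub_mod Iz) : gl_hat := aval (uval y).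

Lemma utval_inj : injective utval.
Proof. by move=> x y h; apply: subsp_inj; apply: subsp_inj. Qed.
Lemma uzval_inj : injective uzval.
Proof. by move=> x y h; apply: subsp_inj; apply: subsp_inj. Qed.
Lemma utval_lin : linear utval. Proof. by []. Qed.
Lemma utval_in y : Ut (utval y).
Proof. exact: (subsp_in (y : subsp It)). Qed.
Lemma uzval_in y : Uz (uzval y).
Proof. exact: (subsp_in (y : subsp Iz)). Qed.
Lemma utval_act z y : utval (act z y) = br (aval z) (utval y).
Proof. by []. Qed.
Lemma uzval_act z y : uzval (act z y) = br (aval z) (uzval y).
Proof. by []. Qed.
Lemma utval_pc b y : utval (pc b y) = pc b (utval y). Proof. by []. Qed.
Lemma u_p_le Z' : sub_le (u_alg F Y0 Z') (p_alg F Y0 Z').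
Proof. by apply: span_alg_le => // r s; right. Qed.

Lemma uSE r s : uS Y0 Z r s <-> [/\ X r, X s & uSt r s].
Proof.
have hX t : inX half_all (t : idx) by case: t.
split=> [[Xr Xs sr n]|[Xr Xs [_ _ sr n]]].
  by split=> //; split=> // /leviE[_ _ b]; apply: n; apply/leviE.
by split=> // /leviE[_ _ b]; apply: n; apply/leviE.
Qed.

Lemma Uz_Ut x : Uz x -> Ut x.
Proof. by apply: span_alg_le => // r s /uSE[]. Qed.

Lemma gproj_U x : Ut x -> Uz (gproj Z x).
Proof.
apply: (lspan_ind (@gproj_lin F k Z)) => {}x [[//]|[r [s [h ->]]]].
rewrite gproj_E; case: ifP => [/andP[Xr Xs]|_]; last exact: sp0.
by apply: lspan_sub; right; exists r, s; split=> //; apply/uSE.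
Qed.

Lemma gproj_Uz x : Uz x -> gproj Z x = x.
Proof.
apply: (eq_on_span (@gproj_lin F k Z) (linear_id (V := gl_hat))) => {}x.
by case=> [[//]|[r [s [/uSE[Xr Xs _] ->]]]]; rewrite gproj_E Xr Xs.
Qed.

Definition mk_ut x (h : Ut x) : sub_mod It :=
  @subsp_mk _ _ It (subsp_mk (u_p_le h)) h.
Definition mk_uz x (h : Uz x) : sub_mod Iz :=
  @subsp_mk _ _ Iz (subsp_mk (u_p_le h)) h.

Definition proj_u (y : sub_mod It) : sub_mod Iz := mk_uz (gproj_U (utval_in y)).
Definition incl_u (y : sub_mod Iz) : sub_mod It := mk_ut (Uz_Ut (uzval_in y)).

Lemma proj_uE y : uzval (proj_u y) = gproj Z (utval y). Proof. by []. Qed.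
Lemma incl_uE y : utval (incl_u y) = uzval y. Proof. by []. Qed.

Lemma proj_u_lin : linear proj_u.
Proof. move=> a x y; apply: uzval_inj; exact: (gproj_lin Z a (utval x) (utval y)). Qed.
Lemma incl_u_lin : linear incl_u.
Proof. move=> a x y; exact: utval_inj. Qed.
Lemma proj_u_pc b y : proj_u (pc b y) = pc b (proj_u y).
Proof. apply: uzval_inj; exact: (gproj_pc Z b (utval y)). Qed.
Lemma incl_u_pc b y : incl_u (pc b y) = pc b (incl_u y).
Proof. exact: utval_inj. Qed.
Lemma incl_uK : cancel incl_u proj_u.
Proof. by move=> y; apply: uzval_inj; exact: gproj_Uz (uzval_in y). Qed.

(* pV projects M onto the span of its weight spaces supported on Z. *)
Variable pV : M -> M.
Hypothesis pV_lin : linear pV.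
Definition supp (g : wt) : Prop := supported Z (wgt g).
Hypothesis pV_eigen : forall g v, eigen (dop M) g v -> pV v = if pselect (supp g) then v else 0.
Hypothesis M_span : forall v, lspan (fun u => exists2 g, sign_definite g & eigen (dop M) g u) v.

Lemma pV_trunc v : trunc_sp Z M (pV v).
Proof.
move: v (M_span v); apply: (lspan_ind pV_lin) => v [g _ hg].
rewrite (pV_eigen hg); case: pselect => sg; last exact: sp0.
by apply: lspan_sub; exists (wgt g) => //; apply/(wspace_eigen _ _ (@gtilde_diag F k)); rewrite wgtK.
Qed.

Lemma pV_id v : trunc_sp Z M v -> pV v = v.
Proof.
apply: (eq_on_span pV_lin (linear_id (V := M))) => {}v [g sg].
move=> /(wspace_eigen _ _ (@gtilde_diag F k)) hg; rewrite (pV_eigen hg).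
by case: pselect => // ns; case: ns => r /sg.
Qed.

Lemma pV_pc b v : pV (pc b v) = pc b (pV v).
Proof.
move: v (M_span v).
apply: (eq_on_span (linear_comp pV_lin (@pc_lin _ M b)) (linear_comp (@pc_lin _ M b) pV_lin)).
move=> v [g _ hg]; have hb : eigen (dop M) g (pc b v).
  move=> j; rewrite -(linEZ (@pc_lin _ M b)) -hg; apply: act_even.
  by rewrite aval_toA; [exact: Dhat_homog | exact: gtilde_diag].
rewrite (pV_eigen hg) (pV_eigen hb); case: (pselect (supp g)) => [//|sg].
by rewrite (linE0 (@pc_lin _ M b)).
Qed.

Definition proj_V (v : Vt) : Vz := @subsp_mk _ _ (trunc_sp Z M) (pV v) (pV_trunc v).
Definition incl_V (v : Vz) : Vt := tval v.

Lemma proj_VE v : tval (proj_V v) = pV v. Proof. by []. Qed.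
Lemma proj_V_lin : linear proj_V.
Proof. by move=> a u v; apply: tval_inj; exact: pV_lin. Qed.
Lemma incl_V_lin : linear incl_V.
Proof. by []. Qed.
Lemma proj_V_pc b v : proj_V (pc b v) = pc b (proj_V v).
Proof. by apply: tval_inj; exact: pV_pc. Qed.
Lemma incl_VK : cancel incl_V proj_V.
Proof. by move=> v; apply: tval_inj; rewrite proj_VE pV_id //; exact: tval_trunc. Qed.

(** For a root of u_-, r is not a non-positive half-integer and s is not a positive one, since
    either would put both indices into one Levi block. So the shift moves half-integer coordinates
    away from 0 and cannot cancel one outside X. *)
Lemma shift_supp g r s : sign_definite g -> uSt r s -> supp (wshift g r s) ->
  [/\ X r, X s & supp g].
Proof.
move=> gg [_ _ sr nl] hs.
have rs : (r == s) = false by apply/negbTE/eqP => e; have := ltI_irr r; rewrite {1}e sr.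
have Xr : X r.
  apply: contraT => nX; have := hs r nX; rewrite /= eqxx rs subr0.
  case: r sr nl rs nX {hs} => [//|m] sr nl rs nX.
  have [n ->] := gg m; case: leP => m0.
    case: nl; case: s sr rs => [i|p] /= sr rs; first by move: m0; rewrite leNgt sr.
    by apply/leviE; split=> //=; rewrite m0 (le_trans (ltW sr) m0).
  by move=> /eqP; rewrite natr1 pnatr_eq0.
have Xs : X s.
  apply: contraT => nX; have := hs s nX; rewrite /= eqxx eq_sym rs sub0r.
  case: s sr nl rs nX {hs} => [//|m] sr nl rs nX.
  have [n ->] := gg m; case: leP => m0.
    by move=> /eqP; rewrite -opprD oppr_eq0 natr1 pnatr_eq0.
  case: nl; case: r sr rs Xr => [i|p] /= sr rs Xr; first by move: m0; rewrite ltNge sr.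
  by apply/leviE; split=> //=; rewrite !leNgt m0 (lt_trans m0 sr).
split=> // t nX; have := hs t nX; rewrite /=.
have -> : (t == r) = false by apply/negbTE/eqP => e; rewrite e Xr in nX.
have -> : (t == s) = false by apply/negbTE/eqP => e; rewrite e Xs in nX.
by rewrite subr0 addr0.
Qed.

Lemma supp_shift g r s : X r -> X s -> supp (wshift g r s) <-> supp g.
Proof.
move=> Xr Xs; split=> h t nX; have := h t nX; rewrite /=.
- have -> : (t == r) = false by apply/negbTE/eqP => e; rewrite e Xr in nX.
  have -> : (t == s) = false by apply/negbTE/eqP => e; rewrite e Xs in nX.
  by rewrite subr0 addr0.
have -> : (t == r) = false by apply/negbTE/eqP => e; rewrite e Xr in nX.
have -> : (t == s) = false by apply/negbTE/eqP => e; rewrite e Xs in nX.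
by rewrite subr0 addr0.
Qed.

Definition compat (x x' : gl_hat) : Prop :=
  (forall y, Ut y -> gproj Z (br x y) = br x' (gproj Z y)) /\
  (forall v, pV (gact x v) = gact x' (pV v)).

Lemma compatP a x x' y y' : compat x x' -> compat y y' -> compat (a *: x + y) (a *: x' + y').
Proof.
move=> [h1 h2] [h3 h4]; split=> [z hz|v].
  by rewrite !br_linl gproj_lin h1 ?h3.
by rewrite !gact_linl pV_lin h2 h4.
Qed.

Lemma compat0 : compat 0 0.
Proof.
split=> [z hz|v]; first by rewrite !(linE0 (@br_linl _ gl_hat _)) (linE0 (@gproj_lin F k Z)).
by rewrite !(linE0 (gact_linl _)) (linE0 pV_lin).
Qed.

(** A half-integer s would share a Levi block with r or with t, so s lies in K, which is part of
    every index set. *)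
Lemma uS_middle r s t : uSt r s -> uSt s t -> X s.
Proof.
move=> [_ _ sr n1] [_ _ ts n2]; case: s sr n1 ts n2 => [//|m] sr n1 ts n2.
have [m0|m0] := leP m 0.
  case: n2; case: t ts => [i|p] /= ts; first by move: m0; rewrite leNgt ts.
  by apply/leviE; split=> //=; rewrite m0 (le_trans (ltW ts) m0).
case: n1; case: r sr => [i|p] /= sr; first by move: m0; rewrite ltNge sr.
by apply/leviE; split=> //=; rewrite !leNgt m0 (lt_trans m0 sr).
Qed.

Lemma gproj_br_span x x' :
  (forall t u, uSt t u -> gproj Z (br x (E t u)) = br x' (gproj Z (E t u))) ->
  forall y, Ut y -> gproj Z (br x y) = br x' (gproj Z y).
Proof.
move=> h; apply: (eq_on_span (linear_comp (@gproj_lin F k Z) (@br_linr _ gl_hat x))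
  (linear_comp (@br_linr _ gl_hat x') (@gproj_lin F k Z))) => y.
by case=> [[//]|[t [u [htu ->]]]]; exact: h.
Qed.

(** If both indices lie in X, the shift by E_rs leaves support unchanged. Otherwise the compression
    of E_rs is 0, and by [shift_supp] the shifted weight is never supported. *)
Lemma compat_E r s : (X r /\ X s) \/ uSt r s -> compat (E r s) (gproj Z (E r s)).
Proof.
move=> hrs; split.
  apply: gproj_br_span => t u htu; rewrite gproj_br //.
    by move=> /eqP e; case: hrs => [[_ ->] //|h]; rewrite -e in htu; exact: uS_middle h htu.
  by move=> /eqP e; case: hrs => [[-> _] //|h]; rewrite e in htu; exact: uS_middle htu h.
move=> v; move: v (M_span v).
apply: (eq_on_span (linear_comp pV_lin (gact_linr _)) (linear_comp (gact_linr _) pV_lin)).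
move=> v [g gg hg].
have hs := eigen_shift (@gtilde_diag F k) (@gtilde_E F k r s) hg.
rewrite (pV_eigen hg) (pV_eigen hs) gproj_E.
have a0 x : gact x 0 = 0 by exact: (linE0 (gact_linr _)).
have a0l w : gact 0 w = 0 by exact: (linE0 (gact_linl _)).
case: (boolP (X r && X s)) => [/andP[Xr Xs]|nX].
  have [h1 h2] := supp_shift g Xr Xs.
  case: (pselect (supp g)) => sg; case: (pselect (supp (wshift g r s))) => sg'.
  - by [].
  - by case: sg'; exact: h2.
  - by case: sg; exact: h1.
  - by rewrite a0.
rewrite a0l; case: (pselect (supp (wshift g r s))) => [h1|//]; case: hrs => [[Xr Xs]|h]; first by rewrite Xr Xs in nX.
by have [Xr Xs _] := shift_supp gg h h1; rewrite Xr Xs in nX.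
Qed.

Lemma compat_K : compat (Khat F k) (Khat F k).
Proof.
split=> [y _|v]; first by rewrite !br_Khatl (linE0 (@gproj_lin F k Z)).
move: v (M_span v).
apply: (eq_on_span (linear_comp pV_lin (gact_linr _)) (linear_comp (gact_linr _) pV_lin)).
move=> v [g gg hg]; rewrite -[gact _ v]/(dop M None v) hg (linEZ pV_lin) (pV_eigen hg).
case: (pselect (supp g)) => sg; first by rewrite -[RHS]/(dop M None v) hg.
by rewrite scaler0 (linE0 (gact_linr _)).
Qed.

(** E_rr measures the coordinate at r, which is 0 on everything that the projections keep. *)
Lemma compat_diag r : ~~ X r -> compat (E r r) 0.
Proof.
move=> nX; split.
  move=> y hy; rewrite (linE0 (@br_linl _ gl_hat _)); move: y hy.
  apply: (eq_on_span (linear_comp (@gproj_lin F k Z) (@br_linr _ gl_hat (E r r)))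
    (linear_zero (U := gl_hat) gl_hat)) => y [[//]|[t [u [_ ->]]]].
  rewrite br_diag (linEZ (@gproj_lin F k Z)) gproj_E.
  case: (eqVneq r t) => [<-|_]; first by rewrite (negbTE nX) scaler0.
  case: (eqVneq r u) => [<-|_]; first by rewrite (negbTE nX) andbF scaler0.
  by rewrite subrr scale0r.
move=> v; rewrite (linE0 (gact_linl _)); move: v (M_span v).
apply: (eq_on_span (linear_comp pV_lin (gact_linr _)) (linear_zero (U := M) M)).
move=> v [g gg hg]; rewrite -[gact _ v]/(dop M (Some r) v) hg (linEZ pV_lin) (pV_eigen hg).
case: (pselect (supp g)) => [sg|sg]; last by rewrite scaler0.
by have /= -> := sg r nX; rewrite scale0r.
Qed.

Lemma compat_U x : Ut x -> compat x (gproj Z x).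
Proof.
have w0 : compat 0 (gproj Z 0) by rewrite (linE0 (@gproj_lin F k Z)); exact: compat0.
have wP a x' y : compat x' (gproj Z x') -> compat y (gproj Z y) ->
    compat (a *: x' + y) (gproj Z (a *: x' + y)).
  by move=> h1 h2; rewrite gproj_lin; exact: compatP.
apply: (lspan_min (W := Subspace w0 wP)) => y [[//]|[r [s [h ->]]]].
by apply: compat_E; right.
Qed.

Lemma compat_L x : Lz x -> compat x x.
Proof.
have wP a u w : compat u u -> compat w w -> compat (a *: u + w) (a *: u + w).
  exact: compatP.
apply: (lspan_min (W := @Subspace F gl_hat (fun u => compat u u) compat0 wP)) => y.
case=> [[_ ->]|[r [s [[Xr Xs _] ->]]]]; first exact: compat_K.
by have := @compat_E r s (or_introl (conj Xr Xs)); rewrite gproj_E Xr Xs.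
Qed.

Lemma compat_intertwines (z1 : sub_lie P1) (z2 : sub_lie P2) :
  compat (aval z1) (aval z2) -> intertwines proj_u proj_V z1 z2.
Proof.
move=> [h1 h2]; split=> [y|v].
  by apply: uzval_inj; rewrite proj_uE utval_act uzval_act proj_uE h1 //; exact: utval_in.
by apply: tval_inj; rewrite act_Vz !proj_VE act_Vt.
Qed.

Lemma proj_intertwines b (x : sub_mod It) : homog b x ->
  intertwines proj_u proj_V (uval x) (uval (proj_u x)).
Proof. by move=> _; apply: compat_intertwines; apply: compat_U; exact: utval_in. Qed.

Lemma incl_intertwines b (x : sub_mod Iz) : homog b x ->
  intertwines incl_u incl_V (uval x) (uval (incl_u x)).
Proof.
move=> _; split=> [y|v]; first exact: utval_inj.
by rewrite act_Vt /incl_V act_Vz.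
Qed.

Lemma P1_diag : diagonal P1.
Proof. by move=> j; apply: l_p_le; exact: ltilde_diag. Qed.

Lemma wshift_sign_definite (g : wt) r s : sign_definite g -> uSt r s -> sign_definite (wshift g r s).
Proof.
move=> gg [_ _ sr nl] m; have [n hn] := gg m; rewrite /wshift hn.
have rs : (r == s) = false by apply/negbTE/eqP => e; have := ltI_irr r; rewrite {1}e sr.
case: (eqVneq (inr m : idx) r) => [e|_].
  rewrite -{1}e in rs; rewrite rs subr0; case: leP => m0; last by exists n.+1; rewrite natr1.
  case: nl; rewrite -e in sr *; case: s sr rs => [i|p] /= sr rs; first by move: m0; rewrite leNgt sr.
  by apply/leviE; split=> //=; rewrite m0 (le_trans (ltW sr) m0).
case: (eqVneq (inr m : idx) s) => [e|_]; last by exists n; rewrite subrr addr0.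
rewrite sub0r; case: leP => m0; first by exists n.+1; rewrite -opprD natr1.
case: nl; rewrite -e in sr *; case: r sr rs => [i|p] /= sr rs; first by move: m0; rewrite ltNge sr.
by apply/leviE; split=> //=; rewrite !leNgt m0 (lt_trans m0 sr).
Qed.

Lemma U_eigen (x : sub_mod It) r s i : utval x = E r s ->
  act (toA P1 (Dhat F i)) x = (wshift (fun=> 0) r s i) *: x.
Proof.
move=> hx; apply: utval_inj; rewrite utval_act (linEZ utval_lin) hx aval_toA; last exact: P1_diag.
case: i => [t|]; first by rewrite br_diag /wshift add0r.
by rewrite br_Khatl /wshift scale0r.
Qed.

Lemma tcons_eigen j (x : sub_mod It) r s (c : tpow It Vt j) g : utval x = E r s ->
  eigen (dop (tpow It Vt j)) g c ->
  eigen (dop (tpow It Vt j.+1)) (wshift g r s) (tcons x c).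
Proof.
move=> hx hc i.
have hD : homog false (toA P1 (Dhat F i)) by apply: toA_homog; exact: Dhat_homog.
have hxh : homog (mpar (r, s)) x.
  by apply: utval_inj; rewrite utval_pc hx; exact: Ehat_homog.
have hci : act (toA P1 (Dhat F i)) c = g i *: c := hc i.
have hw : wshift (fun=> 0) r s i + g i = wshift g r s i.
  by case: (i) => [t|]; rewrite /wshift ?add0r // addrC.
rewrite /dop (act_tcons _ hD hxh) ksignFl scale1r -hw scalerDl.
apply: (congr2 +%R).
  exact: etrans (congr1 (fun y => tcons y c) (U_eigen i hx))
    (linEZ (@tcons_linl _ _ It Vt j c) _ x).
exact: etrans (congr1 (tcons x) hci) (linEZ (@tcons_linr _ _ It Vt j x) _ c).
Qed.

Lemma U_span (W : subspace (sub_mod It)) :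
  (forall x r s, uSt r s -> utval x = E r s -> W x) -> forall x, W x.
Proof.
move=> h x; apply: (lspan_inj utval_lin utval_inj (G := span_gen uSt false)).
  move=> y [[//]|[r [s [hrs ->]]]].
  have hU : Ut (E r s) by apply: lspan_sub; right; exists r, s.
  by exists (mk_ut hU) => //; exact: h hrs _.
exact: utval_in.
Qed.

(** Sign-definiteness is carried through the induction because [shift_supp] requires it of the
    remaining factors. *)
Lemma tpow_span j (t : tpow It Vt j) :
  lspan (fun c => exists g, [/\ sign_definite g, eigen (dop (tpow It Vt j)) g c &
    supp g -> tmap incl_u incl_V (tmap proj_u proj_V c) = c]) t.
Proof.
elim: j t => [|j IHj] t.
  apply: (lspan_mono _ (M_span t)) => v [g gg hg]; apply: lspan_sub; exists g; split=> //.
    move=> i; rewrite /dop act_Vt aval_toA; last exact: P1_diag.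
    exact: hg.
  by move=> sg; apply: (etrans (pV_eigen hg)); case: (pselect (supp g)).
apply: tens_span => u v.
apply: (lspan_image2 (pure_linl (A := sub_mod It) (B := tpow It Vt j))
    (pure_linr (A := sub_mod It) (B := tpow It Vt j))
  (P := fun x => exists r s, uSt r s /\ utval x = E r s) _ _ (IHj v)).
  move=> x c [r [s [hrs hx]]] [g [gg gc hc]]; apply: lspan_sub; exists (wshift g r s); split.
  - exact: wshift_sign_definite.
  - exact: tcons_eigen.
  move=> /(shift_supp gg hrs)[Xr Xs sg].
  rewrite -[pure x c]/(tcons x c) (tmap_cons proj_u_lin proj_V_lin) (tmap_cons incl_u_lin incl_V_lin) hc //.
  by congr tcons; apply: utval_inj; rewrite incl_uE proj_uE hx gproj_E Xr Xs.
by apply: U_span => x r s hrs hx; apply: lspan_sub; exists r, s.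
Qed.

(** * Homology classes of supported weight *)

Local Notation Ht := (homology It Vt).
Local Notation Hz := (homology Iz Vz).
Local Notation cf := (cmap proj_u proj_V).
Local Notation cg := (cmap incl_u incl_V).

Lemma chains_span j (q : chains It Vt j) :
  lspan (fun c => exists g, eigen (dop (chains It Vt j)) g c /\ (supp g -> cg (cf c) = c)) q.
Proof.
rewrite -(qreprK q); apply: (lspan_image (@qpi_lin _ _ (skew It Vt j)) _ (tpow_span _)).
move=> c [g [gg gc hc]]; apply: lspan_sub; exists g; split.
  move=> i; rewrite -(linEZ (@qpi_lin _ _ (skew It Vt j))) -gc.
  exact: (@quo_actE _ _ _ (skew It Vt j)).
move=> sg; rewrite (cmap_qpi proj_u_lin proj_V_lin proj_u_pc) (cmap_qpi incl_u_lin incl_V_lin incl_u_pc) hc //.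
Qed.

Lemma chains_supp j (q : chains It Vt j) g : eigen (dop (chains It Vt j)) g q -> supp g ->
  cg (cf q) = q.
Proof.
move=> gq sg; have lD := dop_lin (chains It Vt j).
have lf := @cmap_lin _ _ _ _ _ _ _ _ _ proj_u_lin proj_V_lin proj_u_pc j.
have lg := @cmap_lin _ _ _ _ _ _ _ _ _ incl_u_lin incl_V_lin incl_u_pc j.
have hev (u : chains It Vt j) : (exists g, eigen (dop (chains It Vt j)) g u /\
    (supp g -> cg (cf u) = u)) -> eigenvector (dop (chains It Vt j)) u.
  by case=> g' [? _]; exists g'.
have := lspan_eigen lD hev (chains_span q) gq.
apply: (eq_on_span (linear_comp lg lf) (linear_id (V := chains It Vt j))) => u [[g' [gu hu]] gu'].
have [->|u0] := pselect (u = 0); first by rewrite (linE0 lf) (linE0 lg).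
by apply: hu; rewrite (eigen_inj gu gu' u0).
Qed.

Definition proj_homology j : Ht j -> Hz j :=
  @hmap _ _ _ _ _ _ _ _ _ proj_u_lin proj_V_lin proj_u_pc proj_intertwines j.
Definition incl_homology j : Hz j -> Ht j :=
  @hmap _ _ _ _ _ _ _ _ _ incl_u_lin incl_V_lin incl_u_pc incl_intertwines j.

Lemma proj_homology_lin j : linear (@proj_homology j). Proof. exact: hmap_lin. Qed.
Lemma incl_homology_lin j : linear (@incl_homology j). Proof. exact: hmap_lin. Qed.

Lemma incl_homologyK j : cancel (@incl_homology j) (@proj_homology j).
Proof.
move=> h; rewrite -(qreprK h) /incl_homology /proj_homology !hmap_qpi; congr qpi.
move: (qrepr h) => z; apply: subsp_inj; rewrite /=.
rewrite -[subsp_val z]/(subsp_val (z : subsp (cycles Iz Vz j))).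
move: (subsp_val _) => c; rewrite -(qreprK c).
rewrite (cmap_qpi incl_u_lin incl_V_lin incl_u_pc) (cmap_qpi proj_u_lin proj_V_lin proj_u_pc).
by rewrite (tmapK proj_u_lin proj_V_lin incl_u_lin incl_V_lin incl_uK incl_VK).
Qed.

(** The cycles form a subspace stable under the diagonal operators, so they are spanned by cycles
    that are weight vectors. *)
Lemma homology_span j (h : Ht j) : lspan (fun u => exists (z : sub_mod (cycles It Vt j)) g,
  eigen (dop (chains It Vt j)) g (subsp_val (z : subsp (cycles It Vt j))) /\
  u = qpi (boundaries It Vt j) z) h.
Proof.
rewrite -(qreprK h); move: (qrepr h) => {h} z.
pose B := fun z : sub_mod (cycles It Vt j) => exists g,
  eigen (dop (chains It Vt j)) g (subsp_val (z : subsp (cycles It Vt j))).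
have hz : lspan B z.
  pose sv (z : sub_mod (cycles It Vt j)) : chains It Vt j :=
    subsp_val (z : subsp (cycles It Vt j)).
  have lsv : linear sv by [].
  have isv : injective sv by move=> x y e; exact: subsp_inj.
  apply: (lspan_inj lsv isv (G := fun u => cycles It Vt j u /\
      eigenvector (dop (chains It Vt j)) u)).
    by move=> u [cu [g gu]]; exists (subsp_mk cu) => //; apply: lspan_sub; exists g.
  apply: (lspan_eigen_stable (dop_lin (chains It Vt j))).
  - by move=> i v; exact: sm_act.
  - apply: (lspan_mono _ (chains_span (sv z))) => c [g [gc _]].
    by apply: lspan_sub; exists g.
  exact: (subsp_in (z : subsp (cycles It Vt j))).
apply: (lspan_image (@qpi_lin _ _ (boundaries It Vt j)) _ hz) => y [g gy].
by apply: lspan_sub; exists y, g.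
Qed.

Lemma qpi_eigen j (z : sub_mod (cycles It Vt j)) g :
  eigen (dop (chains It Vt j)) g (subsp_val (z : subsp (cycles It Vt j))) ->
  eigen (dop (Ht j)) g (qpi (boundaries It Vt j) z).
Proof.
move=> gz i; rewrite -(linEZ (@qpi_lin _ _ (boundaries It Vt j))).
rewrite [LHS](@quo_actE _ _ _ (boundaries It Vt j)); congr qpi.
by apply: subsp_inj; exact: gz.
Qed.

Lemma homology_supp j (h : Ht j) g : eigen (dop (Ht j)) g h -> supp g ->
  incl_homology (proj_homology h) = h.
Proof.
move=> gh sg; have lD := dop_lin (Ht j).
have := homology_span h; set P := (fun u => _) => hs.
have hev u : P u -> eigenvector (dop (Ht j)) u.
  by move=> [z [g' [gz ->]]]; exists g'; exact: qpi_eigen.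
have := lspan_eigen lD hev hs gh.
apply: (eq_on_span (linear_comp (@incl_homology_lin j) (@proj_homology_lin j)) (linear_id (V := Ht j))).
move=> u [[z [g' [gz e]]] gu].
have [->|u0] := pselect (u = 0); first by rewrite (linE0 (@proj_homology_lin j)) (linE0 (@incl_homology_lin j)).
(* The class u is nonzero and has both weights. *)
have eg : g' = g by apply: (eigen_inj _ gu u0); rewrite e; exact: qpi_eigen.
rewrite e /incl_homology /proj_homology !hmap_qpi; congr qpi; apply: subsp_inj.
by apply: (chains_supp gz); rewrite eg.
Qed.

(** Some r outside X has g r nonzero. E_rr multiplies h by this scalar and corresponds to 0
    downstairs, so a nonzero scalar kills the image of h. *)
Lemma homology_nsupp j (h : Ht j) g : eigen (dop (Ht j)) g h -> ~ supp g -> proj_homology h = 0.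
Proof.
move=> gh nsg; have [r nX gr] : exists2 r, ~~ X r & g (Some r) != 0.
  apply: contrapT => no; apply: nsg => r nX; apply/eqP; apply: contrapT => /negP gr.
  by apply: no; exists r.
have hD : homog false (toA P1 (Dhat F (Some r))) by apply: toA_homog; exact: Dhat_homog.
have h0 : homog false (0 : sub_lie P2) by exact: homog0.
have hi : intertwines proj_u proj_V (toA P1 (Dhat F (Some r))) 0.
  apply: compat_intertwines; rewrite aval_toA; first exact: compat_diag.
  exact: P1_diag.
have := hmap_act proj_u_lin proj_V_lin proj_u_pc proj_intertwines h hD h0 hi.
rewrite (linE0 (@act_linl _ _ (Hz j) _)) -[act _ h]/(dop (Ht j) (Some r) h) gh.
rewrite -[hmap _ _ _ _ _]/(proj_homology _) (linEZ (@proj_homology_lin j)) => /eqP.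
by rewrite scaler_eq0 (negbTE gr) => /eqP.
Qed.

Local Notation Hl := (u_homology Y0 M).

Lemma Hl_eigen j g (h : Ht j) : eigen (dop (Hl j)) g h <-> eigen (dop (Ht j)) g h.
Proof.
have dE i : dop (Hl j) i h = dop (Ht j) i h.
  rewrite /dop -[LHS]/(act (incl (@l_p_le F k Y0 half_all) (toA Lt (Dhat F i))) (h : Ht j)).
  by rewrite (toA_incl _ (@ltilde_diag F k Y0 i)).
by split=> gh i; [rewrite -dE | rewrite dE]; exact: gh.
Qed.

Lemma incl_homology_trunc j (h : Hz j) : trunc_sp Z (Hl j) (incl_homology h).
Proof.
(* Replacing h by the projection of its inclusion turns the claim into one about arbitrary classes
   upstairs, where weight vectors span. *)
rewrite -(incl_homologyK h); move: (incl_homology h) => {}h.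
have lfg := linear_comp (@incl_homology_lin j) (@proj_homology_lin j).
apply: (lspan_ind (V := Hl j) lfg _ (homology_span h)) => u [z [g [gz ->]]].
have gu := qpi_eigen gz.
have [sg|ng] := pselect (supp g).
  rewrite (homology_supp gu sg); apply: lspan_sub; exists (wgt g) => //.
  by apply/(wspace_eigen _ _ (@ltilde_diag F k Y0)); rewrite wgtK; apply/Hl_eigen.
by rewrite (homology_nsupp gu ng) (linE0 (@incl_homology_lin j)); exact: sp0.
Qed.

Lemma trunc_projK j (h : Ht j) : trunc_sp Z (Hl j) h -> incl_homology (proj_homology h) = h.
Proof.
have lfg := linear_comp (@incl_homology_lin j) (@proj_homology_lin j).
apply: (eq_on_span (U := Hl j) (V := Ht j) lfg (linear_id (V := Ht j))) => u [g sg].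
move=> /(wspace_eigen _ _ (@ltilde_diag F k Y0))/Hl_eigen gu.
by apply: (homology_supp gu) => r /sg.
Qed.

Lemma trunc_homology_iso j : smod_iso (T_l Z (Hl j)) (u_homology Y0 (T_g Z M) j).
Proof.
pose tv (x : T_l Z (Hl j)) : Ht j := subsp_val (x : subsp (trunc_sp Z (Hl j))).
exists (fun x => proj_homology (tv x)); split.
- exact: (linear_comp (@proj_homology_lin j) (g := tv)).
- exists (fun h => subsp_mk (incl_homology_trunc h)) => h; last exact: incl_homologyK.
  by apply: subsp_inj; apply: trunc_projK; exact: (subsp_in (h : subsp (trunc_sp Z (Hl j)))).
- by move=> b x; exact: (hmap_pc proj_u_lin proj_V_lin proj_u_pc proj_V_pc proj_intertwines).
move=> z x; rewrite -[tv (act z x)]/(act (incl (@l_p_le F k Y0 half_all)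
  (incl (@l_ltilde_le F k Y0 Z) z)) (tv x)).
rewrite -[RHS]/(act (incl (@l_p_le F k Y0 Z) z) (proj_homology (tv x))).
move: (tv x) => {x} h; move: z.
(* [hmap_act] compares homogeneous elements of equal parity. *)
apply: (@homog_ext _ (sub_lie Lz) (Hz j)
  (fun z => proj_homology (act (incl (@l_p_le F k Y0 half_all) (incl (@l_ltilde_le F k Y0 Z) z)) h))
  (fun z => act (incl (@l_p_le F k Y0 Z) z) (proj_homology h))) => [||b z hz].
- exact: (linear_comp (@proj_homology_lin j) (linear_comp (@act_linl _ _ (Ht j) h)
    (linear_comp (lh_lin (incl (@l_p_le F k Y0 half_all))) (lh_lin (incl (@l_ltilde_le F k Y0 Z)))))).
- exact: (linear_comp (@act_linl _ _ (Hz j) (proj_homology h)) (lh_lin (incl (@l_p_le F k Y0 Z)))).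
apply: (hmap_act proj_u_lin proj_V_lin proj_u_pc proj_intertwines (a := b)).
- by do 2!apply: lh_homog.
- exact: lh_homog.
by apply: compat_intertwines; apply: compat_L; exact: (subsp_in (z : subsp Lz)).
Qed.

End Truncation.

Theorem theorem4p7 (R : realType) (k : nat) (Y0 : {set 'I_k.-1}) (a : R[i])
    (M : smodule (sub_lie (gtilde R[i] k))) (hM : catO Y0 a M) (j : nat) :
  [/\ smod_iso (T_l Z_I (u_homology Y0 M j)) (u_homology Y0 (T_g Z_I M) j),
      smod_iso (T_l Z_Ibar (u_homology Y0 M j)) (u_homology Y0 (T_g Z_Ibar M) j),
      smod_iso (T_l Z_Idia (u_homology Y0 M j)) (u_homology Y0 (T_g Z_Idia M) j) &
      smod_iso (T_l Z_Ibardia (u_homology Y0 M j)) (u_homology Y0 (T_g Z_Ibardia M) j)].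
Proof.
have hspan := catO_span hM.
(* The argument is uniform in the set Z of half-integers that are kept. *)
suff iso Z : smod_iso (T_l Z (u_homology Y0 M j)) (u_homology Y0 (T_g Z M) j) by split; exact: iso.
have hev v : lspan (eigenvector (dop M)) v.
  by apply: (lspan_mono _ (hspan v)) => u [g _ hg]; apply: lspan_sub; exists g.
have [p [lp hp]] := eigen_projection (dop_lin M) (supp Z) hev.
exact: (trunc_homology_iso Y0 lp hp hspan).
Qed.
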